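(* Let $I$ be an isotopy in $\mathrm{Homeo}_0(\mathbb{A})$ from the identity to a homeomorphism $f$. Let $\gamma_0,\gamma_1,\gamma_2$ be three essential, pairwise disjoint, $f$-free Jordan curves in $\mathbb{A}$ such that $\gamma_1$ separates $\gamma_0$ from $\gamma_2$. For $i\in\{0,1\}$ let $A_i$ be the closed annulus delimited by $\gamma_i$ and $\gamma_{i+1}$, and let $A=A_0\cup A_1$. Suppose that (i) $\Theta(A_0)$ and $\Theta(A_1)$ are non-empty, and (ii) $\rho_{\Theta(A_0)}(I)$ is contained in one of the sets $(0,+\infty)$, $(-\infty,0)$ and $\rho_{\Theta(A_1)}(I)$ is contained in the other one. Then $0\in\rho_{\Theta(A)}(I)$.
   Context: $\mathbb{T}^1=\mathbb{R}/\mathbb{Z}$, $\mathbb{A}=\mathbb{T}^1\times\mathbb{R}$ is the open annulus with universal covering $\pi:\mathbb{R}^2\to\mathbb{A}$ and $p_1:\mathbb{R}^2\to\mathbb{R}$ the first coordinate projection. $\mathrm{Homeo}_0(\mathbb{A})$ is the set of homeomorphisms of $\mathbb{A}$ isotopic to the identity. For an isotopy $I=(f_t)_{t\in[0,1]}$ from the identity to $f=f_1$, let $(\tilde f_t)$ be its lift to $\mathbb{R}^2$ with $\tilde f_0=\mathrm{Id}$, and $\tilde f=\tilde f_1$. For $z\in\mathbb{A}$ and $n\ge1$, $\rho_n(z)=\frac1n(p_1(\tilde f^n(\tilde z))-p_1(\tilde z))$ with $\tilde z\in\pi^{-1}(z)$. For a compact $K\subset\mathbb{A}$, $\rho_K(I)=\bigcap_{m\ge1}\mathrm{Cl}\big(\bigcup_{n\ge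 m}\{\rho_n(z): z\in K,\ f^n(z)\in K\}\big)$, closure in $\overline{\mathbb{R}}=\mathbb{R}\cup\{\pm\infty\}$. A Jordan curve $\gamma\subset\mathbb{A}$ is essential if $\mathbb{A}\setminus\gamma$ has two unbounded connected components; it is $f$-free if $f(\gamma)\cap\gamma=\emptyset$. For $E\subset\mathbb{A}$, $\Theta(E)=\{x\in E: f^n(x)\in E\text{ for all }n\in\mathbb{Z}\}$ is the maximal invariant set of $E$. *)

(* Defs.v *)
From Stdlib Require Import Reals ZArith.
Open Scope R_scope.

(** * The open annulus A = T^1 x R, modelled on its universal cover R^2.
    A point of A is represented by any of its lifts in R^2 = R*R; a subset
    of A is represented by its (saturated) preimage in R^2.  The topology of
    A is the one of the quotient pseudo-metric [dA] below. *)

Definition pt := (R * R)%type.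

Definition dT1 (a b : R) : R :=
  let u := frac_part (a - b) in Rmin u (1 - u).

(** (pseudo-)distance on A (sup metric), = 0 iff same point of A *)
Definition dA (z w : pt) : R :=
  Rmax (dT1 (fst z) (fst w)) (Rabs (snd z - snd w)).

Definition d2 (z w : pt) : R :=
  Rmax (Rabs (fst z - fst w)) (Rabs (snd z - snd w)).

Definition Tr (z : pt) : pt := (fst z + 1, snd z).

Definition openA (U : pt -> Prop) : Prop :=
  forall z, U z -> exists eps, 0 < eps /\ forall w, dA w z < eps -> U w.

Definition connectedA (S : pt -> Prop) : Prop :=
  forall U V : pt -> Prop, openA U -> openA V ->
    (forall z, S z -> U z \/ V z) ->
    (forall z, S z -> U z -> V z -> False) ->
    (forall z, S z -> ~ U z) \/ (forall z, S z -> ~ V z).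

Definition componentA (X C : pt -> Prop) : Prop :=
  (exists z, C z) /\ (forall z, C z -> X z) /\ connectedA C /\
  (forall D, connectedA D -> (forall z, C z -> D z) -> (forall z, D z -> X z) ->
     forall z, D z -> C z).

Definition boundedA (C : pt -> Prop) : Prop :=
  exists M, forall z, C z -> Rabs (snd z) <= M.

Definition unboundedA (C : pt -> Prop) : Prop := ~ boundedA C.

(** Jordan curve in A: image of a continuous injective map T^1 -> A,
    written as a 1-periodic continuous map c : R -> A. *)
Definition jordanA (g : pt -> Prop) : Prop :=
  exists c : R -> pt,
    (forall t eps, 0 < eps -> exists delta, 0 < delta /\
        forall s, Rabs (s - t) < delta -> dA (c s) (c t) < eps) /\
    (forall s t, dA (c s) (c t) = 0 <-> exists k : Z, s - t = IZR k) /\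
    (forall z, g z <-> exists t, dA z (c t) = 0).

Definition complA (g : pt -> Prop) : pt -> Prop := fun z => ~ g z.

Definition essentialA (g : pt -> Prop) : Prop :=
  exists C1 C2, componentA (complA g) C1 /\ componentA (complA g) C2 /\
    unboundedA C1 /\ unboundedA C2 /\ exists z, C1 z /\ ~ C2 z.

Definition separatesA (g1 g0 g2 : pt -> Prop) : Prop :=
  forall C, componentA (complA g1) C ->
    ~ ((exists z, g0 z /\ C z) /\ (exists z, g2 z /\ C z)).

Definition disjointA (g g' : pt -> Prop) : Prop := forall z, g z -> g' z -> False.

Definition closed_annulus (g g' : pt -> Prop) : pt -> Prop := fun z =>
  g z \/ g' z \/
  exists C, componentA (fun w => ~ g w /\ ~ g' w) C /\ boundedA C /\ C z.

Definition unionA (E E' : pt -> Prop) : pt -> Prop := fun z => E z \/ E' z.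

Definition homeo2 (h : pt -> pt) : Prop :=
  (forall z eps, 0 < eps -> exists delta, 0 < delta /\
     forall w, d2 w z < delta -> d2 (h w) (h z) < eps) /\
  exists h' : pt -> pt, (forall z, h' (h z) = z) /\ (forall z, h (h' z) = z) /\
  (forall z eps, 0 < eps -> exists delta, 0 < delta /\
     forall w, d2 w z < delta -> d2 (h' w) (h' z) < eps).

(** F is the lift (F t = tilde f_t, F 0 = Id) of an isotopy
    I = (f_t)_{t in [0,1]} in Homeo_0(A) starting at the identity. *)
Definition isotopy_lift (F : R -> pt -> pt) : Prop :=
  (forall z, F 0 z = z) /\
  (forall t z eps, 0 <= t <= 1 -> 0 < eps -> exists delta, 0 < delta /\
     forall s w, 0 <= s <= 1 -> Rabs (s - t) < delta -> d2 w z < delta ->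
       d2 (F s w) (F t z) < eps) /\
  (forall t, 0 <= t <= 1 -> homeo2 (F t)) /\
  (forall t z, 0 <= t <= 1 -> F t (Tr z) = Tr (F t z)).

Fixpoint iter (n : nat) (h : pt -> pt) (z : pt) : pt :=
  match n with O => z | S k => h (iter k h z) end.

(** f^n for n in Z, g being the inverse of f *)
Definition iterZ (f g : pt -> pt) (n : Z) (z : pt) : pt :=
  match n with
  | Z0 => z
  | Zpos p => iter (Pos.to_nat p) f z
  | Zneg p => iter (Pos.to_nat p) g z
  end.

Definition Theta (f g : pt -> pt) (E : pt -> Prop) : pt -> Prop := fun z =>
  E z /\ forall n : Z, E (iterZ f g n z).

Inductive Rbar : Type := Fin (r : R) | PInf | MInf.

Definition rho_n (ft : pt -> pt) (n : nat) (z : pt) : R :=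
  (fst (iter n ft z) - fst z) / INR n.

Definition rho_vals (ft : pt -> pt) (K : pt -> Prop) (m : nat) (x : R) : Prop :=
  exists n z, (m <= n)%nat /\ K z /\ K (iter n ft z) /\ x = rho_n ft n z.

Definition closure_Rbar (S : R -> Prop) (x : Rbar) : Prop :=
  match x with
  | Fin r => forall eps, 0 < eps -> exists s, S s /\ Rabs (s - r) < eps
  | PInf => forall M, exists s, S s /\ M < s
  | MInf => forall M, exists s, S s /\ s < M
  end.

Definition rho_set (ft : pt -> pt) (K : pt -> Prop) (x : Rbar) : Prop :=
  forall m, (1 <= m)%nat -> closure_Rbar (rho_vals ft K m) x.

Definition in_pos (x : Rbar) : Prop := exists r, x = Fin r /\ 0 < r.
Definition in_neg (x : Rbar) : Prop := exists r, x = Fin r /\ r < 0.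

(* Main.v *)
(** A lift [th1] of an orbit that stays in the upper annulus and one, [th0], of an orbit that
    stays in the lower annulus drift in opposite horizontal directions.  If both outer curves
    are moved in the same vertical direction, say upwards, join [th0] to the upper end above the
    lower curve by a path [al], and [th1] to the lower end below the upper curve by a path [be].
    For large [N] the path [f^N(al)] meets [be]: following the isotopy, the angle of the vector
    from the orbit ending at [th1] to the orbit of [th0] turns from "left" to "right" through
    "down", because the middle curve, being free, keeps the first orbit above the second; if the
    two paths were disjoint, this angle would have to turn through "up".  If the outer curves are
    both moved inwards, the annulus is forward invariant and the intermediate value theorem
    applies to the displacement along the lower curve; the other cases follow by time reversal.
    In all cases there are orbit segments of every large length [N] inside the annulus with
    bounded total displacement, and by compactness this forces [0] into the rotation set.

    The two sides of a curve are defined by the paths that escape to the two ends of the annulus,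
    so that the Jordan curve theorem is not needed. *)

From Stdlib Require Import Reals ZArith Lra Lia Setoid Classical ClassicalEpsilon FunctionalExtensionality.
From Coquelicot Require Import Coquelicot.
Require Import Defs.
Open Scope R_scope.

(** * Continuity and compactness *)

(** The displacement bound must not depend on [N], while the isotopy to [f^N] sweeps points through
    heights that do. Hence [al] and [be] are taken in a vertical strip [|x| <= r] fixed before [N],
    and only the heights they reach are adapted to [N]; the resulting bound is [2 * r]. Angles are
    real numbers, not classes modulo a full turn: the contradiction is between the determinations
    [- 3 PI / 2] and [PI / 2] of the upward direction. The free middle curve is not invariant, so
    only one of its sides is mapped into itself by [f]; the linking is carried along a path attached
    to the orbit on that side, and then exchanged for the path needed at the end. When both outer
    curves move up, staying between them at all times up to [N] reduces to one condition at the
    first point and one at the last, which is exactly what an intersection of [f^N(al)] with [be]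
    provides. *)

Lemma continuous_pair {X Y Z : UniformSpace} (f : X -> Y) (g : X -> Z) (x : X) :
  continuous f x -> continuous g x -> continuous (fun a => (f a, g a)) x.
Proof.
  intros Hf Hg. apply (continuous_comp_2 f g pair); auto.
  apply continuous_ext with (f := fun p => p); [now intros []|apply continuous_id].
Qed.

Lemma continuous_fst_comp {X Y Z : UniformSpace} (f : X -> Y * Z) (x : X) :
  continuous f x -> continuous (fun a => fst (f a)) x.
Proof.
  intros Hf. apply (continuous_comp f fst); auto.
  destruct (f x); apply continuous_fst.
Qed.

Lemma continuous_snd_comp {X Y Z : UniformSpace} (f : X -> Y * Z) (x : X) :
  continuous f x -> continuous (fun a => snd (f a)) x.
Proof.
  intros Hf. apply (continuous_comp f snd); auto.
  destruct (f x); apply continuous_snd.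
Qed.

Lemma continuous_Rplus_comp {X : UniformSpace} (f g : X -> R) (x : X) :
  continuous f x -> continuous g x -> continuous (fun a => f a + g a) x.
Proof. apply (continuous_plus (K := R_AbsRing) (V := R_NormedModule)). Qed.

Lemma continuous_Rminus_comp {X : UniformSpace} (f g : X -> R) (x : X) :
  continuous f x -> continuous g x -> continuous (fun a => f a - g a) x.
Proof. apply (continuous_minus (K := R_AbsRing) (V := R_NormedModule)). Qed.

Lemma continuous_Rmult_comp {X : UniformSpace} (f g : X -> R) (x : X) :
  continuous f x -> continuous g x -> continuous (fun a => f a * g a) x.
Proof. apply (continuous_mult (K := R_AbsRing)). Qed.

Lemma continuous_Rdiv_comp {X : UniformSpace} (f g : X -> R) (x : X) :
  continuous f x -> continuous g x -> g x <> 0 -> continuous (fun a => f a / g a) x.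
Proof.
  intros Hf Hg H. apply continuous_Rmult_comp; auto.
  apply (continuous_comp g (fun y => / y)); auto. now apply continuous_Rinv.
Qed.

(** Retracts the line onto [[0, 1]], so that paths and isotopies known only on the unit interval
    become functions continuous on all of [R]. *)
Definition clamp (t : R) : R := Rmax 0 (Rmin 1 t).

Lemma clamp_in t : 0 <= clamp t <= 1.
Proof. unfold clamp, Rmax, Rmin; repeat destruct Rle_dec; lra. Qed.

Lemma clamp_id t : 0 <= t <= 1 -> clamp t = t.
Proof. unfold clamp, Rmax, Rmin; repeat destruct Rle_dec; lra. Qed.

Lemma clamp_lipschitz s t : Rabs (clamp s - clamp t) <= Rabs (s - t).
Proof. unfold clamp, Rmax, Rmin, Rabs; repeat destruct Rle_dec; repeat destruct Rcase_abs; lra. Qed.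

Lemma continuous_clamp (t : R) : continuous clamp t.
Proof.
  apply filterlim_locally; intros eps. exists eps. intros s Hs.
  eapply Rle_lt_trans; [apply clamp_lipschitz|exact Hs].
Qed.

Lemma continuous_clamp_comp {X : UniformSpace} (f : X -> R) (x : X) :
  continuous f x -> continuous (fun a => clamp (f a)) x.
Proof. intros Hf. apply (continuous_comp f clamp); auto. apply continuous_clamp. Qed.

Lemma continuous_comp_atan {X : UniformSpace} (f : X -> R) (x : X) :
  continuous f x -> continuous (fun a => atan (f a)) x.
Proof. intros Hf. apply (continuous_comp f atan); auto. apply continuous_atan. Qed.

Ltac ctn := intros; repeat first
  [ assumption
  | apply continuous_const
  | apply continuous_id
  | match goal with
    | H : forall x, continuous ?f x |- continuous (fun y => ?f y) _ => apply H
    | H : forall x, continuous ?f x |- continuous ?f _ => apply H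
    | H : forall x, continuous ?f x |- continuous (fun y => ?f (@?h y)) ?a =>
        apply (continuous_comp h f a); [|apply H]
    end
  | apply continuous_pair
  | match goal with
    | |- continuous (fun y => _ - _) _ => apply continuous_Rminus_comp
    | |- continuous (fun y => _ + _) _ => apply continuous_Rplus_comp
    | |- continuous (fun y => _ * _) _ => apply continuous_Rmult_comp
    | |- continuous (fun y => clamp _) _ => apply continuous_clamp_comp
    | |- continuous (fun y => fst _) _ => apply continuous_fst_comp
    | |- continuous (fun y => snd _) _ => apply continuous_snd_comp
    | |- continuous (Rmult ?c) _ => apply (continuous_Rmult_comp (fun _ => c) (fun y => y))
    | |- continuous (Rplus ?c) _ => apply (continuous_Rplus_comp (fun _ => c) (fun y => y))
    | |- continuous (Rminus ?c) _ => apply (continuous_Rminus_comp (fun _ => c) (fun y => y))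
    | |- continuous clamp _ => apply continuous_clamp
    | |- continuous fst _ => apply (continuous_fst_comp (fun p => p))
    | |- continuous snd _ => apply (continuous_snd_comp (fun p => p))
    end ].

Lemma continuous_eps {X : UniformSpace} (f : X -> R) (x : X) :
  continuous f x -> forall e, 0 < e -> locally x (fun y => Rabs (f y - f x) < e).
Proof. intros H e He. exact (proj1 (filterlim_locally f (f x)) H (mkposreal e He)). Qed.

Lemma continuous_gt {X : UniformSpace} (f : X -> R) (x : X) c :
  continuous f x -> c < f x -> locally x (fun y => c < f y).
Proof.
  intros H Hc. assert (He : 0 < f x - c) by lra.
  generalize (continuous_eps f x H _ He). apply filter_imp. intros y.
  unfold Rabs; destruct Rcase_abs; lra.
Qed.

Lemma locally_R (x : R) (P : R -> Prop) :
  locally x P <-> exists e, 0 < e /\ forall y, Rabs (y - x) < e -> P y.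
Proof.
  split.
  - intros [e He]. exists e; split; [apply cond_pos|exact He].
  - intros [e [H He]]. exists (mkposreal e H). exact He.
Qed.

Lemma d2_lt (w z : pt) e : d2 w z < e <-> Rabs (fst w - fst z) < e /\ Rabs (snd w - snd z) < e.
Proof. unfold d2, Rmax; destruct Rle_dec; lra. Qed.

Lemma locally_pt (z : pt) (P : pt -> Prop) :
  locally z P <-> exists e, 0 < e /\ forall w, d2 w z < e -> P w.
Proof.
  split.
  - intros [e He]. exists e; split; [apply cond_pos|].
    intros w Hw. apply He. apply d2_lt in Hw. exact Hw.
  - intros [e [H He]]. exists (mkposreal e H). intros w Hw. apply He, d2_lt. exact Hw.
Qed.

Lemma continuous_pt (h : pt -> pt) (z : pt) :
  continuous h z <-> forall eps, 0 < eps -> exists delta, 0 < delta /\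
    forall w, d2 w z < delta -> d2 (h w) (h z) < eps.
Proof.
  split.
  - intros H e He. apply locally_pt.
    generalize (proj1 (filterlim_locally h (h z)) H (mkposreal e He)).
    apply filter_imp. intros w Hw. apply d2_lt. exact Hw.
  - intros H. apply filterlim_locally. intros e. apply locally_pt.
    destruct (H e (cond_pos e)) as [d [Hd Hw]]. exists d; split; auto.
    intros w Hdw. specialize (Hw w Hdw). apply d2_lt in Hw. exact Hw.
Qed.

Lemma interval_connected (Q : R -> Prop) :
  (forall t, 0 <= t <= 1 -> Q t -> exists e, 0 < e /\
     forall s, 0 <= s <= 1 -> Rabs (s - t) < e -> Q s) ->
  (forall t, 0 <= t <= 1 -> ~ Q t -> exists e, 0 < e /\
     forall s, 0 <= s <= 1 -> Rabs (s - t) < e -> ~ Q s) ->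
  Q 0 -> forall t, 0 <= t <= 1 -> Q t.
Proof.
  intros HO HC H0 t Ht. apply NNPP. intros Hn.
  set (E := fun s => 0 <= s <= t /\ forall r, 0 <= r <= s -> Q r).
  destruct (completeness E) as [l [Hub Hlub]].
  { exists t. intros s Hs. apply Hs. }
  { exists 0. split; [lra|]. intros r Hr. replace r with 0 by lra. exact H0. }
  assert (Hl0 : 0 <= l). { apply Hub. split; [lra|]. intros r Hr. replace r with 0 by lra. exact H0. }
  assert (Hlt : l <= t). { apply Hlub. intros s Hs. apply Hs. }
  assert (Hbelow : forall r, 0 <= r < l -> Q r).
  { intros r Hr. apply NNPP. intros Hq.
    enough (l <= r) by lra. apply Hlub. intros s [Hs1 Hs2].
    destruct (Rle_dec s r); auto. exfalso. apply Hq, Hs2. lra. }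
  destruct (classic (Q l)) as [Ql|Ql].
  - destruct (HO l ltac:(lra) Ql) as [e [He Hs]].
    assert (l < t) by (destruct (Req_dec l t); [subst; tauto|lra]).
    assert (E (Rmin t (l + e / 2))).
    { split; [unfold Rmin; destruct Rle_dec; lra|].
      intros r Hr. destruct (Rlt_dec r l). { apply Hbelow; lra. }
      assert (r <= l + e / 2) by (revert Hr; unfold Rmin; destruct Rle_dec; lra).
      assert (r <= t) by (revert Hr; unfold Rmin; destruct Rle_dec; lra).
      apply Hs; [lra|]. apply Rabs_def1; lra. }
    specialize (Hub _ H1). revert Hub. unfold Rmin; destruct Rle_dec; lra.
  - destruct (HC l ltac:(lra) Ql) as [e [He Hs]].
    assert (0 < l) by (destruct (Req_dec l 0); [subst; tauto|lra]).
    set (r := Rmax 0 (l - e / 2)).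
    assert (0 <= r < l /\ l - e < r) by (unfold r, Rmax; destruct Rle_dec; lra).
    apply (Hs r); [lra|apply Rabs_def1; lra|apply Hbelow; lra].
Qed.

(** Compactness of [[0, 1]] drawn from connectedness: the times [t] for which one bound serves all
    of [[0, t]] form a relatively open and closed set. Monotony in [H] lets two local bounds be
    merged. *)
Lemma interval_uniform (P : R -> R -> Prop) :
  (forall H H' t, H <= H' -> P H t -> P H' t) ->
  (forall t, 0 <= t <= 1 -> exists e H, 0 < e /\
     forall s, 0 <= s <= 1 -> Rabs (s - t) < e -> P H s) ->
  exists H, forall t, 0 <= t <= 1 -> P H t.
Proof.
  intros Hm HL.
  assert (HL' : forall t, 0 <= t <= 1 -> exists e, 0 < e /\
    forall s s', 0 <= s <= 1 -> 0 <= s' <= 1 -> Rabs (s - t) < e -> Rabs (s' - t) < e ->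
    (exists H, forall r, 0 <= r <= s -> P H r) -> exists H, forall r, 0 <= r <= s' -> P H r).
  { intros t Ht. destruct (HL t Ht) as [e [H [He HP]]]. exists e; split; auto.
    intros s s' Hs Hs' Hst Hst' [H' HQ]. exists (Rmax H H'). intros r Hr.
    destruct (Rle_dec r s).
    - apply Hm with H'; [apply Rmax_r|]. apply HQ; lra.
    - apply Hm with H; [apply Rmax_l|]. apply HP; [lra|].
      revert Hst Hst'; unfold Rabs; repeat destruct Rcase_abs; lra. }
  assert (HQ := interval_connected (fun t => exists H, forall r, 0 <= r <= t -> P H r)).
  destruct HQ with (t := 1) as [H HH]; try lra.
  - intros t Ht Hq. destruct (HL' t Ht) as [e [He HP]]. exists e; split; auto.
    intros s Hs Hst. apply (HP t s); auto. rewrite Rminus_diag, Rabs_R0; lra.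
  - intros t Ht Hq. destruct (HL' t Ht) as [e [He HP]]. exists e; split; auto.
    intros s Hs Hst Hqs. apply Hq. apply (HP s t); auto. rewrite Rminus_diag, Rabs_R0; lra.
  - destruct (HL 0 ltac:(lra)) as [e [H [He HP]]]. exists H. intros r Hr.
    apply HP; [lra|]. replace (r - 0) with 0 by lra. rewrite Rabs_R0; lra.
  - exists H. exact HH.
Qed.

Lemma continuous_interval_bounded (f : R -> R) :
  (forall t, continuous f t) -> exists M, forall t, 0 <= t <= 1 -> Rabs (f t) <= M.
Proof.
  intros Hf. apply (interval_uniform (fun M t => Rabs (f t) <= M)).
  - intros; lra.
  - intros t Ht. destruct (proj1 (locally_R t _) (continuous_eps f t (Hf t) 1 Rlt_0_1)) as [e [He Hs]].
    exists e, (Rabs (f t) + 1). split; auto. intros s _ Hst. specialize (Hs s Hst).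
    revert Hs; unfold Rabs; repeat destruct Rcase_abs; lra.
Qed.

Lemma interval_cluster (u : nat -> R) a b :
  (forall n, a <= u n <= b) ->
  exists x, a <= x <= b /\ forall e, 0 < e -> forall N, exists n, (N <= n)%nat /\ Rabs (u n - x) < e.
Proof.
  intros Hu.
  destruct (Bolzano_Weierstrass u (fun c => a <= c <= b) (compact_P3 a b) Hu) as [x Hx].
  assert (HC : forall e, 0 < e -> forall N, exists n, (N <= n)%nat /\ Rabs (u n - x) < e).
  { intros e He N. destruct (Hx (disc x (mkposreal e He)) N) as [n [Hn Hd]].
    - exists (mkposreal e He). intros y Hy; exact Hy.
    - exists n; split; auto. }
  exists x; split; auto.
  split; apply Rnot_lt_le; intros Hlt.
  - destruct (HC (a - x) ltac:(lra) 0%nat) as [n [_ Hn]].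
    specialize (Hu n). revert Hn; unfold Rabs; destruct Rcase_abs; lra.
  - destruct (HC (x - b) ltac:(lra) 0%nat) as [n [_ Hn]].
    specialize (Hu n). revert Hn; unfold Rabs; destruct Rcase_abs; lra.
Qed.

(** Bolzano-Weierstrass is applied twice, the second time to the ordinates along a chosen
    subsequence whose abscissae converge. *)
Lemma rectangle_cluster (u : nat -> pt) a b c d :
  (forall n, a <= fst (u n) <= b /\ c <= snd (u n) <= d) ->
  exists z : pt, (a <= fst z <= b /\ c <= snd z <= d) /\
    forall P, locally z P -> forall N, exists n, (N <= n)%nat /\ P (u n).
Proof.
  intros Hu.
  destruct (interval_cluster (fun n => fst (u n)) a b) as [x [Hx HCx]]; [intros n; apply Hu|].
  assert (HS : forall k, { n | (k <= n)%nat /\ Rabs (fst (u n) - x) < / INR (S k) }).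
  { intros k. apply constructive_indefinite_description.
    apply HCx. apply Rinv_0_lt_compat, lt_0_INR; lia. }
  destruct (interval_cluster (fun k => snd (u (proj1_sig (HS k)))) c d) as [y [Hy HCy]];
    [intros k; apply Hu|].
  exists (x, y). split; [simpl; auto|].
  intros P HP N. apply locally_pt in HP. destruct HP as [e [He HP]].
  destruct (archimed_cor1 e He) as [K [HK HK0]].
  destruct (HCy e He (Nat.max N K)) as [k [Hk Hyk]].
  destruct (proj2_sig (HS k)) as [Hk1 Hk2].
  exists (proj1_sig (HS k)). split; [lia|].
  apply HP, d2_lt. simpl. split; [|exact Hyk].
  eapply Rlt_trans; [exact Hk2|]. eapply Rle_lt_trans; [|exact HK].
  apply Rinv_le_contravar; [apply lt_0_INR; lia|apply le_INR; lia].
Qed.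

(** * Continuous determinations of the angle *)

Definition is_angle (v : pt) (a : R) : Prop :=
  exists r, 0 < r /\ fst v = r * cos a /\ snd v = r * sin a.

Definition dot (p q : pt) : R := fst p * fst q + snd p * snd q.
Definition cross (p q : pt) : R := fst p * snd q - snd p * fst q.

(** When the scalar product is positive, [atan (cross p q / dot p q)] is the signed angle from [p]
    to [q]. *)
Lemma is_angle_step p q a :
  is_angle p a -> 0 < dot p q -> is_angle q (a + atan (cross p q / dot p q)).
Proof.
  intros [r [Hr [Hx Hy]]] Hd. set (b := atan (cross p q / dot p q)).
  assert (Hcb : 0 < cos b).
  { generalize (atan_bound (cross p q / dot p q)); fold b; intros. apply cos_gt_0; lra. }
  assert (Ht : sin b * dot p q = cos b * cross p q).
  { assert (T : tan b = cross p q / dot p q) by apply tan_atan.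
    unfold tan in T. field_simplify_eq in T; [lra|lra]. }
  assert (S1 : (sin a)² + (cos a)² = 1) by apply sin2_cos2. unfold Rsqr in S1.
  exists (dot p q / (r * cos b)). split.
  { apply Rdiv_lt_0_compat; auto. apply Rmult_lt_0_compat; auto. }
  assert (Hk : cos b * (dot p q / (r * cos b)) = cos a * fst q + sin a * snd q).
  { unfold dot. rewrite Hx, Hy. field. lra. }
  assert (Hk' : sin b * (dot p q / (r * cos b)) = cos a * snd q - sin a * fst q).
  { replace (sin b * (dot p q / (r * cos b))) with ((sin b * dot p q) / (r * cos b)) by (field; lra).
    rewrite Ht. unfold cross. rewrite Hx, Hy. field. lra. }
  rewrite cos_plus, sin_plus. set (k := dot p q / (r * cos b)) in *.
  split.
  - replace (k * (cos a * cos b - sin a * sin b))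
      with (cos a * (cos b * k) - sin a * (sin b * k)) by ring.
    rewrite Hk, Hk'. replace (fst q) with ((sin a * sin a + cos a * cos a) * fst q) at 1 by (rewrite S1; ring). ring.
  - replace (k * (sin a * cos b + cos a * sin b))
      with (sin a * (cos b * k) + cos a * (sin b * k)) by ring.
    rewrite Hk, Hk'. replace (snd q) with ((sin a * sin a + cos a * cos a) * snd q) at 1 by (rewrite S1; ring). ring.
Qed.

Lemma is_angle_near (v : pt) a :
  0 < dot (cos a, sin a) v -> exists b, is_angle v b /\ a - PI / 2 < b < a + PI / 2.
Proof.
  intros H. eexists. split.
  - apply (is_angle_step (cos a, sin a) v a); auto. exists 1. simpl. lra.
  - generalize (atan_bound (cross (cos a, sin a) v / dot (cos a, sin a) v)). lra.
Qed.

Definition angle_lift (V : R -> pt) (A B : R) : Prop :=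
  exists th : R -> R, (forall s, continuous th s) /\ th 0 = A /\ th 1 = B /\
    forall s, 0 <= s <= 1 -> is_angle (V s) (th s).

Lemma IVT_unit (f : R -> R) y :
  (forall s, continuous f s) -> f 0 <= y <= f 1 -> exists s, 0 <= s <= 1 /\ f s = y.
Proof.
  intros Hf Hy. destruct (IVT_gen_consistent f 0 1 y) as [s [Hs Hfs]]; auto.
  { unfold Rmin, Rmax; repeat destruct Rle_dec; lra. }
  exists s; split; auto. revert Hs; unfold Rmin, Rmax; repeat destruct Rle_dec; lra.
Qed.

Lemma IVT_unit_any (f : R -> R) y :
  (forall s, continuous f s) -> (f 0 <= y <= f 1 \/ f 1 <= y <= f 0) ->
  exists s, 0 <= s <= 1 /\ f s = y.
Proof.
  intros Hf [Hy|Hy]; [now apply IVT_unit|].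
  destruct (IVT_unit (fun s => - f s) (- y)) as [s [Hs E]]; [|lra|exists s; lra].
  intros s. apply continuous_ext with (f := fun s => 0 - f s); [intros; lra|ctn].
Qed.

Lemma is_angle_unique v a b : is_angle v a -> is_angle v b -> cos (a - b) = 1.
Proof.
  intros [r [Hr [Hx Hy]]] [q [Hq [Hx' Hy']]].
  assert (S1 : (sin a)² + (cos a)² = 1) by apply sin2_cos2. unfold Rsqr in S1.
  assert (S2 : (sin b)² + (cos b)² = 1) by apply sin2_cos2. unfold Rsqr in S2.
  assert (E : r * r = q * q).
  { transitivity (r * r * (sin a * sin a + cos a * cos a)). rewrite S1; ring.
    transitivity (fst v * fst v + snd v * snd v). rewrite Hx, Hy; ring.
    rewrite Hx', Hy'. transitivity (q * q * (sin b * sin b + cos b * cos b)); [ring|rewrite S2; ring]. }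
  assert (r = q) by nra. subst q.
  rewrite Hx in Hx'. rewrite Hy in Hy'.
  apply Rmult_eq_reg_l in Hx'; [|lra]. apply Rmult_eq_reg_l in Hy'; [|lra].
  rewrite cos_minus, Hx', Hy'. lra.
Qed.

(** Two lifts differ by a continuous function that vanishes at 0 and has cosine 1; if it did not end
    at 0, it would take a value of modulus in [(0, PI]], where the cosine is not 1. *)
Lemma angle_lift_unique V A B B' : angle_lift V A B -> angle_lift V A B' -> B = B'.
Proof.
  intros [t [Ct [T0 [T1 HT]]]] [t' [Ct' [T0' [T1' HT']]]].
  set (D := fun s => t s - t' s).
  assert (CD : forall s, continuous D s) by (unfold D; ctn).
  assert (HD : forall s, 0 <= s <= 1 -> cos (D s) = 1).
  { intros s Hs. apply (is_angle_unique (V s)); auto. }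
  assert (D0 : D 0 = 0) by (unfold D; lra).
  assert (P := PI_RGT_0).
  assert (Hc : forall c, 0 < c <= PI -> cos c <> 1).
  { intros c Hc E. assert (cos c < cos 0) by (apply cos_decreasing_1; lra).
    rewrite cos_0 in *. lra. }
  destruct (Rtotal_order (D 1) 0) as [H|[H|H]]; [|unfold D in H; lra|].
  - exfalso. set (c := Rmin (- D 1) PI).
    assert (0 < c <= PI /\ c <= - D 1) by (unfold c, Rmin; destruct Rle_dec; lra).
    destruct (IVT_unit_any D (- c)) as [s [Hs E]]; auto; [lra|].
    apply (Hc c); [lra|]. rewrite <- (HD s Hs), E, cos_neg. reflexivity.
  - exfalso. set (c := Rmin (D 1) PI).
    assert (0 < c <= PI /\ c <= D 1) by (unfold c, Rmin; destruct Rle_dec; lra).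
    destruct (IVT_unit_any D c) as [s [Hs E]]; auto; [lra|].
    apply (Hc c); [lra|]. rewrite <- (HD s Hs), E. reflexivity.
Qed.

Lemma angle_lift_angles V A B : angle_lift V A B -> is_angle (V 0) A /\ is_angle (V 1) B.
Proof. intros [t [Ct [T0 [T1 HT]]]]. subst. split; apply HT; lra. Qed.

(** A window of real numbers, not of classes modulo [2 * PI]: it records both that a vector points
    into the open half-plane around the direction [c] and which determination of its angle is
    meant. *)
Definition near (c a : R) : Prop := c - PI / 2 < a < c + PI / 2.

Lemma dot_angle c v a : is_angle v a -> exists r, 0 < r /\ dot (cos c, sin c) v = r * cos (a - c).
Proof.
  intros [r [Hr [Hx Hy]]]. exists r. split; auto. unfold dot; simpl. rewrite Hx, Hy, cos_minus. ring.
Qed.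

(** A vector in the open half-plane around [c] never has the angle [c + PI / 2] or [c - PI / 2], so
    a continuous determination can neither enter nor leave the window. *)
Lemma angle_lift_half_plane V A B c :
  angle_lift V A B -> (forall s, 0 <= s <= 1 -> 0 < dot (cos c, sin c) (V s)) ->
  (near c A <-> near c B).
Proof.
  intros [t [Ct [T0 [T1 HT]]]] HV. subst A B.
  assert (HC : forall s, 0 <= s <= 1 -> 0 < cos (t s - c)).
  { intros s Hs. destruct (dot_angle c _ _ (HT s Hs)) as [r [Hr E]].
    specialize (HV s Hs). rewrite E in HV. nra. }
  assert (Hno : forall s, 0 <= s <= 1 -> t s <> c + PI / 2 /\ t s <> c - PI / 2).
  { intros s Hs. specialize (HC s Hs). split; intros E; rewrite E in HC.
    - replace (c + PI / 2 - c) with (PI / 2) in HC by lra. rewrite cos_PI2 in HC; lra.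
    - replace (c - PI / 2 - c) with (- (PI / 2)) in HC by lra. rewrite cos_neg, cos_PI2 in HC; lra. }
  assert (P := PI_RGT_0). unfold near.
  assert (Hup : forall y, (t 0 <= y <= t 1 \/ t 1 <= y <= t 0) -> y <> c + PI / 2 /\ y <> c - PI / 2).
  { intros y Hy. destruct (IVT_unit_any t y) as [s [Hs E]]; auto. rewrite <- E. auto. }
  assert (Hn0 := Hno 0 ltac:(lra)). assert (Hn1 := Hno 1 ltac:(lra)).
  split; intros Hn; apply NNPP; intros Hc.
  - destruct (Rle_dec (c + PI / 2) (t 1)).
    + destruct (Hup (c + PI / 2)); [lra|tauto].
    + destruct (Hup (c - PI / 2)); [lra|tauto].
  - destruct (Rle_dec (c + PI / 2) (t 0)).
    + destruct (Hup (c + PI / 2)); [lra|tauto].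
    + destruct (Hup (c - PI / 2)); [lra|tauto].
Qed.

Section Square.
Variable V : R -> R -> pt.
Hypothesis V_continuous : forall p : R * R, continuous (fun p : R * R => V (fst p) (snd p)) p.
Hypothesis V_nonzero : forall s t, 0 <= s <= 1 -> 0 <= t <= 1 -> V s t <> (0, 0).

(** Uniform continuity in the form needed for angles. Otherwise bad pairs of points at distance
    below [/ INR (S n)] accumulate at a diagonal point [(z, z)], where the product is the squared
    norm of a nonzero vector. *)
Lemma square_step_positive : exists d, 0 < d /\
  forall s t s' t', 0 <= s <= 1 -> 0 <= t <= 1 -> 0 <= s' <= 1 -> 0 <= t' <= 1 ->
    Rabs (s' - s) < d -> Rabs (t' - t) < d -> 0 < dot (V s t) (V s' t').
Proof.
  apply NNPP. intros Hn.
  set (bad := fun n (q : pt * pt) =>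
    (0 <= fst (fst q) <= 1 /\ 0 <= snd (fst q) <= 1) /\
    d2 (snd q) (fst q) < / INR (S n) /\
    dot (V (fst (fst q)) (snd (fst q))) (V (fst (snd q)) (snd (snd q))) <= 0).
  assert (HS : forall n, { q | bad n q }).
  { intros n. apply constructive_indefinite_description. apply NNPP. intros Hq. apply Hn.
    exists (/ INR (S n)). split; [apply Rinv_0_lt_compat, lt_0_INR; lia|].
    intros s t s' t' Hs Ht Hs' Ht' H1 H2. apply Rnot_le_lt. intros Hd. apply Hq.
    exists ((s, t), (s', t')). unfold bad; simpl. repeat split; try tauto.
    apply d2_lt; simpl; auto. }
  destruct (rectangle_cluster (fun n => fst (proj1_sig (HS n))) 0 1 0 1) as [z [[Hz1 Hz2] HC]].
  { intros n. apply (proj2_sig (HS n)). }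
  set (W := fun p : pt => V (fst p) (snd p)).
  set (g := fun q : pt * pt => dot (W (fst q)) (W (snd q))).
  assert (Cg : continuous g (z, z)).
  { assert (CW : forall p : pt, continuous W p) by exact V_continuous.
    unfold g, dot. apply (continuous_Rplus_comp (X := prod_UniformSpace (prod_UniformSpace R_UniformSpace R_UniformSpace) (prod_UniformSpace R_UniformSpace R_UniformSpace))); ctn. }
  assert (Hg : 0 < g (z, z)).
  { unfold g, dot; simpl. assert (Hnz := V_nonzero (fst z) (snd z) Hz1 Hz2).
    fold (W z) in Hnz. destruct (W z) as [a b]; simpl.
    destruct (Req_dec a 0); destruct (Req_dec b 0); try nra. subst; tauto. }
  destruct (continuous_gt g (z, z) 0 Cg Hg) as [e He].
  destruct (archimed_cor1 (e / 2)) as [K [HK HK0]]; [generalize (cond_pos e); lra|].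
  destruct (HC (fun w => d2 w z < e / 2)) with (N := K) as [n [Hn1 Hn2]].
  { apply locally_pt. exists (e / 2). split; auto. generalize (cond_pos e); lra. }
  destruct (proj2_sig (HS n)) as [_ [Hb1 Hb2]].
  set (q := proj1_sig (HS n)) in *.
  assert (Hd : d2 (snd q) (fst q) < e / 2).
  { eapply Rlt_trans; [exact Hb1|]. eapply Rle_lt_trans; [|exact HK].
    apply Rinv_le_contravar; [apply lt_0_INR; lia|apply le_INR; lia]. }
  apply d2_lt in Hn2. apply d2_lt in Hd.
  assert (Hp := cond_pos e).
  specialize (He q). unfold g, W in He.
  enough (0 < dot (V (fst (fst q)) (snd (fst q))) (V (fst (snd q)) (snd (snd q)))) by lra.
  apply He. clearbody q. clear - Hn2 Hd Hp.
  split; split; simpl;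
  match goal with |- ball ?a ?r ?b => change (Rabs (b - a) < r) end;
  destruct Hn2 as [A1 A2]; destruct Hd as [B1 B2];
  apply Rabs_def2 in A1; apply Rabs_def2 in A2; apply Rabs_def2 in B1; apply Rabs_def2 in B2;
  unfold pt in *; apply Rabs_def1; lra.
Qed.

(* Sum of the small angles between the values of [V] at consecutive points of the
   subdivision of the segment from the origin to [(clamp s, clamp t)]. *)
Fixpoint ray_angle (A : R) (m i : nat) (p : R * R) : R :=
  match i with
  | O => A
  | S j =>
      let v k := V (INR k / INR m * clamp (fst p)) (INR k / INR m * clamp (snd p)) in
      ray_angle A m j p + atan (cross (v j) (v (S j)) / dot (v j) (v (S j)))
  end.

(** The angle at a point is [A] plus the small turns along the ray leading to it. By uniform
    continuity the same number [m] of steps serves all rays, so this is a finite sum of continuous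
    terms. *)
Lemma square_angle A : is_angle (V 0 0) A ->
  exists th : R * R -> R, (forall p, continuous th p) /\ th (0, 0) = A /\
    forall s t, 0 <= s <= 1 -> 0 <= t <= 1 -> is_angle (V s t) (th (s, t)).
Proof.
  intros HA. destruct square_step_positive as [d [Hd Hpos]].
  destruct (archimed_cor1 d Hd) as [m [Hm Hm0]].
  assert (Im : 0 < INR m) by (apply lt_0_INR; lia).
  assert (Hfr : forall k x, (k <= m)%nat -> 0 <= x <= 1 -> 0 <= INR k / INR m * x <= 1).
  { intros k x Hk Hx. assert (0 <= INR k / INR m <= 1).
    { split; [apply Rdiv_le_0_compat; auto; apply pos_INR|].
      apply Rle_div_l; auto. rewrite Rmult_1_l. apply le_INR; auto. }
    nra. }
  assert (Hst : forall k x, 0 <= x <= 1 -> Rabs (INR (S k) / INR m * x - INR k / INR m * x) < d).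
  { intros k x Hx. replace (INR (S k) / INR m * x - INR k / INR m * x) with (/ INR m * x)
      by (rewrite S_INR; field; lra).
    assert (0 < / INR m) by now apply Rinv_0_lt_compat.
    rewrite Rabs_pos_eq; nra. }
  set (v := fun k (p : R * R) => V (INR k / INR m * clamp (fst p)) (INR k / INR m * clamp (snd p))).
  assert (Hdot : forall k p, (k < m)%nat -> 0 < dot (v k p) (v (S k) p)).
  { intros k p Hk. assert (H1 := clamp_in (fst p)). assert (H2 := clamp_in (snd p)).
    apply Hpos; try apply Hfr; try apply Hst; auto; lia. }
  assert (Cv : forall k (p : R * R), continuous (v k) p).
  { intros k p. unfold v.
    apply (continuous_comp (fun p : R * R => (INR k / INR m * clamp (fst p), INR k / INR m * clamp (snd p)))
      (fun q : R * R => V (fst q) (snd q))); [|apply V_continuous].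
    ctn. }
  exists (ray_angle A m m). split; [|split].
  - enough (forall i, (i <= m)%nat -> forall p : R * R, continuous (ray_angle A m i) p) by auto.
    induction i as [|i IH]; intros Hi p; simpl; [apply continuous_const|].
    apply continuous_Rplus_comp; [apply IH; lia|].
    apply continuous_comp_atan.
    change (continuous (fun p => cross (v i p) (v (S i) p) / dot (v i p) (v (S i) p)) p).
    assert (C0 := Cv i). assert (C1 := Cv (S i)).
    apply continuous_Rdiv_comp; [unfold cross; ctn|unfold dot; ctn|].
    assert (H := Hdot i p ltac:(lia)). lra.
  - enough (forall i, (i <= m)%nat -> ray_angle A m i (0, 0) = A) by auto.
    induction i as [|i IH]; intros Hi; simpl; auto. rewrite IH by lia.
    rewrite clamp_id by lra. rewrite !Rmult_0_r. unfold cross.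
    replace (_ - _) with 0 by ring. unfold Rdiv. rewrite Rmult_0_l, atan_0. lra.
  - intros s t Hs Ht.
    assert (E : forall i, (i <= m)%nat -> is_angle (v i (s, t)) (ray_angle A m i (s, t))).
    { induction i as [|i IH]; intros Hi.
      - unfold v; simpl. unfold Rdiv. rewrite !Rmult_0_l. exact HA.
      - simpl ray_angle. apply (is_angle_step (v i (s, t))); [apply IH; lia|apply Hdot; lia]. }
    specialize (E m (le_n m)). unfold v in E; simpl in E.
    rewrite !clamp_id in E by lra.
    replace (INR m / INR m) with 1 in E by (field; lra). rewrite !Rmult_1_l in E. exact E.
Qed.

(** One angle function restricted to the four sides gives lifts that agree at the corners, so both
    ways round the square lead to the same value [D]. This is the homotopy invariance behind the
    linking argument. *)
Lemma angle_lift_square A : is_angle (V 0 0) A -> exists B C D,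
  angle_lift (fun s => V s 0) A B /\ angle_lift (fun t => V 0 t) A C /\
  angle_lift (fun t => V 1 t) B D /\ angle_lift (fun s => V s 1) C D.
Proof.
  intros HA. destruct (square_angle A HA) as [th [Cth [H0 Hth]]].
  exists (th (1, 0)), (th (0, 1)), (th (1, 1)).
  split; [|split; [|split]].
  - exists (fun s => th (s, 0)). split; [ctn|]. repeat split; auto. intros; apply Hth; lra.
  - exists (fun s => th (0, s)). split; [ctn|]. repeat split; auto. intros; apply Hth; lra.
  - exists (fun s => th (1, s)). split; [ctn|]. repeat split; auto. intros; apply Hth; lra.
  - exists (fun s => th (s, 1)). split; [ctn|]. repeat split; auto. intros; apply Hth; lra.
Qed.
End Square.

Lemma angle_lift_exists (V : R -> pt) A :
  (forall s, continuous V s) -> (forall s, 0 <= s <= 1 -> V s <> (0, 0)) ->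
  is_angle (V 0) A -> exists B, angle_lift V A B.
Proof.
  intros CV HV HA. destruct (angle_lift_square (fun s _ => V s)) with (A := A) as [B [C [D [H _]]]]; auto.
  - intros p. ctn.
  - exists B; exact H.
Qed.

(** * The two sides of an essential continuum *)

Definition Tn (k : Z) (z : pt) : pt := (fst z + IZR k, snd z).

Lemma Tn_Tn j k z : Tn j (Tn k z) = Tn (k + j) z.
Proof. unfold Tn; simpl. rewrite plus_IZR. f_equal; ring. Qed.

Lemma Tn_0 z : Tn 0 z = z.
Proof. destruct z; unfold Tn; simpl. f_equal; ring. Qed.

Lemma Tn_opp k z : Tn k (Tn (- k) z) = z.
Proof. rewrite Tn_Tn. replace (- k + k)%Z with 0%Z by lia. apply Tn_0. Qed.

Lemma Tn_unit z : exists k, 0 <= fst (Tn k z) <= 1.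
Proof.
  exists (- Int_part (fst z))%Z. unfold Tn; simpl. rewrite opp_IZR.
  destruct (base_Int_part (fst z)). lra.
Qed.

Lemma d2_Tn k w z : d2 (Tn k w) (Tn k z) = d2 w z.
Proof.
  unfold d2, Tn; simpl.
  replace (fst w + IZR k - (fst z + IZR k)) with (fst w - fst z) by ring. reflexivity.
Qed.

Definition invariant (P : pt -> Prop) : Prop := forall k z, P (Tn k z) <-> P z.

Definition vshift (t : R) (z : pt) : pt := (fst z, snd z + t).

Definition reach (g : pt -> Prop) (z w : pt) : Prop :=
  exists p : R -> pt, (forall s, continuous p s) /\ p 0 = z /\ p 1 = w /\
    forall s, 0 <= s <= 1 -> ~ g (p s).

(** The part of the complement adjoining the upper end ([sg = 1]) or the lower end ([sg = -1]), the
    vertical ray being an explicit access to that end. The two sides are not claimed to fill the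
    complement. *)
Definition side (sg : R) (g : pt -> Prop) (z : pt) : Prop :=
  exists w, reach g z w /\ forall t, 0 <= t -> ~ g (vshift (sg * t) w).

(* The properties of essential Jordan curves that survive without the Jordan curve theorem. *)
Record essential_continuum (g : pt -> Prop) : Prop := {
  ec_invariant : invariant g;
  ec_closed : forall z, ~ g z -> locally z (fun w => ~ g w);
  ec_bounded : exists M, 0 <= M /\ forall z, g z -> Rabs (snd z) <= M;
  ec_connected : forall P : pt -> Prop, invariant P ->
    (forall z, g z -> P z -> locally z P) ->
    (forall z, g z -> ~ P z -> locally z (fun w => ~ P w)) ->
    (forall z, g z -> P z) \/ (forall z, g z -> ~ P z);
  ec_separating : forall z, side 1 g z -> side (-1) g z -> False }.

Definition sign (sg : R) : Prop := sg = 1 \/ sg = -1.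

Lemma sign_opp sg : sign sg -> sign (- sg).
Proof. unfold sign; lra. Qed.

Lemma ec_sides g sg z : essential_continuum g -> sign sg -> side sg g z -> side (- sg) g z -> False.
Proof.
  intros E [->| ->] H1 H2.
  - apply (ec_separating g E z); auto.
  - apply (ec_separating g E z); auto. replace 1 with (- -1) by ring. auto.
Qed.

Definition seg (z w : pt) (s : R) : pt :=
  (fst z + s * (fst w - fst z), snd z + s * (snd w - snd z)).

Lemma seg_continuous z w s : continuous (seg z w) s.
Proof. unfold seg. ctn. Qed.

Lemma seg_0 z w : seg z w 0 = z.
Proof. destruct z; unfold seg; simpl; f_equal; ring. Qed.

Lemma seg_1 z w : seg z w 1 = w.
Proof. destruct z, w; unfold seg; simpl; f_equal; ring. Qed.

Lemma reach_seg g z w : (forall s, 0 <= s <= 1 -> ~ g (seg z w s)) -> reach g z w.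
Proof.
  intros H. exists (seg z w). split; [apply seg_continuous|].
  split; [apply seg_0|split; [apply seg_1|auto]].
Qed.

Lemma reach_refl (g : pt -> Prop) z : ~ g z -> reach g z z.
Proof. intros H. exists (fun _ => z). split; [ctn|]. auto. Qed.

Lemma reach_start g z w : reach g z w -> ~ g z.
Proof. intros [p [_ [<- [_ H]]]]. apply H; lra. Qed.

Lemma reach_sym g z w : reach g z w -> reach g w z.
Proof.
  intros [p [Cp [H0 [H1 H]]]]. exists (fun s => p (1 - s)). split; [ctn|].
  repeat split.
  - now rewrite Rminus_0_r.
  - now replace (1 - 1) with 0 by ring.
  - intros s Hs. apply H; lra.
Qed.

Lemma reach_trans g z w v : reach g z w -> reach g w v -> reach g z v.
Proof.
  intros [p [Cp [H0 [H1 H]]]] [q [Cq [K0 [K1 K]]]].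
  (* Concatenation without case distinction: at every time one of the two clamped paths sits at [w],
     which the subtraction cancels. *)
  exists (fun s => (fst (p (clamp (2 * s))) + fst (q (clamp (2 * s - 1))) - fst w,
                    snd (p (clamp (2 * s))) + snd (q (clamp (2 * s - 1))) - snd w)).
  assert (L : forall s, s <= 1 / 2 -> clamp (2 * s - 1) = 0).
  { intros s Hs. unfold clamp, Rmax, Rmin; repeat destruct Rle_dec; lra. }
  assert (L' : forall s, 1 / 2 <= s -> clamp (2 * s) = 1).
  { intros s Hs. unfold clamp, Rmax, Rmin; repeat destruct Rle_dec; lra. }
  split; [ctn|]. split; [|split].
  - rewrite L by lra. rewrite Rmult_0_r, clamp_id, H0, K0 by lra.
    destruct z; simpl; f_equal; ring.
  - rewrite L' by lra. replace (2 * 1 - 1) with 1 by ring. rewrite clamp_id, H1, K1 by lra.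
    destruct v; simpl; f_equal; ring.
  - intros s Hs. destruct (Rle_dec s (1 / 2)) as [Hs'|Hs'].
    + rewrite (L s), K0 by lra.
      replace (_, _) with (p (clamp (2 * s))); [apply H, clamp_in|].
      destruct (p (clamp (2 * s))); simpl; f_equal; ring.
    + rewrite (L' s), H1 by lra.
      replace (_, _) with (q (clamp (2 * s - 1))); [apply K, clamp_in|].
      destruct (q (clamp (2 * s - 1))); simpl; f_equal; ring.
Qed.

Lemma reach_prefix (g : pt -> Prop) (p : R -> pt) r : (forall s, continuous p s) -> 0 <= r ->
  (forall s, 0 <= s <= r -> ~ g (p s)) -> reach g (p 0) (p r).
Proof.
  intros Cp Hr H. exists (fun s => p (r * s)). split; [ctn|].
  rewrite Rmult_0_r, Rmult_1_r. repeat split; auto. intros s Hs. apply H. nra.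
Qed.

Lemma reach_Tn g k z w : invariant g -> reach g z w -> reach g (Tn k z) (Tn k w).
Proof.
  intros Ig [p [Cp [H0 [H1 H]]]]. exists (fun s => Tn k (p s)).
  split; [unfold Tn; ctn|]. rewrite H0, H1. repeat split; auto.
  intros s Hs. rewrite (Ig k). auto.
Qed.

Lemma reach_ext (g g' : pt -> Prop) z w : (forall v, g' v -> g v) -> reach g z w -> reach g' z w.
Proof. intros E [p [Cp [H0 [H1 H]]]]. exists p. repeat split; auto. intros s Hs Hg. apply (H s Hs); auto. Qed.

Lemma side_reach sg g z w : side sg g w -> reach g z w -> side sg g z.
Proof. intros [v [H1 H2]] H. exists v. split; auto. eapply reach_trans; eauto. Qed.

Lemma side_not sg g z : side sg g z -> ~ g z.
Proof. intros [v [H1 H2]]. eapply reach_start; eauto. Qed.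

Lemma side_vertical sg g z : (forall t, 0 <= t -> ~ g (vshift (sg * t) z)) -> side sg g z.
Proof.
  intros H. exists z. split; auto. apply reach_refl.
  specialize (H 0 (Rle_refl 0)). unfold vshift in H. rewrite Rmult_0_r, Rplus_0_r in H.
  now destruct z.
Qed.

Lemma side_invariant sg g : invariant g -> invariant (side sg g).
Proof.
  intros Ig.
  assert (L : forall k z, side sg g z -> side sg g (Tn k z)).
  { intros k z [w [H1 H2]]. exists (Tn k w). split; [now apply reach_Tn|].
    intros t Ht. change (vshift (sg * t) (Tn k w)) with (Tn k (vshift (sg * t) w)).
    rewrite (Ig k). auto. }
  intros k z. split; auto. intros H. apply (L (- k)%Z) in H.
  rewrite Tn_Tn in H. replace (k + - k)%Z with 0%Z in H by lia. now rewrite Tn_0 in H.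
Qed.

Lemma seg_ball z w s e : 0 <= s <= 1 -> d2 w z < e -> d2 (seg z w s) z < e.
Proof.
  intros Hs H. apply d2_lt in H. apply d2_lt. unfold seg; simpl.
  destruct H as [H1 H2].
  assert (A : forall a b, Rabs (b - a) < e -> Rabs (a + s * (b - a) - a) < e).
  { intros a b Hab. replace (a + s * (b - a) - a) with (s * (b - a)) by ring.
    rewrite Rabs_mult, (Rabs_pos_eq s) by lra.
    generalize (Rabs_pos (b - a)). nra. }
  auto.
Qed.

Lemma reach_locally g z : locally z (fun w => ~ g w) -> locally z (reach g z).
Proof.
  intros H. apply locally_pt in H. destruct H as [e [He H]]. apply locally_pt.
  exists e. split; auto. intros w Hw. apply reach_seg. intros s Hs. apply H. now apply seg_ball.
Qed.

Lemma side_open sg g z : (forall z, ~ g z -> locally z (fun w => ~ g w)) ->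
  side sg g z -> locally z (side sg g).
Proof.
  intros Cg H. generalize (reach_locally g z (Cg z (side_not _ _ _ H))).
  apply filter_imp. intros w Hw. apply side_reach with z; auto. now apply reach_sym.
Qed.

Lemma not_side_open sg g z : (forall z, ~ g z -> locally z (fun w => ~ g w)) ->
  ~ g z -> ~ side sg g z -> locally z (fun w => ~ side sg g w).
Proof.
  intros Cg Hg H. generalize (reach_locally g z (Cg z Hg)).
  apply filter_imp. intros w Hw Hs. apply H. now apply side_reach with w.
Qed.

Lemma connected_side sg g g' : essential_continuum g -> essential_continuum g' ->
  (forall z, g z -> g' z -> False) ->
  (forall z, g z -> side sg g' z) \/ (forall z, g z -> ~ side sg g' z).
Proof.
  intros E E' Hd. apply (ec_connected g E).
  - apply side_invariant, ec_invariant; auto.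
  - intros z _ Hz. apply side_open; auto. apply ec_closed; auto.
  - intros z Hg Hz. apply not_side_open; auto. apply ec_closed; auto. eauto.
Qed.

Lemma side_far sg g z M : sign sg -> (forall z, g z -> Rabs (snd z) <= M) -> M < sg * snd z -> side sg g z.
Proof.
  intros S HM Hz. apply side_vertical. intros t Ht Hg. specialize (HM _ Hg).
  unfold vshift in HM; simpl in HM. revert HM. unfold Rabs.
  destruct S as [->| ->]; destruct Rcase_abs; lra.
Qed.

Lemma first_hit g (p : R -> pt) : (forall z, ~ g z -> locally z (fun w => ~ g w)) ->
  (forall s, continuous p s) -> ~ g (p 0) -> g (p 1) ->
  exists r, 0 < r <= 1 /\ g (p r) /\ forall s, 0 <= s < r -> ~ g (p s).
Proof.
  intros Cg Cp H0 H1.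
  assert (Op : forall s, ~ g (p s) -> exists e, 0 < e /\ forall r, Rabs (r - s) < e -> ~ g (p r)).
  { intros s Hs. apply locally_R. exact (Cp s _ (Cg _ Hs)). }
  apply NNPP. intros Hn.
  apply (interval_connected (fun t => forall r, 0 <= r <= t -> ~ g (p r))) with (t := 1) (r := 1); try lra; auto.
  - intros t Ht Q. destruct (Op t (Q t ltac:(lra))) as [e [He Hr]].
    exists e. split; auto. intros s Hs Hst r Hr'. destruct (Rle_dec r t); [apply Q; lra|].
    apply Hr. apply Rabs_def2 in Hst. apply Rabs_def1; lra.
  - intros t Ht Q.
    assert (exists r, 0 <= r < t /\ g (p r)) as [r [Hr Hgr]].
    { apply NNPP. intros Hc. apply Q. intros r Hr Hg.
      destruct (Req_dec r t) as [->|Hrt]; [|apply Hc; exists r; split; auto; lra].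
      apply Hn. exists t. split; [|split]; auto.
      - destruct (Req_dec t 0); [subst; tauto|lra].
      - intros s Hs Hgs. apply Hc. exists s. auto. }
    exists (t - r). split; [lra|]. intros s Hs Hst Qs. apply (Qs r); auto.
    apply Rabs_def2 in Hst. lra.
  - intros r Hr. replace r with 0 by lra. auto.
Qed.

(** Walk vertically from [z] in the direction [sg]. The walk must meet [g], and until then it stays
    in the region reachable from [z], which is free of [g']. *)
Lemma reach_first_hit g g' z sg : (forall z, ~ g z -> locally z (fun w => ~ g w)) ->
  ~ g z -> ~ side sg g z ->
  (forall w, reach g z w -> ~ g' w) -> (forall w, g w -> ~ g' w) ->
  exists w, g w /\ reach g' z w.
Proof.
  intros Cg Hz Hs Hr Hd.
  assert (exists t, 0 <= t /\ g (vshift (sg * t) z)) as [t [Ht Hgt]].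
  { apply NNPP. intros Hn. apply Hs, side_vertical. intros t Ht Hg. apply Hn; eauto. }
  set (p := fun s => vshift (sg * (t * s)) z).
  assert (Cp : forall s, continuous p s) by (unfold p, vshift; ctn).
  assert (p0 : p 0 = z).
  { unfold p, vshift. rewrite !Rmult_0_r, Rplus_0_r. now destruct z. }
  destruct (first_hit g p) as [r [Hr0 [Hgr Hbefore]]]; auto.
  - now rewrite p0.
  - unfold p. now rewrite Rmult_1_r.
  - exists (p r). split; auto. rewrite <- p0. apply reach_prefix; auto; [lra|].
    intros s Hs'. destruct (Req_dec s r) as [->|Hsr]; auto.
    apply Hr. rewrite <- p0. apply reach_prefix; auto; [lra|]. intros s' Hs''. apply Hbefore. lra.
Qed.

Lemma ec_far g g' : essential_continuum g -> essential_continuum g' ->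
  exists M, 0 <= M /\ (forall z, g z -> Rabs (snd z) <= M) /\ (forall z, g' z -> Rabs (snd z) <= M).
Proof.
  intros E E'. destruct (ec_bounded g E) as [M [H0 H]]. destruct (ec_bounded g' E') as [M' [H0' H']].
  exists (Rmax M M'). split; [|split].
  - eapply Rle_trans; [exact H0|apply Rmax_l].
  - intros z Hz. eapply Rle_trans; [apply H; auto|apply Rmax_l].
  - intros z Hz. eapply Rle_trans; [apply H'; auto|apply Rmax_r].
Qed.

(** A point far out in the direction [- sg] is on that side of both sets. Walking back until [g] is
    met, the path stays in [side (- sg) g] and so avoids [g']; hence the point of [g] it reaches is
    in [side (- sg) g'], and connectedness extends this to all of [g]. *)
Lemma side_swap g g' sg : sign sg -> essential_continuum g -> essential_continuum g' ->
  (forall z, g z -> g' z -> False) ->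
  (forall z, g' z -> ~ side (- sg) g z) -> forall z, g z -> side (- sg) g' z.
Proof.
  intros S E E' Hd H.
  destruct (ec_far g g' E E') as [M [M0 [HM HM']]].
  set (z0 := (0, - sg * (M + 1))).
  assert (F0 : M < - sg * snd z0) by (unfold z0; simpl; destruct S as [->| ->]; lra).
  assert (S0 : side (- sg) g z0) by (apply side_far with M; auto using sign_opp).
  destruct (reach_first_hit g g' z0 sg) as [w [Hw Hr]].
  - apply ec_closed; auto.
  - eapply side_not; eauto.
  - intros Hs. apply (ec_sides g sg z0); auto.
  - intros w Hw Hg'. apply (H w Hg'). apply side_reach with z0; auto. now apply reach_sym.
  - eauto.
  - assert (side (- sg) g' w).
    { apply side_reach with z0; [|now apply reach_sym]. apply side_far with M; auto using sign_opp. }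
    destruct (connected_side (- sg) g g') as [A|A]; auto. exfalso. apply (A w); auto.
Qed.

Lemma ec_nonempty g : essential_continuum g -> exists z, g z.
Proof.
  intros E. apply NNPP. intros Hn.
  apply (ec_separating g E (0, 0)); apply side_vertical; intros t Ht Hg; apply Hn; eauto.
Qed.

(** If [g'] lay on neither side of [g], say in a bounded complementary region, then by [side_swap]
    in both directions [g] would lie on both sides of [g']. *)
Lemma ec_dichotomy g g' : essential_continuum g -> essential_continuum g' ->
  (forall z, g z -> g' z -> False) ->
  (forall z, g' z -> side 1 g z) \/ (forall z, g' z -> side (-1) g z).
Proof.
  intros E E' Hd.
  assert (Hd' : forall z, g' z -> g z -> False) by eauto.
  destruct (connected_side 1 g' g) as [A|A]; auto.
  destruct (connected_side (-1) g' g) as [B|B]; auto.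
  exfalso. destruct (ec_nonempty g E) as [z Hz].
  apply (ec_separating g' E' z).
  - replace 1 with (- -1) by ring. apply (side_swap g g' (-1)); auto; [right; auto|].
    replace (- -1) with 1 by ring. auto.
  - apply (side_swap g g' 1); auto. left; auto.
Qed.

(** * Order of disjoint essential continua *)

Section Order.
Variables (g g' : pt -> Prop) (sg : R).
Hypothesis S : sign sg.
Hypothesis E : essential_continuum g.
Hypothesis E' : essential_continuum g'.
Hypothesis beyond : forall z, g' z -> side sg g z.

Lemma beyond_disjoint z : g z -> g' z -> False.
Proof. intros H H'. apply (side_not _ _ _ (beyond z H')); auto. Qed.

Lemma beyond_opp z : g z -> side (- sg) g' z.
Proof.
  apply side_swap; auto. apply beyond_disjoint.
  intros w Hw H. eapply (ec_sides g sg); eauto.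
Qed.

(** Walking from [z] in the direction [sg] one meets [g] before [g'], because [g'] is contained in
    [side sg g], which cannot be reached from [z] off [g]. So [z] is joined off [g'] to a point of
    [g], which lies in [side (- sg) g']. *)
Lemma not_side_beyond z : ~ side sg g z -> side (- sg) g' z.
Proof.
  intros H. destruct (classic (g z)) as [Hg|Hg]; [now apply beyond_opp|].
  destruct (reach_first_hit g g' z sg) as [w [Hw Hr]]; auto.
  - apply ec_closed; auto.
  - intros w Hw Hg'. apply H. apply side_reach with w; auto.
  - intros w Hw Hg'. eapply beyond_disjoint; eauto.
  - apply side_reach with w; auto. now apply beyond_opp.
Qed.

Lemma side_opp_beyond z : side (- sg) g z -> side (- sg) g' z.
Proof. intros H. apply not_side_beyond. intros H'. eapply (ec_sides g sg); eauto. Qed.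

Lemma side_beyond z : side sg g' z -> side sg g z.
Proof.
  intros H. apply NNPP. intros Hn. apply (ec_sides g' sg z); auto. now apply not_side_beyond.
Qed.
End Order.

(** Access to an end by paths of arbitrary final height [H] in one strip. The order of quantifiers
    matters: [r] does not depend on [H], so paths can be lengthened without being widened, and they
    never go back beyond [- r]. *)
Definition sray (sg : R) (P : pt -> Prop) (z : pt) (r : R) : Prop :=
  forall H, exists p : R -> pt, (forall s, continuous p s) /\ p 0 = z /\
    (forall s, 0 <= s <= 1 -> P (p s) /\ Rabs (fst (p s)) <= r /\ - r <= sg * snd (p s)) /\
    H <= sg * snd (p 1).

Lemma sray_weaken sg (P P' : pt -> Prop) z r r' : (forall z, P z -> P' z) -> r <= r' ->
  sray sg P z r -> sray sg P' z r'.
Proof.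
  intros HP Hr HS H. destruct (HS H) as [p [Cp [H0 [Hs H1]]]]. exists p. repeat split; auto.
  - apply HP, Hs; auto.
  - destruct (Hs s H2) as [_ [? ?]]; lra.
  - destruct (Hs s H2) as [_ [? ?]]; lra.
Qed.

Lemma side_sray sg g z : sign sg -> side sg g z -> exists r, sray sg (side sg g) z r.
Proof.
  intros S [w [[p [Cp [H0 [H1 Hp]]]] Hw]].
  destruct (continuous_interval_bounded (fun s => fst (p s))) as [r1 Hr1]; [ctn|].
  destruct (continuous_interval_bounded (fun s => snd (p s))) as [r2 Hr2]; [ctn|].
  exists (Rmax r1 r2). intros H.
  set (h := Rmax 0 (H - sg * snd w)).
  (* First the given path, then a vertical prolongation by [h]. The latter keeps the abscissa and
     moves towards the end, so the bounds on [p] alone give [r]. *)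
  set (q := fun s => vshift (sg * (h * clamp (2 * s - 1))) (p (clamp (2 * s)))).
  assert (Hh : 0 <= h) by apply Rmax_l.
  assert (Hc : forall s, clamp (2 * s - 1) = 0 \/ clamp (2 * s) = 1).
  { intros s. unfold clamp, Rmax, Rmin; repeat destruct Rle_dec; lra. }
  assert (Hq : forall s, ~ g (q s)).
  { intros s. unfold q. destruct (Hc s) as [E|E]; rewrite E.
    - rewrite !Rmult_0_r. unfold vshift. rewrite Rplus_0_r. rewrite <- surjective_pairing.
      apply Hp, clamp_in.
    - rewrite H1. apply Hw. apply Rmult_le_pos; auto. apply clamp_in. }
  assert (Cq : forall s, continuous q s) by (unfold q, vshift; ctn).
  assert (q0 : q 0 = z).
  { unfold q. replace (2 * 0 - 1) with (-1) by ring. rewrite Rmult_0_r.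
    replace (clamp (-1)) with 0 by (unfold clamp, Rmax, Rmin; repeat destruct Rle_dec; lra).
    rewrite clamp_id by lra. rewrite H0, !Rmult_0_r. unfold vshift. rewrite Rplus_0_r. now destruct z. }
  exists q. split; auto. split; auto. split.
  - intros s Hs. split; [|split].
    + apply side_reach with (q 0).
      * rewrite q0. exists w. split; auto. exists p; auto.
      * apply reach_sym, reach_prefix; auto. lra.
    + unfold q, vshift; simpl. eapply Rle_trans; [apply Hr1, clamp_in|apply Rmax_l].
    + unfold q, vshift; simpl.
      assert (A := Hr2 _ (clamp_in (2 * s))). assert (B := Rmax_r r1 r2).
      assert (C := proj1 (clamp_in (2 * s - 1))).
      assert (0 <= h * clamp (2 * s - 1)) by now apply Rmult_le_pos.
      revert A. unfold Rabs. destruct S as [->| ->]; destruct Rcase_abs; lra.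
  - unfold q, vshift; simpl. replace (2 * 1 - 1) with 1 by ring.
    replace (clamp (2 * 1)) with 1 by (unfold clamp, Rmax, Rmin; repeat destruct Rle_dec; lra).
    rewrite clamp_id, H1 by lra. assert (A : H - sg * snd w <= h) by apply Rmax_r.
    destruct S as [->| ->]; lra.
Qed.

(** * Essential Jordan curves and closed annuli *)

Lemma dT1_lt a b e : dT1 a b < e -> exists k : Z, Rabs (a - (b + IZR k)) < e.
Proof.
  unfold dT1, frac_part. destruct (base_Int_part (a - b)) as [H1 H2].
  unfold Rmin; destruct Rle_dec; intros H.
  - exists (Int_part (a - b)). apply Rabs_def1; lra.
  - exists (Int_part (a - b) + 1)%Z. rewrite plus_IZR. apply Rabs_def1; lra.
Qed.

Lemma dT1_le a b (k : Z) : dT1 a b <= Rabs (a - (b + IZR k)).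
Proof.
  unfold dT1, frac_part. destruct (base_Int_part (a - b)) as [H1 H2].
  set (n := Int_part (a - b)) in *.
  destruct (Z_le_gt_dec k n) as [H|H].
  - apply IZR_le in H. eapply Rle_trans; [apply Rmin_l|]. rewrite Rabs_pos_eq; lra.
  - assert (H' : (n + 1 <= k)%Z) by lia. apply IZR_le in H'. rewrite plus_IZR in H'.
    eapply Rle_trans; [apply Rmin_r|]. rewrite Rabs_left1; lra.
Qed.

Lemma dA_lt w z e : dA w z < e <-> exists k, d2 w (Tn k z) < e.
Proof.
  split.
  - intros H. assert (H1 : dT1 (fst w) (fst z) < e) by (eapply Rle_lt_trans; [apply Rmax_l|exact H]).
    assert (H2 : Rabs (snd w - snd z) < e) by (eapply Rle_lt_trans; [apply Rmax_r|exact H]).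
    destruct (dT1_lt _ _ _ H1) as [k Hk]. exists k. apply d2_lt. auto.
  - intros [k H]. apply d2_lt in H. destruct H as [H1 H2]. apply Rmax_lub_lt; auto.
    eapply Rle_lt_trans; [apply (dT1_le _ _ k)|exact H1].
Qed.

Lemma d2_lt_dA w z e : d2 w z < e -> dA w z < e.
Proof. intros H. apply dA_lt. exists 0%Z. now rewrite Tn_0. Qed.

Lemma dA_nonneg w z : 0 <= dA w z.
Proof. eapply Rle_trans; [apply Rabs_pos|apply Rmax_r]. Qed.

Lemma dA_zero w z : dA w z = 0 <-> exists k, w = Tn k z.
Proof.
  split.
  - intros H. assert (H2 : Rabs (snd w - snd z) <= 0) by (rewrite <- H; apply Rmax_r).
    assert (H1 : dT1 (fst w) (fst z) <= 0) by (rewrite <- H; apply Rmax_l).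
    unfold dT1 in H1. destruct (base_fp (fst w - fst z)) as [F1 F2].
    assert (F : frac_part (fst w - fst z) = 0).
    { revert H1. unfold Rmin. destruct Rle_dec; lra. }
    exists (Int_part (fst w - fst z)). unfold frac_part in F. unfold Tn.
    destruct w as [x y], z as [x' y']; simpl in *. f_equal; [lra|].
    generalize (Rabs_pos (y - y')); intros. destruct (Req_dec (y - y') 0); [lra|].
    apply Rabs_pos_lt in H3; lra.
  - intros [k ->]. apply Rle_antisym; [|apply dA_nonneg].
    apply Rnot_lt_le. intros H. apply (Rlt_irrefl (dA (Tn k z) z)).
    apply dA_lt. exists k. apply d2_lt. rewrite !Rminus_diag, Rabs_R0. lra.
Qed.

Lemma d2_sym w z : d2 w z = d2 z w.
Proof. unfold d2. now rewrite Rabs_minus_sym, (Rabs_minus_sym (snd w)). Qed.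

Lemma d2_triangle w z v : d2 w v <= d2 w z + d2 z v.
Proof.
  assert (A : forall a b c, Rabs (a - c) <= Rabs (a - b) + Rabs (b - c)).
  { intros. replace (a - c) with ((a - b) + (b - c)) by ring. apply Rabs_triang. }
  unfold d2. apply Rmax_lub.
  - eapply Rle_trans; [apply (A _ (fst z))|]. apply Rplus_le_compat; apply Rmax_l.
  - eapply Rle_trans; [apply (A _ (snd z))|]. apply Rplus_le_compat; apply Rmax_r.
Qed.

Lemma openA_locally U z : openA U -> U z -> locally z U.
Proof.
  intros O H. destruct (O z H) as [e [He Hw]]. apply locally_pt. exists e. split; auto.
  intros w Hd. apply Hw. now apply d2_lt_dA.
Qed.

Lemma locally_openA U : invariant U -> (forall z, U z -> locally z U) -> openA U.
Proof.
  intros I L z H. destruct (proj1 (locally_pt z U) (L z H)) as [e [He Hw]]. exists e. split; auto.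
  intros w Hd. apply dA_lt in Hd. destruct Hd as [k Hk]. apply (I (- k)%Z). apply Hw.
  rewrite <- (d2_Tn k), Tn_opp. exact Hk.
Qed.

Lemma openA_invariant U : openA U -> invariant U.
Proof.
  intros O.
  assert (L : forall k z, U z -> U (Tn k z)).
  { intros k z H. destruct (O z H) as [e [He Hw]]. apply Hw.
    rewrite (proj2 (dA_zero (Tn k z) z)); eauto. }
  intros k z. split; auto. intros H. apply (L (- k)%Z) in H.
  rewrite Tn_Tn in H. replace (k + - k)%Z with 0%Z in H by lia. now rewrite Tn_0 in H.
Qed.

Lemma path_openA U V (p : R -> pt) : openA U -> openA V -> (forall s, continuous p s) ->
  (forall s, 0 <= s <= 1 -> U (p s) \/ V (p s)) ->
  (forall s, 0 <= s <= 1 -> U (p s) -> V (p s) -> False) ->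
  U (p 0) -> U (p 1).
Proof.
  intros OU OV Cp HC HD H0.
  assert (L : forall W t, openA W -> W (p t) -> exists e, 0 < e /\ forall s, Rabs (s - t) < e -> W (p s)).
  { intros W t OW HW. apply locally_R. exact (Cp t _ (openA_locally W (p t) OW HW)). }
  apply (interval_connected (fun t => U (p t))); auto; [| |lra].
  - intros t Ht H. destruct (L U t OU H) as [e [He Hs]]. eauto.
  - intros t Ht H. destruct (HC t Ht) as [H'|H']; [tauto|].
    destruct (L V t OV H') as [e [He Hs]]. exists e. split; auto. intros s Hs' Hst HU.
    apply (HD s); auto.
Qed.

Section Components.
Variables (Z X : pt -> Prop).
Hypothesis Z_invariant : invariant Z.
Hypothesis Z_closed : forall z, ~ Z z -> locally z (fun w => ~ Z w).
Hypothesis XZ : forall z, X z <-> ~ Z z.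

Lemma reach_target z w : reach Z z w -> X w.
Proof. intros H. apply XZ. apply (reach_start Z w z). now apply reach_sym. Qed.

Lemma reach_open U V (D : pt -> Prop) z w : openA U -> openA V ->
  (forall v, D v -> U v \/ V v) -> (forall v, D v -> U v -> V v -> False) ->
  (forall v, reach Z z v -> D v) -> reach Z z w -> U z -> U w.
Proof.
  intros OU OV HC HD HR [p [Cp [H0 [H1 Hp]]]] HU.
  assert (HDp : forall s, 0 <= s <= 1 -> D (p s)).
  { intros s Hs. apply HR. rewrite <- H0. apply reach_prefix; auto; [lra|].
    intros s' Hs'. apply Hp. lra. }
  rewrite <- H1. apply (path_openA U V); auto.
  - intros s Hs. apply HD; auto.
  - now rewrite H0.
Qed.

(** Adjoining to [C] all that is reachable from [z] keeps it connected, so maximality absorbs it. *)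
Lemma component_reach C z w : componentA X C -> C z -> reach Z z w -> C w.
Proof.
  intros [_ [HX [HC HM]]] Hz Hw.
  apply (HM (fun v => C v \/ reach Z z v)); auto.
  - intros U V OU OV Hcov Hdis.
    assert (Hside : forall U V, openA U -> openA V ->
      (forall v, C v \/ reach Z z v -> U v \/ V v) ->
      (forall v, C v \/ reach Z z v -> U v -> V v -> False) -> U z ->
      forall v, C v \/ reach Z z v -> ~ V v).
    { clear U V OU OV Hcov Hdis. intros U V OU OV Hcov Hdis HU v Hv HV.
      apply (Hdis v); auto. destruct Hv as [Hv|Hv].
      - destruct (HC U V OU OV) as [A|A].
        + intros y Hy. auto.
        + intros y Hy. apply Hdis; auto.
        + exfalso. apply (A z); auto.
        + exfalso. apply (A v); auto.
      - apply (reach_open U V (fun v => C v \/ reach Z z v) z v); auto. }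
    destruct (Hcov z (or_introl Hz)) as [H|H].
    + right. apply (Hside U V); auto.
    + left. apply (Hside V U); auto.
      * intros v Hv. destruct (Hcov v Hv); auto.
      * intros v Hv H1 H2. apply (Hdis v); auto.
  - intros v [Hv|Hv]; auto. now apply reach_target in Hv.
Qed.

(** Paths live in the plane, so a component in the annulus is the union of the integer translates of
    a path component. It is maximal because it and the rest of the complement of [Z] are both
    open. *)
Lemma component_exists z : ~ Z z -> componentA X (fun w => exists k, reach Z z (Tn k w)).
Proof.
  intros Hz. set (C := fun w => exists k, reach Z z (Tn k w)).
  assert (Czero : forall w, reach Z z w -> C w).
  { intros w Hw. exists 0%Z. now rewrite Tn_0. }
  assert (IC : invariant C).
  { intros k w. split; intros [j H].
    - exists (k + j)%Z. now rewrite <- Tn_Tn.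
    - exists (j - k)%Z. rewrite Tn_Tn. now replace (k + (j - k))%Z with j by lia. }
  assert (CX : forall w, C w -> ~ Z w).
  { intros w [k H]. apply reach_target in H. apply XZ in H. intros HZ. apply H. now apply Z_invariant. }
  assert (CO : forall w, C w -> locally w C).
  { intros w Hw. generalize (reach_locally Z w (Z_closed w (CX w Hw))).
    apply filter_imp. intros v Hv. destruct Hw as [k Hk]. exists k.
    apply reach_trans with (Tn k w); auto. now apply reach_Tn. }
  assert (NO : forall w, ~ Z w /\ ~ C w -> locally w (fun w => ~ Z w /\ ~ C w)).
  { intros w [HZ HC]. generalize (reach_locally Z w (Z_closed w HZ)).
    apply filter_imp. intros v Hv. split.
    - apply XZ. now apply reach_target in Hv.
    - intros [k Hk]. apply HC. exists k. apply reach_trans with (Tn k v); auto.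
      apply reach_Tn; auto. now apply reach_sym. }
  split; [|split; [|split]].
  - exists z. apply Czero, reach_refl; auto.
  - intros w Hw. apply XZ. auto.
  - intros U V OU OV Hcov Hdis.
    assert (Hside : forall U V, openA U -> openA V ->
      (forall v, C v -> U v \/ V v) -> (forall v, C v -> U v -> V v -> False) -> U z ->
      forall v, C v -> ~ V v).
    { clear U V OU OV Hcov Hdis. intros U V OU OV Hcov Hdis HU v Hv HV. apply (Hdis v); auto.
      destruct Hv as [k Hk]. apply (openA_invariant U OU k).
      apply (reach_open U V C z (Tn k v)); auto. }
    destruct (Hcov z) as [H|H]; [apply Czero, reach_refl; auto| |].
    + right. apply (Hside U V); auto.
    + left. apply (Hside V U); auto.
      * intros v Hv. destruct (Hcov v Hv); auto.
      * intros v Hv H1 H2. apply (Hdis v); auto.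
  - intros D HD HCD HDX w Hw.
    destruct (HD C (fun w => ~ Z w /\ ~ C w)) as [A|A].
    + now apply locally_openA.
    + apply locally_openA; auto. intros k v. rewrite (Z_invariant k v), (IC k v). tauto.
    + intros v Hv. destruct (classic (C v)); auto. right. split; auto. apply XZ; auto.
    + tauto.
    + exfalso. apply (A z); [apply HCD|]; apply Czero, reach_refl; auto.
    + apply NNPP. intros Hn. apply (A w); auto. split; auto. apply XZ; auto.
Qed.
End Components.

(** Both points can be brought to a common height beyond [M], where the horizontal segment joining
    them avoids [g]. *)
Lemma side_connected g sg z w M : sign sg -> (forall v, g v -> Rabs (snd v) <= M) ->
  side sg g z -> side sg g w -> reach g z w.
Proof.
  intros S HM.
  assert (L : forall z, side sg g z -> exists x, forall T, M < T ->
    reach g z (x, sg * T)).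
  { intros v [v' [Hr Hv]]. exists (fst v'). intros T HT.
    apply reach_trans with v'; auto.
    destruct (Rle_dec (sg * snd v') T) as [H|H].
    - apply reach_seg. intros s Hs.
      replace (seg v' (fst v', sg * T) s) with (vshift (sg * (s * (T - sg * snd v'))) v').
      + apply Hv. apply Rmult_le_pos; lra.
      + unfold seg, vshift; simpl. destruct S as [->| ->]; f_equal; ring.
    - apply reach_seg. intros s Hs Hg. specialize (HM _ Hg). unfold seg in HM; simpl in HM.
      revert HM H. unfold Rabs. destruct S as [->| ->]; destruct Rcase_abs; nra. }
  intros Hz Hw. destruct (L z Hz) as [x Hx]. destruct (L w Hw) as [y Hy].
  apply reach_trans with (x, sg * (M + 1)); [apply Hx; lra|].
  apply reach_trans with (y, sg * (M + 1)); [|apply reach_sym, Hy; lra].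
  apply reach_seg. intros s Hs Hg. specialize (HM _ Hg). unfold seg in HM; simpl in HM.
  replace (sg * (M + 1) + s * (sg * (M + 1) - sg * (M + 1))) with (sg * (M + 1)) in HM by ring.
  revert HM. unfold Rabs. destruct S as [->| ->]; destruct Rcase_abs; lra.
Qed.

Lemma unbounded_side g C M : (forall v, g v -> Rabs (snd v) <= M) -> unboundedA C ->
  exists z sg, sign sg /\ C z /\ side sg g z.
Proof.
  intros HM HU.
  assert (exists z, C z /\ M < Rabs (snd z)) as [z [Hz HzM]].
  { apply NNPP. intros Hn. apply HU. exists M. intros z Hz. apply Rnot_lt_le. eauto. }
  exists z. revert HzM. unfold Rabs. destruct Rcase_abs; intros H.
  - exists (-1). split; [right; auto|]. split; auto. apply side_far with M; auto; [right; auto|lra].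
  - exists 1. split; [left; auto|]. split; auto. apply side_far with M; auto; [left; auto|lra].
Qed.

(** A point on both sides would belong to every unbounded component. Then [C1] and [C2] would have a
    connected union, and maximality of [C2] would put [C1] inside [C2]. *)
Lemma essential_separating g M : invariant g ->
  (forall v, g v -> Rabs (snd v) <= M) -> essentialA g -> forall z, side 1 g z -> side (-1) g z -> False.
Proof.
  intros Ig HM [C1 [C2 [K1 [K2 [U1 [U2 [v [Hv1 Hv2]]]]]]]] z Hp Hm.
  assert (XZ : forall w, complA g w <-> ~ g w) by (unfold complA; tauto).
  assert (L : forall C, componentA (complA g) C -> unboundedA C -> C z).
  { intros C K U. destruct (unbounded_side g C M HM U) as [w [sg [S [Hw Hs]]]].
    apply (component_reach g (complA g) XZ C w z); auto.
    apply (side_connected g sg w z M); auto. destruct S as [->| ->]; auto. }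
  assert (Z1 := L C1 K1 U1). assert (Z2 := L C2 K2 U2).
  destruct K1 as [_ [X1 [N1 _]]]. destruct K2 as [_ [X2 [N2 M2]]].
  apply Hv2. apply (M2 (fun w => C1 w \/ C2 w)); auto.
  - intros U V OU OV Hcov Hdis.
    destruct (N1 U V OU OV) as [A|A]; auto; [intros; apply (Hdis z0); auto| |];
    destruct (N2 U V OU OV) as [B|B]; auto; try (intros; apply (Hdis z0); auto).
    + left. intros w [Hw|Hw]; auto.
    + exfalso. destruct (Hcov z (or_introl Z1)); [apply (A z)|apply (B z)]; auto.
    + exfalso. destruct (Hcov z (or_introl Z1)); [apply (B z)|apply (A z)]; auto.
    + right. intros w [Hw|Hw]; auto.
  - intros w [Hw|Hw]; auto.
Qed.

Section Jordan.
Variables (g : pt -> Prop) (c : R -> pt).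
Hypothesis c_continuous : forall t eps, 0 < eps -> exists delta, 0 < delta /\
  forall s, Rabs (s - t) < delta -> dA (c s) (c t) < eps.
Hypothesis c_injective : forall s t, dA (c s) (c t) = 0 <-> exists k : Z, s - t = IZR k.
Hypothesis c_image : forall z, g z <-> exists t, dA z (c t) = 0.

Lemma jordan_unit z : g z -> exists k t, 0 <= t <= 1 /\ z = Tn k (c t).
Proof.
  intros H. apply c_image in H. destruct H as [t Ht]. apply dA_zero in Ht. destruct Ht as [k ->].
  destruct (base_Int_part t) as [H1 H2].
  assert (E : dA (c t) (c (t - IZR (Int_part t))) = 0).
  { apply c_injective. exists (Int_part t). lra. }
  apply dA_zero in E. destruct E as [j ->]. rewrite Tn_Tn.
  exists (j + k)%Z, (t - IZR (Int_part t)). split; auto. lra.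
Qed.

Lemma jordan_invariant : invariant g.
Proof.
  assert (L : forall k z, g z -> g (Tn k z)).
  { intros k z H. apply jordan_unit in H. destruct H as [j [t [_ ->]]].
    apply c_image. exists t. apply dA_zero. rewrite Tn_Tn. eauto. }
  intros k z. split; auto. intros H. apply (L (- k)%Z) in H.
  rewrite Tn_Tn in H. replace (k + - k)%Z with 0%Z in H by lia. now rewrite Tn_0 in H.
Qed.

Lemma jordan_point t : g (c t).
Proof. apply c_image. exists t. apply dA_zero. exists 0%Z. now rewrite Tn_0. Qed.

Lemma jordan_closed z : ~ g z -> locally z (fun w => ~ g w).
Proof.
  intros Hz.
  (* The distance bound is written [/ H] because [interval_uniform] asks for a property preserved
     when [H] grows. *)
  destruct (interval_uniform (fun H t => 0 < H /\ forall k, / H <= d2 z (Tn k (c t)))) as [H HH].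
  - intros H H' t Hle [H0 Hk]. split; [lra|]. intros k. eapply Rle_trans; [|apply Hk].
    apply Rinv_le_contravar; auto.
  - intros t Ht. assert (Hm : 0 < dA z (c t)).
    { destruct (dA_nonneg z (c t)) as [?|E]; auto. exfalso. apply Hz, c_image. exists t. auto. }
    set (m := dA z (c t)) in *.
    destruct (c_continuous t (m / 2)) as [d [Hd Hs]]; [lra|].
    exists d, (2 / m). split; auto. intros s _ Hst.
    split; [apply Rdiv_lt_0_compat; lra|]. intros k. apply Rnot_lt_le. intros Hlt.
    replace (/ (2 / m)) with (m / 2) in Hlt by (field; lra).
    specialize (Hs s Hst). apply dA_lt in Hs. destruct Hs as [j Hj].
    apply (Rlt_irrefl m). apply dA_lt. exists (j + k)%Z. rewrite <- Tn_Tn.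
    eapply Rle_lt_trans; [apply (d2_triangle _ (Tn k (c s)))|]. rewrite d2_Tn. lra.
  - destruct (HH 0) as [H0 _]; [lra|]. apply locally_pt. exists (/ H).
    split; [now apply Rinv_0_lt_compat|]. intros w Hw Hg.
    apply jordan_unit in Hg. destruct Hg as [k [t [Ht ->]]].
    destruct (HH t Ht) as [_ Hk]. specialize (Hk k). rewrite d2_sym in Hk. lra.
Qed.

Lemma jordan_bounded : exists M, 0 <= M /\ forall z, g z -> Rabs (snd z) <= M.
Proof.
  destruct (interval_uniform (fun H t => Rabs (snd (c t)) <= H)) as [H HH].
  - intros; lra.
  - intros t Ht. destruct (c_continuous t 1) as [d [Hd Hs]]; [lra|].
    exists d, (Rabs (snd (c t)) + 1). split; auto. intros s _ Hst. specialize (Hs s Hst).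
    apply dA_lt in Hs. destruct Hs as [k Hk]. apply d2_lt in Hk. destruct Hk as [_ Hk].
    simpl in Hk. revert Hk. unfold Rabs; repeat destruct Rcase_abs; lra.
  - exists H. split.
    + eapply Rle_trans; [apply Rabs_pos|apply (HH 0); lra].
    + intros z Hz. apply jordan_unit in Hz. destruct Hz as [k [t [Ht ->]]]. apply (HH t Ht).
Qed.

Lemma jordan_connected (P : pt -> Prop) : invariant P ->
  (forall z, g z -> P z -> locally z P) ->
  (forall z, g z -> ~ P z -> locally z (fun w => ~ P w)) ->
  (forall z, g z -> P z) \/ (forall z, g z -> ~ P z).
Proof.
  intros IP OP NP.
  assert (L : forall Q : pt -> Prop, invariant Q -> forall t, locally (c t) Q ->
    exists e, 0 < e /\ forall s, 0 <= s <= 1 -> Rabs (s - t) < e -> Q (c s)).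
  { intros Q IQ t H. apply locally_pt in H. destruct H as [e [He HQ]].
    destruct (c_continuous t e He) as [d [Hd Hs]]. exists d. split; auto.
    intros s _ Hst. specialize (Hs s Hst). apply dA_lt in Hs. destruct Hs as [k Hk].
    apply (IQ (- k)%Z). apply HQ. rewrite <- (d2_Tn k), Tn_opp. exact Hk. }
  assert (IN : invariant (fun w => ~ P w)) by (intros k z; rewrite (IP k z); tauto).
  assert (OL : forall t, P (c t) -> exists e, 0 < e /\ forall s, 0 <= s <= 1 -> Rabs (s - t) < e -> P (c s)).
  { intros t H. apply (L P IP). apply OP; auto. apply jordan_point. }
  assert (NL : forall t, ~ P (c t) -> exists e, 0 < e /\ forall s, 0 <= s <= 1 -> Rabs (s - t) < e -> ~ P (c s)).
  { intros t H. apply (L _ IN). apply NP; auto. apply jordan_point. }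
  destruct (classic (P (c 0))) as [H|H].
  - left. intros z Hz. apply jordan_unit in Hz. destruct Hz as [k [t [Ht ->]]]. apply IP.
    apply (interval_connected (fun t => P (c t))); auto.
  - right. intros z Hz. apply jordan_unit in Hz. destruct Hz as [k [t [Ht ->]]]. rewrite (IP k).
    apply (interval_connected (fun t => ~ P (c t))); auto.
    intros t' Ht' Hn. destruct (OL t' (NNPP _ Hn)) as [e [He Hs]]. exists e. split; auto.
Qed.
End Jordan.

Lemma essential_jordan_continuum g : jordanA g -> essentialA g -> essential_continuum g.
Proof.
  intros [c [Cc [Ic Hc]]] He.
  destruct (jordan_bounded g c Cc Ic Hc) as [M [M0 HM]].
  constructor.
  - exact (jordan_invariant g c Ic Hc).
  - exact (jordan_closed g c Cc Ic Hc).
  - eauto.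
  - exact (jordan_connected g c Cc Ic Hc).
  - apply essential_separating with M; auto. exact (jordan_invariant g c Ic Hc).
Qed.

(** Trades bounded components for sides: a point of a bounded component has no access to an end, and
    a point on neither outer side has a bounded component, since passing beyond height [M] would put
    it on one of them. *)
Lemma closed_annulus_sides g g' sg z : sign sg -> essential_continuum g -> essential_continuum g' ->
  (forall w, g' w -> side sg g w) ->
  (closed_annulus g g' z <-> ~ side (- sg) g z /\ ~ side sg g' z).
Proof.
  intros S E E' B.
  assert (B' := beyond_opp g g' sg S E E' B).
  destruct (ec_far g g' E E') as [M [M0 [HM HM']]].
  set (Z := fun w => g w \/ g' w).
  assert (XZ : forall w, (~ g w /\ ~ g' w) <-> ~ Z w) by (unfold Z; tauto).
  assert (IZ : invariant Z).
  { intros k w. unfold Z. rewrite (ec_invariant g E k w), (ec_invariant g' E' k w). tauto. }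
  assert (CZ : forall w, ~ Z w -> locally w (fun v => ~ Z v)).
  { intros w Hw. apply XZ in Hw. destruct Hw as [Hw Hw'].
    generalize (filter_and _ _ (ec_closed g E w Hw) (ec_closed g' E' w Hw')).
    apply filter_imp. unfold Z. tauto. }
  assert (HZM : forall w, Z w -> Rabs (snd w) <= M) by (intros w [H|H]; auto).
  assert (Esc : forall sg C w v h, sign sg -> componentA (fun w => ~ g w /\ ~ g' w) C -> boundedA C -> C w ->
     reach Z w v -> (forall t, 0 <= t -> ~ Z (vshift (sg * t) v)) -> (h : Prop)).
  { intros sg' C w v h S' K [N HN] Hw Hr Hv. exfalso.
    set (t := Rmax 0 (N + 1 - sg' * snd v)).
    assert (Ht : 0 <= t) by apply Rmax_l. assert (Ht' : N + 1 - sg' * snd v <= t) by apply Rmax_r.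
    assert (Cv : C (vshift (sg' * t) v)).
    { apply (component_reach Z _ XZ C w); auto. apply reach_trans with v; auto.
      apply reach_seg. intros s Hs.
      replace (seg v (vshift (sg' * t) v) s) with (vshift (sg' * (s * t)) v).
      - apply Hv. apply Rmult_le_pos; lra.
      - unfold seg, vshift; simpl. f_equal; ring. }
    specialize (HN _ Cv). unfold vshift in HN; simpl in HN.
    revert HN. unfold Rabs. destruct S' as [->| ->]; destruct Rcase_abs; lra. }
  (* All points of a path witnessing [side sg h] are themselves on that side, so the path also
     avoids any [h'] disjoint from it. *)
  assert (Avoid : forall h h' sg w, sign sg -> (forall v, h' v -> ~ side sg h v) -> side sg h w ->
     exists v, reach (fun v => h v \/ h' v) w v /\ forall t, 0 <= t -> ~ (h (vshift (sg * t) v) \/ h' (vshift (sg * t) v))).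
  { clear. intros h h' sg w S Hd [v [Hr Hv]]. exists v.
    assert (Hvs : forall t, 0 <= t -> side sg h (vshift (sg * t) v)).
    { intros t Ht. apply side_vertical. intros t' Ht'. 
      replace (vshift (sg * t') (vshift (sg * t) v)) with (vshift (sg * (t + t')) v).
      - apply Hv; lra.
      - unfold vshift; simpl; f_equal; ring. }
    assert (Hsv : side sg h v).
    { specialize (Hvs 0 (Rle_refl 0)). unfold vshift in Hvs.
      rewrite Rmult_0_r, Rplus_0_r, <- surjective_pairing in Hvs. exact Hvs. }
    split.
    - destruct Hr as [p [Cp [H0 [H1 Hp]]]]. exists p. split; [exact Cp|]. repeat split; auto.
      intros s Hs [H|H]; [now apply (Hp s)|]. apply (Hd _ H). apply side_reach with w.
      + exists v. split; auto. exists p; auto.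
      + rewrite <- H0. apply reach_sym, reach_prefix; auto; [lra|]. intros s' Hs'. apply Hp; lra.
    - intros t Ht [H|H]; [now apply (Hv t)|]. apply (Hd _ H). auto. }
  split.
  - intros [Hz|[Hz|[C [K [BC Hz]]]]].
    + split; [intros Hs; now apply side_not in Hs|]. intros Hs. apply (ec_sides g' sg z); auto.
    + split; [|intros Hs; now apply side_not in Hs]. intros Hs. apply (ec_sides g sg z); auto.
    + split; intros Hs.
      * destruct (Avoid g g' (- sg) z) as [v [Hr Hv]]; auto using sign_opp.
        { intros w Hw Hn. apply (ec_sides g sg w); auto. }
        apply (Esc (- sg) C z v); auto using sign_opp.
      * destruct (Avoid g' g sg z) as [v [Hr Hv]]; auto.
        { intros w Hw Hn. apply (ec_sides g' sg w); auto. }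
        apply (Esc sg C z v); auto.
        -- eapply reach_ext; [|exact Hr]. unfold Z; tauto.
        -- intros t Ht H. apply (Hv t Ht). unfold Z in H; tauto.
  - intros [H1 H2]. destruct (classic (g z)) as [Hg|Hg]; [left; auto|].
    destruct (classic (g' z)) as [Hg'|Hg']; [right; left; auto|]. right; right.
    assert (Hz : ~ Z z) by (unfold Z; tauto).
    exists (fun w => exists k, reach Z z (Tn k w)). split; [now apply component_exists|]. split.
    + exists M. intros w [k Hk]. apply Rnot_lt_le. intros Hlt.
      assert (Hr : reach g z (Tn k w)) by (eapply reach_ext; [|exact Hk]; unfold Z; tauto).
      assert (Hr' : reach g' z (Tn k w)) by (eapply reach_ext; [|exact Hk]; unfold Z; tauto).
      destruct (Rlt_dec M (sg * snd w)) as [Hs|Hs].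
      * apply H2. apply side_reach with (Tn k w); auto. apply side_far with M; auto.
      * apply H1. apply side_reach with (Tn k w); auto. apply side_far with M; auto using sign_opp.
        simpl. revert Hlt Hs. unfold Rabs. destruct S as [->| ->]; destruct Rcase_abs; lra.
    + exists 0%Z. rewrite Tn_0. now apply reach_refl.
Qed.

(** * Isotopies and the ends of the annulus *)

Lemma commute_Tn (h : pt -> pt) : (forall z, h (Tr z) = Tr (h z)) -> forall k z, h (Tn k z) = Tn k (h z).
Proof.
  intros H.
  assert (N : forall n z, h (Tn (Z.of_nat n) z) = Tn (Z.of_nat n) (h z)).
  { induction n as [|n IH]; intros z; [now rewrite !Tn_0|].
    rewrite Nat2Z.inj_succ, <- Z.add_1_r, <- !Tn_Tn.
    change (Tn 1 ?w) with (Tr w). now rewrite H, IH. }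
  intros k z. destruct (Z_le_gt_dec 0 k).
  - rewrite <- (Z2Nat.id k) by auto. apply N.
  - assert (E := N (Z.to_nat (- k)) (Tn k z)). rewrite Z2Nat.id in E by lia.
    rewrite Tn_Tn in E. replace (k + - k)%Z with 0%Z in E by lia. rewrite Tn_0 in E.
    rewrite E, Tn_opp. reflexivity.
Qed.

Lemma inverse_Tn (h h' : pt -> pt) : (forall z, h' (h z) = z) -> (forall z, h (h' z) = z) ->
  (forall k z, h (Tn k z) = Tn k (h z)) -> forall k z, h' (Tn k z) = Tn k (h' z).
Proof. intros H1 H2 HT k z. rewrite <- (H1 (Tn k (h' z))), HT, H2. reflexivity. Qed.

Lemma band_bounded (phi : pt -> R) M : (forall z : pt, continuous phi z) ->
  (forall k z, phi (Tn k z) = phi z) ->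
  exists H, 0 <= H /\ forall z, Rabs (snd z) <= M -> Rabs (phi z) <= H.
Proof.
  intros Cp Ip. apply NNPP. intros Hn.
  assert (HS : forall n, { z : pt | (0 <= fst z <= 1 /\ - M <= snd z <= M) /\ INR n < Rabs (phi z) }).
  { intros n. apply constructive_indefinite_description. apply NNPP. intros Hz. apply Hn.
    exists (INR n). split; [apply pos_INR|]. intros z Hs. apply Rnot_lt_le. intros Hlt. apply Hz.
    destruct (Tn_unit z) as [k Hk]. exists (Tn k z). rewrite Ip. repeat split; auto; try lra; simpl;
    revert Hs; unfold Rabs; destruct Rcase_abs; lra. }
  destruct (rectangle_cluster (fun n => proj1_sig (HS n)) 0 1 (- M) M) as [z [_ HC]].
  { intros n. apply (proj2_sig (HS n)). }
  destruct (INR_unbounded (Rabs (phi z) + 1)) as [N HN].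
  destruct (HC _ (continuous_eps phi z (Cp z) 1 Rlt_0_1) N) as [n [Hn1 Hn2]].
  destruct (proj2_sig (HS n)) as [_ Hb]. apply le_INR in Hn1.
  revert HN Hn2 Hb. unfold Rabs; repeat destruct Rcase_abs; lra.
Qed.

Section Ends.
Variable K : R -> pt -> pt.
Hypothesis HK : isotopy_lift K.

Lemma isotopy_0 z : K 0 z = z.
Proof. apply HK. Qed.

Lemma isotopy_Tn t k z : 0 <= t <= 1 -> K t (Tn k z) = Tn k (K t z).
Proof. intros Ht. apply commute_Tn. intros w. now apply HK. Qed.

Lemma isotopy_continuous (p : R * pt) :
  continuous (fun p : R * pt => K (clamp (fst p)) (snd p)) p.
Proof.
  destruct HK as [_ [Cc _]]. apply filterlim_locally. intros e.
  destruct (Cc (clamp (fst p)) (snd p) e (clamp_in _) (cond_pos e)) as [d [Hd Hw]].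
  exists (mkposreal d Hd). intros [t w] [H1 H2].
  assert (D : d2 (K (clamp t) w) (K (clamp (fst p)) (snd p)) < e).
  { apply Hw.
    - apply clamp_in.
    - eapply Rle_lt_trans; [apply clamp_lipschitz|exact H1].
    - apply d2_lt. exact H2. }
  apply d2_lt in D. exact D.
Qed.

Lemma isotopy_continuous_comp {X : UniformSpace} (u : X -> R) (v : X -> pt) x :
  continuous u x -> continuous v x -> continuous (fun a => K (clamp (u a)) (v a)) x.
Proof.
  intros Hu Hv. apply (continuous_comp (fun a => (u a, v a)) (fun p => K (clamp (fst p)) (snd p))).
  - now apply continuous_pair.
  - apply isotopy_continuous.
Qed.

Lemma isotopy_at_continuous t (z : pt) : 0 <= t <= 1 -> continuous (K t) z.
Proof.
  intros Ht. apply continuous_ext with (fun w => K (clamp t) w).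
  - intros w. now rewrite clamp_id.
  - apply isotopy_continuous_comp; ctn.
Qed.

Lemma isotopy_inverse t : 0 <= t <= 1 -> exists h, (forall z, h (K t z) = z) /\
  (forall z, K t (h z) = z) /\ (forall z : pt, continuous h z).
Proof.
  intros Ht. destruct HK as [_ [_ [Hh _]]]. destruct (Hh t Ht) as [_ [h [H1 [H2 H3]]]].
  exists h. repeat split; auto. intros z. now apply continuous_pt, H3.
Qed.

Lemma isotopy_injective t z w : 0 <= t <= 1 -> K t z = K t w -> z = w.
Proof. intros Ht E. destruct (isotopy_inverse t Ht) as [h [H1 _]]. now rewrite <- (H1 z), E. Qed.

(* The lines [y = sg * H] are sent outside the band [|y| <= M]; as [K t] is a bijection,
   the connected complement of the image of such a line on the side of the origin is
   covered by the image of the half-plane that contains the origin. *)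
Lemma ends_local t0 sg M : 0 <= t0 <= 1 -> sign sg ->
  exists H e sg', sign sg' /\ 0 < e /\ forall t, 0 <= t <= 1 -> Rabs (t - t0) < e ->
    forall z, H <= sg * snd z -> M < sg' * snd (K t z).
Proof.
  intros Ht0 S.
  destruct (continuous_interval_bounded (fun t => snd (K (clamp t) (0, 0)))) as [B HB].
  { intros t. apply continuous_snd_comp, isotopy_continuous_comp; ctn. }
  assert (HB' : forall t, 0 <= t <= 1 -> Rabs (snd (K t (0, 0))) <= B).
  { intros t Ht. rewrite <- (clamp_id t Ht) at 1. auto. }
  (* The band is enlarged to contain the whole trajectory of the origin, which then serves as a
     reference point inside the band at all times. *)
  set (M' := Rmax M B).
  assert (HM : M <= M') by apply Rmax_l. assert (HBM : B <= M') by apply Rmax_r.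
  assert (B0 : 0 <= B) by (eapply Rle_trans; [apply Rabs_pos|apply (HB' t0 Ht0)]).
  destruct (isotopy_inverse t0 Ht0) as [h [h1 [h2 Ch]]].
  assert (Th : forall k z, h (Tn k z) = Tn k (h z)).
  { apply (inverse_Tn (K t0)); auto. intros; now apply isotopy_Tn. }
  destruct (band_bounded (fun z => snd (h z)) M') as [H0 [H0pos HH0]].
  { intros z. ctn. }
  { intros k z. rewrite Th. reflexivity. }
  set (H := H0 + 1).
  assert (Far : forall z, H <= sg * snd z -> M' < Rabs (snd (K t0 z))).
  { intros z Hz. apply Rnot_le_lt. intros Hle. specialize (HH0 _ Hle). rewrite h1 in HH0.
    revert HH0 Hz. unfold H, Rabs. destruct S as [->| ->]; destruct Rcase_abs; lra. }
  assert (sgH : forall x : R, H <= sg * snd (x, sg * H)) by (intros; simpl; destruct S as [->| ->]; lra).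
  assert (exists sg', sign sg' /\ M' < sg' * snd (K t0 (0, sg * H))) as [sg' [S' Hs']].
  { assert (A := Far (0, sg * H) (sgH 0)). revert A. unfold Rabs at 1. destruct Rcase_abs.
    - exists (-1). split; [right; auto|lra].
    - exists 1. split; [left; auto|lra]. }
  assert (Line : forall x, M' < sg' * snd (K t0 (x, sg * H))).
  { intros x. apply Rnot_le_lt. intros Hle.
    assert (A := Far (x, sg * H) (sgH x)).
    assert (D : sg' * snd (K t0 (x, sg * H)) < - M').
    { revert A Hle. unfold Rabs at 1. destruct S' as [->| ->]; destruct Rcase_abs; lra. }
    set (u := fun s => sg' * snd (K t0 (seg (0, sg * H) (x, sg * H) s))).
    destruct (IVT_unit_any u 0) as [s [Hs Es]].
    - intros s. unfold u. apply continuous_Rmult_comp; [ctn|]. apply continuous_snd_comp.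
      apply (continuous_comp (seg (0, sg * H) (x, sg * H)) (K t0)); [apply seg_continuous|].
      now apply isotopy_at_continuous.
    - right. unfold u. rewrite seg_0, seg_1. lra.
    - unfold u in Es.
      assert (Hs2 : H <= sg * snd (seg (0, sg * H) (x, sg * H) s)).
      { unfold seg; simpl. destruct S as [->| ->]; lra. }
      apply Far in Hs2.
      assert (snd (K t0 (seg (0, sg * H) (x, sg * H) s)) = 0) by (destruct S' as [->| ->]; lra).
      rewrite H1, Rabs_R0 in Hs2. lra. }
  destruct (interval_uniform (fun N x => 0 < N /\ forall t, 0 <= t <= 1 -> Rabs (t - t0) < / N ->
     M' < sg' * snd (K t (x, sg * H)))) as [N HN].
  { intros N N' x Hle [HN HP]. split; [lra|]. intros t Ht Htt. apply HP; auto.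
    eapply Rlt_le_trans; [exact Htt|]. apply Rinv_le_contravar; auto. }
  { intros x Hx.
    assert (Cu : continuous (fun p : R * R => sg' * snd (K (clamp (fst p)) (snd p, sg * H))) (t0, x)).
    { apply continuous_Rmult_comp; [ctn|]. apply continuous_snd_comp, isotopy_continuous_comp; ctn. }
    destruct (continuous_gt _ (t0, x) M' Cu) as [e He].
    { simpl. rewrite clamp_id by auto. apply Line. }
    exists e, (/ e). assert (Hp := cond_pos e). split; auto. intros y Hy Hyx.
    split; [now apply Rinv_0_lt_compat|]. intros t Ht Htt. rewrite Rinv_inv in Htt.
    specialize (He (t, y)). simpl in He. rewrite clamp_id in He by auto. apply He.
    split; [exact Htt|exact Hyx]. }
  exists H, (/ N), sg'. split; auto.
  split; [destruct (HN 0) as [? _]; [lra|]; now apply Rinv_0_lt_compat|].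
  intros t Ht Htt z Hz. apply Rle_lt_trans with M'; auto. apply Rnot_le_lt. intros Hle.
  assert (Line' : forall x, M' < sg' * snd (K t (x, sg * H))).
  { intros x. destruct (Tn_unit (x, sg * H)) as [k Hk]. destruct (HN _ Hk) as [_ A].
    specialize (A t Ht Htt). change (fst (Tn k (x, sg * H)), sg * H) with (Tn k (x, sg * H)) in A.
    rewrite isotopy_Tn in A by auto. exact A. }
  destruct (isotopy_inverse t Ht) as [h' [h1' [h2' Ch']]].
  set (q := fun s => h' (seg (K t (0, 0)) (K t z) s)).
  destruct (IVT_unit_any (fun s => sg * snd (q s)) H) as [s [Hs Es]].
  - intros s. unfold q. apply continuous_Rmult_comp; [ctn|]. apply continuous_snd_comp.
    apply (continuous_comp (seg (K t (0, 0)) (K t z)) h'); [apply seg_continuous|]. apply Ch'.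
  - left. unfold q. rewrite seg_0, seg_1, !h1'. simpl. unfold H in *. lra.
  - assert (Eq : q s = (fst (q s), sg * H)).
    { rewrite (surjective_pairing (q s)) at 1. f_equal. destruct S as [->| ->]; lra. }
    assert (A := Line' (fst (q s))). rewrite <- Eq in A. unfold q in A. rewrite h2' in A.
    unfold seg in A; simpl in A.
    assert (B1 := HB' t Ht). assert (sg' * snd (K t (0, 0)) <= M').
    { revert B1. unfold Rabs. destruct S' as [->| ->]; destruct Rcase_abs; lra. }
    replace (sg' * (snd (K t (0, 0)) + s * (snd (K t z) - snd (K t (0, 0))))) with
      ((1 - s) * (sg' * snd (K t (0, 0))) + s * (sg' * snd (K t z))) in A by ring.
    nra.
Qed.

Definition preserves_end (sg : R) (f : pt -> pt) : Prop :=
  forall M, exists H, forall z, H <= sg * snd z -> M < sg * snd (f z).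

Lemma ends_sign t0 sg : 0 <= t0 <= 1 -> sign sg ->
  (exists H, forall z, H <= sg * snd z -> 0 < sg * snd (K t0 z)) -> preserves_end sg (K t0).
Proof.
  intros Ht0 S [H HH] M. destruct (ends_local t0 sg (Rmax M 0) Ht0 S) as [H2 [e [sg' [S' [He HL]]]]].
  specialize (HL t0 Ht0). rewrite Rminus_diag, Rabs_R0 in HL. specialize (HL He).
  set (z := (0, sg * Rmax H H2)).
  assert (A := HH z). assert (B := HL z). unfold z in A, B; simpl in A, B.
  assert (E : sg * (sg * Rmax H H2) = Rmax H H2) by (destruct S as [->| ->]; lra).
  rewrite E in A, B. specialize (A (Rmax_l _ _)). specialize (B (Rmax_r _ _)).
  assert (Rm := Rmax_r M 0). assert (Rl := Rmax_l M 0).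
  assert (sg' = sg) by (destruct S as [->| ->]; destruct S' as [->| ->]; lra). subst sg'.
  exists H2. intros w Hw. specialize (HL w Hw). lra.
Qed.

(** By [ends_local], the end to which a given end is sent is locally constant in [t]; at [t = 0] it
    is the same end. *)
Lemma isotopy_preserves_end t sg : 0 <= t <= 1 -> sign sg -> preserves_end sg (K t).
Proof.
  intros Ht S.
  assert (L : forall t0, 0 <= t0 <= 1 -> exists e, 0 < e /\
    ((forall t, 0 <= t <= 1 -> Rabs (t - t0) < e -> preserves_end sg (K t)) \/
     (forall t, 0 <= t <= 1 -> Rabs (t - t0) < e -> ~ preserves_end sg (K t)))).
  { intros t0 Ht0. destruct (ends_local t0 sg 0 Ht0 S) as [H [e [sg' [S' [He HL]]]]].
    exists e. split; auto. destruct (Req_dec sg sg') as [<-|Hne].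
    - left. intros t' Ht' Htt. apply ends_sign; eauto.
    - right. intros t' Ht' Htt Hp. destruct (Hp 0) as [H' HH].
      set (z := (0, sg * Rmax H H')).
      assert (E : sg * snd z = Rmax H H') by (simpl; destruct S as [->| ->]; lra).
      assert (A := HL t' Ht' Htt z). assert (B := HH z). rewrite E in A, B.
      specialize (A (Rmax_l _ _)). specialize (B (Rmax_r _ _)).
      destruct S as [->| ->]; destruct S' as [->| ->]; lra. }
  assert (R0 : forall t0, Rabs (t0 - t0) = 0) by (intros; rewrite Rminus_diag; apply Rabs_R0).
  apply (interval_connected (fun t => preserves_end sg (K t))); auto.
  - intros t0 Ht0 H. destruct (L t0 Ht0) as [e [He [A|A]]]; [eauto|].
    exfalso. apply (A t0); auto. rewrite R0; auto.
  - intros t0 Ht0 H. destruct (L t0 Ht0) as [e [He [A|A]]]; [|eauto].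
    exfalso. apply H, A; auto. rewrite R0; auto.
  - intros M. exists (M + 1). intros z Hz. rewrite isotopy_0. lra.
Qed.

Lemma isotopy_ends_uniform sg M : sign sg -> exists H, forall t, 0 <= t <= 1 ->
  forall z, H <= sg * snd z -> M < sg * snd (K t z).
Proof.
  intros S. apply (interval_uniform (fun H t => forall z, H <= sg * snd z -> M < sg * snd (K t z))).
  - intros H H' t Hle HP z Hz. apply HP; lra.
  - intros t0 Ht0. destruct (ends_local t0 sg (Rmax M 0) Ht0 S) as [H [e [sg' [S' [He HL]]]]].
    exists e, H. split; auto. intros t Ht Htt z Hz. specialize (HL t Ht Htt).
    destruct (isotopy_preserves_end t sg Ht S 0) as [H' HH].
    set (w := (0, sg * Rmax H H')).
    assert (E : sg * snd w = Rmax H H') by (simpl; destruct S as [->| ->]; lra).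
    assert (A := HL w). assert (B := HH w). rewrite E in A, B.
    specialize (A (Rmax_l _ _)). specialize (B (Rmax_r _ _)).
    assert (Rm := Rmax_r M 0). assert (Rl := Rmax_l M 0).
    assert (sg' = sg) by (destruct S as [->| ->]; destruct S' as [->| ->]; lra). subst sg'.
    specialize (HL z Hz). lra.
Qed.
End Ends.

(** * Homeomorphisms of the annulus and their action on sides *)

Record annulus_homeo (f g : pt -> pt) : Prop := {
  ah_gf : forall z, g (f z) = z;
  ah_fg : forall z, f (g z) = z;
  ah_f_continuous : forall z : pt, continuous f z;
  ah_g_continuous : forall z : pt, continuous g z;
  ah_f_Tn : forall k z, f (Tn k z) = Tn k (f z);
  ah_g_Tn : forall k z, g (Tn k z) = Tn k (g z);
  ah_f_ends : forall sg, sign sg -> preserves_end sg f;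
  ah_g_ends : forall sg, sign sg -> preserves_end sg g }.

Lemma annulus_homeo_sym f g : annulus_homeo f g -> annulus_homeo g f.
Proof. intros []. now constructor. Qed.

Lemma homeo2_comp h k : homeo2 h -> homeo2 k -> homeo2 (fun z => h (k z)).
Proof.
  intros [Ch [h' [h1 [h2 Ch']]]] [Ck [k' [k1 [k2 Ck']]]]. split.
  - intros z. apply -> (continuous_pt (fun z => h (k z))).
    apply (continuous_comp k h); apply continuous_pt; [apply Ck|apply Ch].
  - exists (fun z => k' (h' z)). split; [|split].
    + intros z. now rewrite h1.
    + intros z. now rewrite k2.
    + intros z. apply -> (continuous_pt (fun z => k' (h' z))).
      apply (continuous_comp h' k'); apply continuous_pt; [apply Ch'|apply Ck'].
Qed.

Lemma homeo2_id : homeo2 (fun z => z).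
Proof.
  split; [intros z e He; exists e; auto|].
  exists (fun z => z). repeat split; auto. intros z e He; exists e; auto.
Qed.

(** Running the isotopy backwards after [g] gives an isotopy from the identity to [g], so that
    arguments for [f] apply to its inverse. *)
Lemma isotopy_reverse K g : isotopy_lift K -> (forall z, g (K 1 z) = z) -> (forall z, K 1 (g z) = z) ->
  isotopy_lift (fun t z => K (1 - t) (g z)).
Proof.
  intros HK H1 H2. destruct HK as [K0 [Kc [Kh KT]]] eqn:E. clear E.
  destruct (Kh 1 ltac:(lra)) as [Cf [h [h1 [h2 Ch]]]].
  assert (Eg : forall z, h z = g z) by (intros z; rewrite <- (H2 z) at 1; now rewrite h1).
  assert (Hg : homeo2 g).
  { split; [intros z e He; destruct (Ch z e He) as [d Hd]; exists d; rewrite <- !Eg|].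
    - split; [tauto|]. intros w. rewrite <- Eg. apply Hd.
    - exists (K 1). repeat split; auto. }
  split; [intros z; now rewrite Rminus_0_r|]. split; [|split].
  - intros t z e Ht He. destruct (Kc (1 - t) (g z) e ltac:(lra) He) as [d [Hd Hw]].
    destruct Hg as [Cg _]. destruct (Cg z d Hd) as [d' [Hd' Hw']].
    exists (Rmin d d'). split; [now apply Rmin_glb_lt|]. intros s w Hs Hst Hwz.
    apply Hw; [lra| |].
    + replace (1 - s - (1 - t)) with (- (s - t)) by ring. rewrite Rabs_Ropp.
      eapply Rlt_le_trans; [exact Hst|apply Rmin_l].
    + apply Hw'. eapply Rlt_le_trans; [exact Hwz|apply Rmin_r].
  - intros t Ht. apply (homeo2_comp (K (1 - t)) g); auto. apply Kh; lra.
  - intros t z Ht. rewrite <- KT by lra. f_equal.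
    rewrite <- (H2 z) at 1. rewrite <- KT by lra. apply H1.
Qed.

Lemma isotopy_comp K L : isotopy_lift K -> isotopy_lift L -> isotopy_lift (fun t z => K t (L t z)).
Proof.
  intros [K0 [Kc [Kh KT]]] [L0 [Lc [Lh LT]]]. split; [|split; [|split]].
  - intros z. now rewrite L0, K0.
  - intros t z e Ht He. destruct (Kc t (L t z) e Ht He) as [d [Hd Hw]].
    destruct (Lc t z d Ht Hd) as [d' [Hd' Hw']].
    exists (Rmin d d'). split; [now apply Rmin_glb_lt|]. intros s w Hs Hst Hwz.
    apply Hw; auto; [|apply Hw'; auto].
    + eapply Rlt_le_trans; [exact Hst|apply Rmin_l].
    + eapply Rlt_le_trans; [exact Hst|apply Rmin_r].
    + eapply Rlt_le_trans; [exact Hwz|apply Rmin_r].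
  - intros t Ht. apply (homeo2_comp (K t) (L t)); auto.
  - intros t z Ht. rewrite LT, KT; auto.
Qed.

Lemma isotopy_iter K n : isotopy_lift K -> isotopy_lift (fun t => iter n (K t)).
Proof.
  intros HK. induction n as [|n IH]; simpl.
  - split; [auto|]. split; [|split; auto using homeo2_id].
    intros t z e Ht He. exists e. auto.
  - apply (isotopy_comp K (fun t => iter n (K t))); auto.
Qed.

Lemma isotopy_annulus_homeo K g : isotopy_lift K ->
  (forall z, g (K 1 z) = z) -> (forall z, K 1 (g z) = z) -> annulus_homeo (K 1) g.
Proof.
  intros HK H1 H2. assert (HR := isotopy_reverse K g HK H1 H2).
  assert (E : forall z, K (1 - 1) (g z) = g z).
  { intros z. replace (1 - 1) with 0 by ring. now apply isotopy_0. }
  assert (I : 0 <= 1 <= 1) by lra.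
  constructor; auto.
  - intros z. now apply isotopy_at_continuous.
  - intros z. apply continuous_ext with (fun z => K (1 - 1) (g z)); auto.
    apply (isotopy_at_continuous _ HR 1 z I).
  - intros k z. now apply isotopy_Tn.
  - apply (inverse_Tn (K 1)); auto. intros; now apply isotopy_Tn.
  - intros sg S. now apply isotopy_preserves_end.
  - intros sg S M. destruct (isotopy_preserves_end _ HR 1 sg I S M) as [H HH].
    exists H. intros z Hz. rewrite <- E. now apply HH.
Qed.

Section Images.
Variables (f g : pt -> pt).
Hypothesis fg : annulus_homeo f g.

Lemma image_bounded (c : pt -> Prop) M : (forall z, c z -> Rabs (snd z) <= M) ->
  exists M', 0 <= M' /\ forall z, c (g z) -> Rabs (snd z) <= M'.
Proof.
  intros HM. destruct (band_bounded (fun z => snd (f z)) M) as [H [H0 HH]].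
  - intros z. assert (C := ah_f_continuous f g fg). ctn.
  - intros k z. rewrite (ah_f_Tn f g fg). reflexivity.
  - exists H. split; auto. intros z Hz. rewrite <- (ah_fg f g fg z). auto.
Qed.

(** [fun w => c (g w)] is the image of [c] under [f]. A path from [z] that goes far enough towards
    the end [sg] is mapped to one that ends beyond this image, because [f] preserves the ends. *)
Lemma side_image_1 (c : pt -> Prop) sg z M : sign sg -> (forall z, c z -> Rabs (snd z) <= M) ->
  side sg c z -> side sg (fun w => c (g w)) (f z).
Proof.
  intros S HM Hs. destruct (image_bounded c M HM) as [M' [M0 HM']].
  destruct (ah_f_ends f g fg sg S M') as [H HH].
  destruct (side_sray sg c z S Hs) as [r Hr]. destruct (Hr H) as [p [Cp [p0 [Hp Hp1]]]].
  apply side_reach with (f (p 1)).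
  - apply side_far with M'; auto.
  - exists (fun s => f (p s)). split; [assert (C := ah_f_continuous f g fg); ctn|].
    rewrite p0. repeat split; auto. intros s Hs'. rewrite (ah_gf f g fg).
    apply (side_not sg). apply Hp; auto.
Qed.
End Images.

Lemma side_ext sg (c c' : pt -> Prop) z : (forall w, c w <-> c' w) -> side sg c z -> side sg c' z.
Proof.
  intros E [w [Hr Hv]]. exists w. split.
  - eapply reach_ext; [|exact Hr]. apply E.
  - intros t Ht. rewrite <- E. auto.
Qed.

Lemma side_image f g (c : pt -> Prop) sg z : annulus_homeo f g -> essential_continuum c -> sign sg ->
  side sg (fun w => c (g w)) (f z) <-> side sg c z.
Proof.
  intros fg E S. destruct (ec_bounded c E) as [M [_ HM]]. split.
  - intros H. destruct (image_bounded f g fg c M HM) as [M' [_ HM']].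
    apply (side_image_1 g f (annulus_homeo_sym _ _ fg) _ sg _ M' S) in H; auto.
    rewrite (ah_gf f g fg) in H. eapply side_ext; [|exact H].
    intros w. simpl. now rewrite (ah_gf f g fg).
  - now apply side_image_1 with M.
Qed.

Lemma locally_preimage (f : pt -> pt) (P : pt -> Prop) (z : pt) :
  continuous f z -> locally (f z) P -> locally z (fun w => P (f w)).
Proof. intros C H. exact (C _ H). Qed.

Lemma ec_image f g (c : pt -> Prop) : annulus_homeo f g -> essential_continuum c ->
  essential_continuum (fun w => c (g w)).
Proof.
  intros fg E. constructor.
  - intros k z. rewrite (ah_g_Tn f g fg). apply (ec_invariant c E).
  - intros z Hz. apply (locally_preimage g (fun w => ~ c w)).
    + apply (ah_g_continuous f g fg).
    + now apply ec_closed.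
  - destruct (ec_bounded c E) as [M [_ HM]]. now apply (image_bounded f g fg c M).
  - intros P IP OP NP.
    assert (Eg := ah_gf f g fg). assert (Ef := ah_fg f g fg).
    destruct (ec_connected c E (fun z => P (f z))) as [A|A].
    + intros k z. rewrite (ah_f_Tn f g fg). apply IP.
    + intros z Hz HP. apply (locally_preimage f P); [apply (ah_f_continuous f g fg)|].
      apply OP; auto. now rewrite Eg.
    + intros z Hz HP. apply (locally_preimage f (fun w => ~ P w)); [apply (ah_f_continuous f g fg)|].
      apply NP; auto. now rewrite Eg.
    + left. intros z Hz. rewrite <- (Ef z). auto.
    + right. intros z Hz. rewrite <- (Ef z). auto.
  - intros z H1 H2. rewrite <- (ah_fg f g fg z) in H1, H2.
    apply (side_image f g c) in H1; auto; [|left; auto].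
    apply (side_image f g c) in H2; auto; [|right; auto].
    apply (ec_separating c E _ H1 H2).
Qed.

Definition moves (sg : R) (f : pt -> pt) (c : pt -> Prop) : Prop :=
  forall z, c z -> side sg c (f z).

Section Moves.
Variables (f g : pt -> pt) (c : pt -> Prop) (sg : R).
Hypothesis fg : annulus_homeo f g.
Hypothesis E : essential_continuum c.
Hypothesis S : sign sg.
Hypothesis H : moves sg f c.

Lemma moves_image z : c (g z) -> side sg c z.
Proof. intros Hz. rewrite <- (ah_fg f g fg z). now apply H. Qed.

(** [f] maps [side sg c] to the same side of [f(c)], and that side is contained in [side sg c]
    because [f(c)] lies beyond [c]. *)
Lemma moves_side z : side sg c z -> side sg c (f z).
Proof.
  intros Hz. apply (side_beyond c (fun w => c (g w))); auto using moves_image.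
  - now apply (ec_image f).
  - now apply (side_image f g).
Qed.

Lemma moves_side_back z : side (- sg) c (f z) -> side (- sg) c z.
Proof.
  intros Hz. apply (side_image f g c); auto using sign_opp.
  apply side_opp_beyond with c; auto using moves_image. now apply (ec_image f).
Qed.

Lemma moves_trap z : ~ side sg c z -> side (- sg) c (g z).
Proof.
  intros Hz. apply (side_image f g c); auto using sign_opp. rewrite (ah_fg f g fg).
  apply not_side_beyond with c; auto using moves_image. now apply (ec_image f).
Qed.

Lemma moves_inverse : moves (- sg) g c.
Proof. intros z Hz. apply moves_trap. intros Hs. now apply (side_not _ _ _ Hs). Qed.
End Moves.

Lemma free_moves f g c : annulus_homeo f g -> essential_continuum c ->
  (forall z, c z -> ~ c (f z)) -> moves 1 f c \/ moves (-1) f c.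
Proof.
  intros fg E Hf. destruct (ec_dichotomy c (fun w => c (g w))) as [A|A]; auto.
  - now apply (ec_image f).
  - intros z H1 H2. apply (Hf (g z)); auto. now rewrite (ah_fg f g fg).
  - left. intros z Hz. apply A. now rewrite (ah_gf f g fg).
  - right. intros z Hz. apply A. now rewrite (ah_gf f g fg).
Qed.

(** Whichever way the free curve moves, a point outside [side sg c] has its image or its preimage in
    [side (- sg) c]. Consequently points of the maximal invariant sets stay off the boundary
    curves. *)
Lemma free_invariant_side f g c sg z : annulus_homeo f g -> essential_continuum c -> sign sg ->
  (forall z, c z -> ~ c (f z)) ->
  ~ side (- sg) c (f z) -> ~ side (- sg) c (g z) -> side sg c z.
Proof.
  intros fg E S Hf H1 H2. apply NNPP. intros Hn.
  assert (Hm : moves sg f c \/ moves (- sg) f c).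
  { destruct (free_moves f g c) as [A|A]; auto; destruct S as [->| ->]; auto;
    replace (- -1) with 1 by ring; auto. }
  destruct Hm as [Hm|Hm].
  - apply H2. now apply (moves_trap f g c sg).
  - apply H1. apply (moves_trap g f c sg); auto using annulus_homeo_sym.
    assert (Hm' := moves_inverse f g c (- sg) fg E (sign_opp _ S) Hm).
    now rewrite Ropp_involutive in Hm'.
Qed.

(** * Linking of orbits *)

(** The factor [sg] reflects the horizontal axis when necessary, so that the first orbit always
    passes from the left of the second to its right. *)
Definition diff (sg : R) (p q : pt) : pt := (sg * (fst p - fst q), snd p - snd q).

Lemma diff_nonzero sg p q : sign sg -> p <> q -> diff sg p q <> (0, 0).
Proof.
  intros S H E. apply H. unfold diff in E. injection E as E1 E2.
  destruct p as [x y], q as [x' y']; simpl in *. f_equal; [|lra].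
  destruct S as [->| ->]; lra.
Qed.

Lemma dot_right v : dot (cos 0, sin 0) v = fst v.
Proof. unfold dot; simpl. rewrite cos_0, sin_0. ring. Qed.

Lemma dot_up v : dot (cos (PI / 2), sin (PI / 2)) v = snd v.
Proof. unfold dot; simpl. rewrite cos_PI2, sin_PI2. ring. Qed.

Lemma dot_down v : dot (cos (- (PI / 2)), sin (- (PI / 2))) v = - snd v.
Proof. unfold dot; simpl. rewrite cos_neg, sin_neg, cos_PI2, sin_PI2. ring. Qed.

Lemma dot_left v : dot (cos (- PI), sin (- PI)) v = - fst v.
Proof. unfold dot; simpl. rewrite cos_neg, sin_neg, cos_PI, sin_PI. ring. Qed.

Lemma dot_up_neg v : dot (cos (- PI - PI / 2), sin (- PI - PI / 2)) v = snd v.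
Proof.
  replace (- PI - PI / 2) with (- (PI / 2 + PI)) by field.
  unfold dot; simpl. rewrite cos_neg, sin_neg, neg_cos, neg_sin, cos_PI2, sin_PI2. ring.
Qed.

(** Half-planes a quarter turn apart overlap in a quadrant. The vector lies in it, so the
    determination fixed by the window at [c] is also in the window at [c'], with no ambiguity of
    [2 * PI]. *)
Lemma near_quadrant c c' v B : near c B -> is_angle v B ->
  c' = c + PI / 2 \/ c' = c - PI / 2 -> 0 < dot (cos c', sin c') v -> near c' B.
Proof.
  intros Hn HB Hc Hd. destruct (dot_angle c' v B HB) as [r [Hr E]]. rewrite E in Hd.
  assert (Hcos : 0 < cos (B - c')) by nra. assert (P := PI_RGT_0). unfold near in *.
  destruct Hc as [->| ->].
  - split; [|lra]. apply Rnot_le_lt. intros Hle.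
    assert (cos (c + PI / 2 - B) <= 0) by (apply cos_le_0; lra).
    rewrite <- cos_neg in H. replace (- (c + PI / 2 - B)) with (B - (c + PI / 2)) in H by ring. lra.
  - split; [lra|]. apply Rnot_le_lt. intros Hle.
    assert (cos (B - (c - PI / 2)) <= 0) by (apply cos_le_0; lra). lra.
Qed.

Definition down := - (PI / 2).

(** Singles out the determination [A] of the initial angle for which lowering the first point turns
    the vector to the value near [- PI / 2] itself, rather than to another angle of the downward
    direction. [up_ok] does the same by raising the second point. *)
Definition down_ok sg (p : R -> pt) (q : pt) (A : R) : Prop :=
  exists B, angle_lift (fun s => diff sg (p s) q) A B /\ near down B.

Definition up_ok sg (p : pt) (q : R -> pt) (A : R) : Prop :=
  exists B, angle_lift (fun t => diff sg p (q t)) A B /\ near down B.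

Lemma diff_below sg p q : snd p < snd q -> 0 < dot (cos down, sin down) (diff sg p q).
Proof. intros H. unfold down. rewrite dot_down. simpl. lra. Qed.

(* Lowering [p] and raising [q] prescribe the same determination of the angle of [p 0 - q 0]. *)
Lemma down_up_ok sg (p q : R -> pt) A : sign sg ->
  (forall s, continuous p s) -> (forall t, continuous q t) ->
  (forall s t, 0 <= s <= 1 -> 0 <= t <= 1 -> p s <> q t) ->
  (forall t, 0 <= t <= 1 -> snd (p 1) < snd (q t)) ->
  (forall s, 0 <= s <= 1 -> snd (p s) < snd (q 1)) ->
  is_angle (diff sg (p 0) (q 0)) A ->
  (down_ok sg p (q 0) A <-> up_ok sg (p 0) q A).
Proof.
  intros S Cp Cq Hne Hp1 Hq1 HA.
  destruct (angle_lift_square (fun s t => diff sg (p s) (q t))) with (A := A)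
    as [B [C [D [LB [LC [LBD LCD]]]]]]; auto.
  - intros u. unfold diff. ctn.
  - intros s t Hs Ht. apply diff_nonzero; auto.
  - assert (N1 : near down B <-> near down D).
    { apply (angle_lift_half_plane _ _ _ down LBD). intros s Hs. apply diff_below; auto. }
    assert (N2 : near down C <-> near down D).
    { apply (angle_lift_half_plane _ _ _ down LCD). intros s Hs. apply diff_below; auto. }
    split; intros [B' [L N]].
    + rewrite (angle_lift_unique _ _ _ _ L LB) in N. exists C. split; auto. tauto.
    + rewrite (angle_lift_unique _ _ _ _ L LC) in N. exists B. split; auto. tauto.
Qed.

Section Isotopy.
Variables (K : R -> pt -> pt) (sg : R).
Hypothesis HK : isotopy_lift K.
Hypothesis S : sign sg.

(** The second parameter of the square is the time of the isotopy; injectivity of each [K t] keeps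
    the two moving points apart. *)
Lemma isotopy_square (p q : R -> pt) A :
  (forall s, continuous p s) -> (forall s, continuous q s) ->
  (forall s, 0 <= s <= 1 -> p s <> q s) ->
  is_angle (diff sg (p 0) (q 0)) A -> exists B C D,
  angle_lift (fun s => diff sg (p s) (q s)) A B /\
  angle_lift (fun t => diff sg (K (clamp t) (p 0)) (K (clamp t) (q 0))) A C /\
  angle_lift (fun t => diff sg (K (clamp t) (p 1)) (K (clamp t) (q 1))) B D /\
  angle_lift (fun s => diff sg (K 1 (p s)) (K 1 (q s))) C D.
Proof.
  intros Cp Cq Hne HA.
  destruct (angle_lift_square (fun s t => diff sg (K (clamp t) (p s)) (K (clamp t) (q s))))
    with (A := A) as [B [C [D [LB [LC [LBD LCD]]]]]].
  - intros u. unfold diff.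
    assert (Kp : continuous (fun u : R * R => K (clamp (snd u)) (p (fst u))) u)
      by (apply isotopy_continuous_comp; auto; ctn).
    assert (Kq : continuous (fun u : R * R => K (clamp (snd u)) (q (fst u))) u)
      by (apply isotopy_continuous_comp; auto; ctn).
    ctn.
  - intros s t Hs Ht. apply diff_nonzero; auto. intros E.
    apply (isotopy_injective K HK) in E; [|apply clamp_in]. now apply (Hne s).
  - rewrite clamp_id by lra. now rewrite !(isotopy_0 K HK).
  - exists B, C, D. rewrite clamp_id in LB by lra. rewrite clamp_id in LCD by lra.
    split; [|auto]. destruct LB as [th [T1 [T2 [T3 T4]]]]. exists th. repeat split; auto.
    intros s Hs. specialize (T4 s Hs). now rewrite !(isotopy_0 K HK) in T4.
Qed.

(** The end of [p] stays below the other point during the whole isotopy, so along that side of the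
    square the vector remains in the lower half-plane. *)
Lemma isotopy_down_ok (p : R -> pt) q A A1 : (forall s, continuous p s) ->
  (forall s, 0 <= s <= 1 -> p s <> q) ->
  (forall t, 0 <= t <= 1 -> snd (K t (p 1)) < snd (K t q)) ->
  down_ok sg p q A ->
  angle_lift (fun t => diff sg (K (clamp t) (p 0)) (K (clamp t) q)) A A1 ->
  down_ok sg (fun s => K 1 (p s)) (K 1 q) A1.
Proof.
  intros Cp Hne Hlow [B [L N]] LA.
  destruct (isotopy_square p (fun _ => q) A) as [B' [C [D [LB [LC [LBD LCD]]]]]]; auto; [ctn| |].
  - now apply angle_lift_angles in L.
  - rewrite (angle_lift_unique _ _ _ _ LA LC). exists D. split; auto.
    apply (angle_lift_half_plane _ _ _ down LBD).
    + intros s Hs. apply diff_below, Hlow, clamp_in.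
    + now rewrite (angle_lift_unique _ _ _ _ LB L).
Qed.

Lemma isotopy_up_ok p (q : R -> pt) A A1 : (forall s, continuous q s) ->
  (forall s, 0 <= s <= 1 -> p <> q s) ->
  (forall t, 0 <= t <= 1 -> snd (K t p) < snd (K t (q 1))) ->
  up_ok sg p q A ->
  angle_lift (fun t => diff sg (K (clamp t) p) (K (clamp t) (q 0))) A A1 ->
  up_ok sg (K 1 p) (fun s => K 1 (q s)) A1.
Proof.
  intros Cq Hne Hlow [B [L N]] LA.
  destruct (isotopy_square (fun _ => p) q A) as [B' [C [D [LB [LC [LBD LCD]]]]]]; auto; [ctn| |].
  - now apply angle_lift_angles in L.
  - rewrite (angle_lift_unique _ _ _ _ LA LC). exists D. split; auto.
    apply (angle_lift_half_plane _ _ _ down LBD).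
    + intros s Hs. apply diff_below, Hlow, clamp_in.
    + now rewrite (angle_lift_unique _ _ _ _ LB L).
Qed.

Lemma path_snd_bounded (p : R -> pt) : (forall s, continuous p s) ->
  exists M, forall s, 0 <= s <= 1 -> Rabs (snd (p s)) <= M.
Proof. intros Cp. apply continuous_interval_bounded. ctn. Qed.

Variables (g : pt -> pt) (c P0 P2 : pt -> Prop) (th w : pt) (r : R).
Hypothesis g_K1 : forall z, g (K 1 z) = z.
Hypothesis K1_g : forall z, K 1 (g z) = z.
Hypothesis E : essential_continuum c.
Hypothesis Hmove : moves 1 (K 1) c \/ moves (-1) (K 1) c.
Hypothesis th_down : sray (-1) (side (-1) c) th r.
Hypothesis th_up : sray 1 P0 th r.
Hypothesis Kw_up : sray 1 (side 1 c) (K 1 w) r.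
Hypothesis Kw_down : sray (-1) P2 (K 1 w) r.
Hypothesis w_up : side 1 c w.
Hypothesis Kth_down : side (-1) c (K 1 th).
Hypothesis w_right : r < sg * fst w.
Hypothesis Kth_right : r < sg * fst (K 1 th).

Lemma side_ne z z' : side (-1) c z -> side 1 c z' -> z <> z'.
Proof. intros H1 H2 ->. now apply (ec_separating c E z'). Qed.

Lemma right_of (z : pt) x : Rabs (fst z) <= r -> r < sg * x -> sg * (fst z - x) < 0.
Proof. intros H1 H2. revert H1. unfold Rabs. destruct S as [->| ->]; destruct Rcase_abs; lra. Qed.

Lemma snd_K_bounded z : exists M, forall t, 0 <= t <= 1 -> Rabs (snd (K t z)) <= M.
Proof.
  destruct (path_snd_bounded (fun t => K (clamp t) z)) as [M HM].
  - intros t. apply isotopy_continuous_comp; auto; ctn.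
  - exists M. intros t Ht. specialize (HM t Ht). now rewrite clamp_id in HM.
Qed.

(** The path stays to the left of [w], so the angle stays near [- PI]; once the path is lower than
    [w], the vector is in the quadrant between left and down. *)
Lemma down_ok_init A : is_angle (diff sg th w) A -> near (- PI) A ->
  exists H, forall p : R -> pt, (forall s, continuous p s) -> p 0 = th ->
    (forall s, 0 <= s <= 1 -> Rabs (fst (p s)) <= r) -> H <= - snd (p 1) -> down_ok sg p w A.
Proof.
  intros HA NA. exists (- snd w + 1). intros p Cp p0 Hp Hp1.
  assert (Left : forall s, 0 <= s <= 1 -> sg * (fst (p s) - fst w) < 0) by (intros; apply right_of; auto).
  destruct (angle_lift_exists (fun s => diff sg (p s) w) A) as [B LB].
  - unfold diff; ctn.
  - intros s Hs E0. injection E0 as E1 E2. specialize (Left s Hs). lra.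
  - now rewrite p0.
  - exists B. split; auto. apply (near_quadrant (- PI) down (diff sg (p 1) w)).
    + apply (angle_lift_half_plane _ _ _ (- PI) LB); auto.
      intros s Hs. rewrite dot_left. simpl. specialize (Left s Hs). lra.
    + now apply angle_lift_angles in LB.
    + left. unfold down. field.
    + apply diff_below. lra.
Qed.

(** Makes precise that the angle turns through down: [A1], the value to which the isotopy carries
    [A], is the determination selected by raising [K 1 w] within the strip. Paths below [c] and
    paths above [c] cannot meet, which permits each exchange by [down_up_ok]. *)
Lemma linked_up_ok A A1 : is_angle (diff sg th w) A -> near (- PI) A ->
  angle_lift (fun t => diff sg (K (clamp t) th) (K (clamp t) w)) A A1 ->
  exists b : R -> pt, (forall t, continuous b t) /\ b 0 = K 1 w /\
    (forall t, 0 <= t <= 1 -> Rabs (fst (b t)) <= r) /\ up_ok sg (K 1 th) b A1.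
Proof.
  intros HA NA LA.
  assert (fg := isotopy_annulus_homeo K g HK g_K1 K1_g).
  assert (I1 : 0 <= 1 <= 1) by lra.
  assert (CK : forall z : pt, continuous (K 1) z) by (intros; now apply isotopy_at_continuous).
  assert (S1 : sign 1) by (left; auto). assert (Sm : sign (-1)) by (right; auto).
  destruct (snd_K_bounded th) as [Mth HMth]. destruct (snd_K_bounded w) as [Mw HMw].
  destruct (down_ok_init A HA NA) as [Hi Hinit].
  assert (LA0 := proj2 (angle_lift_angles _ _ _ LA)). cbv beta in LA0.
  rewrite clamp_id in LA0 by lra.
  destruct Hmove as [Hm|Hm].
  (* The upper side is mapped into itself, so the condition travels with the path [b'] raised from
     [w]. Its image need not lie in the strip, hence the exchange, through [a'], for [b]. The
     heights are such that [a] ends below [b'], [b' 1] is above [a] and is carried above [th] and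
     [a'], [a'] ends below the image of [b'] and below [b], and [b] ends above [a']. *)
  - destruct (side_sray 1 c w S1 w_up) as [rw Hrw].
    destruct (side_sray (-1) c (K 1 th) Sm Kth_down) as [rt Hrt].
    destruct (isotopy_ends_uniform K HK 1 (Rmax Mth rt) S1) as [He HHe].
    destruct (Hrw (Rmax He (r + 1))) as [b' [Cb' [b'0 [Hb' Hb'1]]]].
    assert (Hb'1a := Rmax_l He (r + 1)). assert (Hb'1b := Rmax_r He (r + 1)).
    destruct (path_snd_bounded (fun t => K 1 (b' t))) as [Mb' HMb']; [ctn|].
    destruct (th_down (Rmax Hi (rw + 1))) as [a [Ca [a0 [Ha Ha1]]]].
    assert (Ha1a := Rmax_l Hi (rw + 1)). assert (Ha1b := Rmax_r Hi (rw + 1)).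
    destruct (Hrt (Rmax (Mb' + 1) (r + 1))) as [a' [Ca' [a'0 [Ha' Ha'1]]]].
    assert (Ha'1a := Rmax_l (Mb' + 1) (r + 1)). assert (Ha'1b := Rmax_r (Mb' + 1) (r + 1)).
    destruct (Kw_up (rt + 1)) as [b [Cb [b0 [Hb Hb1]]]].
    exists b. repeat split; auto. { intros t Ht. now apply Hb. }
    assert (OK1 : down_ok sg a w A).
    { apply Hinit; auto; [intros s Hs; now apply Ha|lra]. }
    assert (OK2 : up_ok sg th b' A).
    { rewrite <- b'0 in OK1. rewrite <- a0. rewrite <- a0, <- b'0 in HA.
      apply (down_up_ok sg a b' A); auto.
      - intros s t Hs Ht. apply side_ne; [apply Ha|apply Hb']; auto.
      - intros t Ht. destruct (Hb' t Ht) as [_ [_ Q]]. lra.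
      - intros s Hs. destruct (Ha s Hs) as [_ [_ Q]]. lra. }
    assert (Kb'1 : forall t, 0 <= t <= 1 -> Rmax Mth rt < snd (K t (b' 1))).
    { intros t Ht. assert (Q := HHe t Ht (b' 1)). lra. }
    assert (Rl := Rmax_l Mth rt). assert (Rr := Rmax_r Mth rt).
    assert (OK3 : up_ok sg (K 1 th) (fun s => K 1 (b' s)) A1).
    { apply (isotopy_up_ok th b' A); auto.
      - intros s Hs. apply side_ne; [|apply Hb'; auto]. rewrite <- a0. apply Ha; lra.
      - intros t Ht. specialize (Kb'1 t Ht). specialize (HMth t Ht).
        apply Rabs_le_between in HMth. lra.
      - now rewrite b'0. }
    assert (OK4 : down_ok sg a' (K 1 w) A1).
    { rewrite <- b'0. apply (down_up_ok sg a' (fun s => K 1 (b' s)) A1); auto.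
      - ctn.
      - intros s t Hs Ht. apply side_ne; [apply Ha'; auto|].
        apply (moves_side (K 1) g c 1 fg E S1 Hm). apply Hb'; auto.
      - intros t Ht. specialize (HMb' t Ht). apply Rabs_le_between in HMb'. lra.
      - intros s Hs. destruct (Ha' s Hs) as [_ [_ Q]]. specialize (Kb'1 1 I1). lra.
      - rewrite a'0, b'0. exact LA0.
      - now rewrite a'0. }
    rewrite <- a'0. apply (down_up_ok sg a' b A1); auto.
    + intros s t Hs Ht. apply side_ne; [apply Ha'|apply Hb]; auto.
    + intros t Ht. destruct (Hb t Ht) as [_ [_ Q]]. lra.
    + intros s Hs. destruct (Ha' s Hs) as [_ [_ Q]]. lra.
    + rewrite a'0, b0. exact LA0.
    + now rewrite b0.
  (* Here the lower side is mapped into itself, and the image of the lowered path [a] can be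
     compared with [b] directly. *)
  - destruct (isotopy_ends_uniform K HK (-1) (Rmax Mw r) Sm) as [He HHe].
    destruct (th_down (Rmax Hi He)) as [a [Ca [a0 [Ha Ha1]]]].
    assert (Ha1a := Rmax_l Hi He). assert (Ha1b := Rmax_r Hi He).
    destruct (path_snd_bounded (fun t => K 1 (a t))) as [Ma HMa]; [ctn|].
    destruct (Kw_up (Ma + 1)) as [b [Cb [b0 [Hb Hb1]]]].
    exists b. repeat split; auto. { intros t Ht. now apply Hb. }
    assert (Rl := Rmax_l Mw r). assert (Rr := Rmax_r Mw r).
    assert (Ka1 : forall t, 0 <= t <= 1 -> Rmax Mw r < - snd (K t (a 1))).
    { intros t Ht. assert (Q := HHe t Ht (a 1)). lra. }
    assert (OK1 : down_ok sg a w A).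
    { apply Hinit; auto; [intros s Hs; now apply Ha|lra]. }
    assert (OK2 : down_ok sg (fun s => K 1 (a s)) (K 1 w) A1).
    { apply (isotopy_down_ok a w A); auto.
      - intros s Hs. apply side_ne; auto. now apply Ha.
      - intros t Ht. specialize (Ka1 t Ht). specialize (HMw t Ht).
        apply Rabs_le_between in HMw. lra.
      - now rewrite a0. }
    rewrite <- a0. rewrite <- b0 in OK2.
    apply (down_up_ok sg (fun s => K 1 (a s)) b A1); auto.
    + ctn.
    + intros s t Hs Ht. apply side_ne; [|now apply Hb].
      apply (moves_side (K 1) g c (-1) fg E Sm Hm). now apply Ha.
    + intros t Ht. destruct (Hb t Ht) as [_ [_ Q]]. specialize (Ka1 1 I1). lra.
    + intros s Hs. specialize (HMa s Hs). apply Rabs_le_between in HMa. lra.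
    + rewrite a0, b0. exact LA0.
Qed.

(** [D] is the angle from [K 1 w] to the end of the image of [al]. Raising [th] along [al] and then
    following the isotopy puts it near [- 3 PI / 2]. If the image of [al] missed [be], then starting
    from [A1], which is near 0, and lowering the second point along [be] would put it near
    [PI / 2]. *)
Lemma link : exists y, P0 y /\ P2 (K 1 y) /\ Rabs (fst y) <= r /\ Rabs (fst (K 1 y)) <= r.
Proof.
  assert (I1 : 0 <= 1 <= 1) by lra.
  assert (CK : forall z : pt, continuous (K 1) z) by (intros; now apply isotopy_at_continuous).
  assert (S1 : sign 1) by (left; auto).
  destruct (snd_K_bounded w) as [Mw HMw].
  destruct (isotopy_ends_uniform K HK 1 (Rmax Mw r) S1) as [He HHe].
  assert (Rl := Rmax_l Mw r). assert (Rr := Rmax_r Mw r).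
  destruct (th_up He) as [al [Ca [al0 [Hal Hal1]]]].
  destruct (path_snd_bounded (fun t => K 1 (al t))) as [Ma HMa]; [ctn|].
  destruct (Kw_down (Ma + 1)) as [be [Cb [be0 [Hbe Hbe1]]]].
  apply NNPP. intros Hn.
  assert (Hne : forall s t, 0 <= s <= 1 -> 0 <= t <= 1 -> K 1 (al s) <> be t).
  { intros s t Hs Ht Eq. apply Hn. exists (al s).
    destruct (Hal s Hs) as [Q1 [Q2 _]]. destruct (Hbe t Ht) as [Q3 [Q4 _]]. rewrite Eq. auto. }
  assert (Left : forall s, 0 <= s <= 1 -> sg * (fst (al s) - fst w) < 0).
  { intros s Hs. apply right_of; auto. now apply Hal. }
  assert (Kal1 : forall t, 0 <= t <= 1 -> Rmax Mw r < snd (K t (al 1))).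
  { intros t Ht. assert (Q := HHe t Ht (al 1)). lra. }
  destruct (is_angle_near (diff sg th w) (- PI)) as [A [HA NA]].
  { rewrite dot_left. simpl. specialize (Left 0 ltac:(lra)). rewrite al0 in Left. lra. }
  destruct (isotopy_square al (fun _ => w) A) as [B [A1 [D [LB [LA [LBD LAD]]]]]]; auto.
  { ctn. }
  { intros s Hs Eq. specialize (Left s Hs). rewrite Eq in Left. lra. }
  { now rewrite al0. }
  cbv beta in *. rewrite al0 in LA.
  assert (NB : near (- PI - PI / 2) B).
  { apply (near_quadrant (- PI) _ (diff sg (al 1) w)).
    - apply (angle_lift_half_plane _ _ _ (- PI) LB); auto.
      intros s Hs. rewrite dot_left. simpl. specialize (Left s Hs). lra.
    - apply (angle_lift_angles _ _ _ LB).
    - right. ring.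
    - rewrite dot_up_neg. simpl. specialize (Kal1 0 ltac:(lra)).
      specialize (HMw 0 ltac:(lra)). apply Rabs_le_between in HMw.
      rewrite !(isotopy_0 K HK) in *. lra. }
  assert (ND : near (- PI - PI / 2) D).
  { apply (angle_lift_half_plane _ _ _ _ LBD); auto. intros t Ht. rewrite dot_up_neg. simpl.
    specialize (Kal1 _ (clamp_in t)). specialize (HMw _ (clamp_in t)).
    apply Rabs_le_between in HMw. lra. }
  destruct (linked_up_ok A A1 HA NA LA) as [b [Cbb [b0 [Hb [B1 [LB1 NB1]]]]]].
  assert (Right : forall z : pt, Rabs (fst z) <= r -> 0 < dot (cos 0, sin 0) (diff sg (K 1 th) z)).
  { intros z Hz. rewrite dot_right. simpl. assert (Q := right_of z _ Hz Kth_right). lra. }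
  (* Along [b] the vector always points to the right, and its angle ends near [- PI / 2], so it was
     near 0 from the start. *)
  assert (NA1 : near 0 A1).
  { apply (angle_lift_half_plane _ _ _ 0 LB1); [auto|].
    apply (near_quadrant down 0 (diff sg (K 1 th) (b 1))); auto.
    - apply (angle_lift_angles _ _ _ LB1).
    - left. unfold down. ring. }
  destruct (angle_lift_square (fun s t => diff sg (K 1 (al s)) (be t))) with (A := A1)
    as [D' [C [D2 [L1 [L2 [L3 L4]]]]]].
  - intros u. unfold diff. ctn.
  - intros s t Hs Ht. apply diff_nonzero; auto.
  - rewrite be0. apply (angle_lift_angles _ _ _ LAD).
  - rewrite be0 in L1. rewrite al0 in L2.
    rewrite (angle_lift_unique _ _ _ _ L1 LAD) in L3.
    assert (NC0 : near 0 C).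
    { apply (angle_lift_half_plane _ _ _ 0 L2); auto. intros t Ht. apply Right. now apply Hbe. }
    assert (Top : forall s, 0 <= s <= 1 -> snd (be 1) < snd (K 1 (al s))).
    { intros s Hs. specialize (HMa s Hs). apply Rabs_le_between in HMa. lra. }
    assert (NC : near (PI / 2) C).
    { apply (near_quadrant 0 _ (diff sg (K 1 th) (be 1))); auto.
      - apply (angle_lift_angles _ _ _ L2).
      - left. ring.
      - rewrite dot_up. simpl. rewrite <- al0. specialize (Top 0 ltac:(lra)). lra. }
    assert (ND2 : near (PI / 2) D2).
    { apply (angle_lift_half_plane _ _ _ _ L4); auto. intros s Hs. rewrite dot_up. simpl.
      specialize (Top s Hs). lra. }
    assert (ND' : near (PI / 2) D).
    { apply (angle_lift_half_plane _ _ _ _ L3); auto. intros t Ht. rewrite dot_up. simpl.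
      destruct (Hbe t Ht) as [_ [_ Q]]. specialize (Kal1 1 I1). lra. }
    (* [D] would lie both in [(- 2 PI, - PI)] and in [(0, PI)]. *)
    assert (P := PI_RGT_0). unfold near in *. lra.
Qed.
End Isotopy.

(** * Long orbit segments and the rotation set *)

Lemma iter_add m n h z : iter (m + n) h z = iter m h (iter n h z).
Proof. induction m; simpl; congruence. Qed.

Lemma iter_comm n h z : iter n h (h z) = h (iter n h z).
Proof. induction n; simpl; congruence. Qed.

Lemma iter_cancel f g n z : (forall z, g (f z) = z) -> iter n g (iter n f z) = z.
Proof.
  intros H. induction n; simpl; auto. now rewrite <- iter_comm, H.
Qed.

Lemma iter_cancel_le f g i j z : (forall z, g (f z) = z) -> (i <= j)%nat ->
  iter i g (iter j f z) = iter (j - i) f z.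
Proof.
  intros H Hij. replace j with (i + (j - i))%nat at 1 by lia. rewrite iter_add.
  now apply iter_cancel.
Qed.

Lemma iter_continuous n (h : pt -> pt) (z : pt) : (forall z : pt, continuous h z) -> continuous (iter n h) z.
Proof.
  intros C. revert z. induction n; intros z; simpl; [apply continuous_id|].
  apply (continuous_comp (iter n h) h); auto.
Qed.

Lemma iter_Tn n h k z : (forall k z, h (Tn k z) = Tn k (h z)) -> iter n h (Tn k z) = Tn k (iter n h z).
Proof. intros H. induction n; simpl; congruence. Qed.

Definition orbit_in (f g : pt -> pt) (P : pt -> Prop) (z : pt) : Prop :=
  forall n, P (iter n f z) /\ P (iter n g z).

Lemma Theta_orbit f g P z : Theta f g P z <-> orbit_in f g P z.
Proof.
  split.
  - intros [H0 H] n. destruct n as [|n]; [split; exact H0|].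
    split.
    + specialize (H (Z.pos (Pos.of_succ_nat n))). simpl in H. now rewrite SuccNat2Pos.id_succ in H.
    + specialize (H (Z.neg (Pos.of_succ_nat n))). simpl in H. now rewrite SuccNat2Pos.id_succ in H.
  - intros H. split; [apply (H O)|]. intros [|p|p]; simpl; [apply (H O)| |]; apply H.
Qed.

Lemma orbit_in_image f g P z : (forall z, g (f z) = z) -> orbit_in f g P z -> orbit_in f g P (f z).
Proof.
  intros E H n. split.
  - rewrite iter_comm. apply (H (S n)).
  - destruct n as [|n]; [apply (H 1%nat)|]. change (P (iter (S n) g (f z))). simpl.
    rewrite <- iter_comm, E. apply H.
Qed.

Lemma orbit_in_sym f g P z : orbit_in f g P z -> orbit_in g f P z.
Proof. intros H n. split; apply H. Qed.

Lemma orbit_in_iter f g P z n : (forall z, g (f z) = z) -> orbit_in f g P z -> orbit_in f g P (iter n f z).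
Proof. intros E H. induction n; simpl; auto. now apply orbit_in_image. Qed.

Lemma displacement_bounded (f : pt -> pt) (P : pt -> Prop) M : (forall z : pt, continuous f z) ->
  (forall k z, f (Tn k z) = Tn k (f z)) -> (forall z, P z -> Rabs (snd z) <= M) ->
  exists C, 0 < C /\ forall n z, (forall j, (j < n)%nat -> P (iter j f z)) ->
    Rabs (fst (iter n f z) - fst z) <= INR n * C.
Proof.
  intros Cf Tf HM. destruct (band_bounded (fun z => fst (f z) - fst z) M) as [C [C0 HC]].
  - intros z. ctn.
  - intros k z. rewrite Tf. simpl. ring.
  - exists (C + 1). split; [lra|]. induction n; intros z H.
    + simpl. rewrite Rminus_diag, Rabs_R0. lra.
    + rewrite S_INR. simpl.
      assert (Q1 : Rabs (fst (f (iter n f z)) - fst (iter n f z)) <= C) by (apply HC, HM, H; lia).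
      assert (Q2 := IHn z ltac:(auto)).
      apply Rabs_le_between in Q1. apply Rabs_le_between in Q2. apply Rabs_le_between. lra.
Qed.

Definition drift (sg : R) (f : pt -> pt) (z : pt) : Prop :=
  forall r, exists N, forall n, (N <= n)%nat -> r < sg * fst (iter n f z).

(** The lower limit [l] of [s * rho_n] is finite by the displacement bound, and [s * l] is in the
    rotation set, whence [0 < l]. The starting point may vary with [n] so that backward orbits are
    covered, with [iter n g z] as starting point. *)
Lemma rho_eventually_positive f (P : pt -> Prop) C s (z : nat -> pt) : sign s ->
  (forall x, rho_set f P x -> exists r, x = Fin r /\ 0 < s * r) ->
  (forall n, P (z n) /\ P (iter n f (z n))) ->
  (forall n, Rabs (fst (iter n f (z n)) - fst (z n)) <= INR n * C) ->
  exists c m, 0 < c /\ forall n, (m <= n)%nat -> INR n * c <= s * (fst (iter n f (z n)) - fst (z n)).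
Proof.
  intros Ss Hrho HP HC.
  set (u := fun n => s * rho_n f n (z n)).
  assert (Hu : forall n, (1 <= n)%nat -> INR n * u n = s * (fst (iter n f (z n)) - fst (z n)) /\ - C <= u n <= C).
  { intros n Hn. assert (In : 0 < INR n) by (apply lt_0_INR; lia).
    assert (Q : INR n * u n = s * (fst (iter n f (z n)) - fst (z n))).
    { unfold u, rho_n. field. lra. }
    split; auto. specialize (HC n). apply Rabs_le_between in HC.
    split; apply Rmult_le_reg_l with (INR n); auto; rewrite Q; destruct Ss as [->| ->]; lra. }
  set (E := fun x => exists m, forall n, (m <= n)%nat -> x <= u n).
  destruct (completeness E) as [l [Hub Hlub]].
  { exists C. intros x [m Hm]. apply Rle_trans with (u (S m)); [apply Hm; lia|]. apply Hu; lia. }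
  { exists (- C), 1%nat. intros n Hn. now apply Hu. }
  assert (Hl : 0 < l).
  { destruct (Hrho (Fin (s * l))) as [r [Er Hr]].
    - intros m Hm eps Heps.
      assert (A : exists n, (m <= n)%nat /\ u n < l + eps /\ l - eps < u n).
      { assert (exists x, E x /\ l - eps < x) as [x [[m' Hx] Hlx]].
        { apply NNPP. intros Hn. assert (l <= l - eps); [|lra]. apply Hlub. intros x Hx.
          apply Rnot_lt_le. intros Hlt. apply Hn. eauto. }
        assert (exists n, (Nat.max m m' <= n)%nat /\ u n < l + eps) as [n [Hn Hun]].
        { apply NNPP. intros Hn. assert (l + eps <= l); [|lra]. apply Hub.
          exists (Nat.max m m'). intros n Hmn. apply Rnot_lt_le. intros Hlt. apply Hn. eauto. }
        exists n. split; [lia|]. split; auto. specialize (Hx n ltac:(lia)). lra. }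
      destruct A as [n [Hn Hun]]. exists (rho_n f n (z n)). split.
      + exists n, (z n). split; auto. split; [apply HP|split; [apply HP|reflexivity]].
      + unfold u in Hun. apply Rabs_def1; destruct Ss as [->| ->]; lra.
    - injection Er as <-. destruct Ss as [->| ->]; lra. }
  assert (exists x, E x /\ l / 2 < x) as [x [[m Hx] Hlx]].
  { apply NNPP. intros Hn. assert (l <= l / 2); [|lra]. apply Hlub. intros x Hx.
    apply Rnot_lt_le. intros Hlt. apply Hn. eauto. }
  exists (l / 2), (S m). split; [lra|]. intros n Hn. destruct (Hu n ltac:(lia)) as [<- _].
  apply Rmult_le_compat_l; [apply pos_INR|]. specialize (Hx n ltac:(lia)). lra.
Qed.

Lemma linear_unbounded c m r : 0 < c -> exists N, (m <= N)%nat /\ forall n, (N <= n)%nat -> r < INR n * c.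
Proof.
  intros Hc. destruct (INR_unbounded (r / c)) as [N HN]. exists (Nat.max m N). split; [lia|].
  intros n Hn. apply Rlt_div_l; auto. eapply Rlt_le_trans; [exact HN|]. apply le_INR; lia.
Qed.

Lemma theta_drift f g (P : pt -> Prop) M s z : annulus_homeo f g -> sign s ->
  (forall z, P z -> Rabs (snd z) <= M) ->
  (forall x, rho_set f (Theta f g P) x -> exists r, x = Fin r /\ 0 < s * r) ->
  Theta f g P z -> drift s f z /\ drift (- s) g z.
Proof.
  intros fg S HM Hrho Hz. apply Theta_orbit in Hz.
  assert (gf := ah_gf f g fg). assert (fg' := ah_fg f g fg).
  destruct (displacement_bounded f P M) as [C [C0 HC]]; auto.
  { apply fg. } { apply fg. }
  split; intros r.
  - destruct (rho_eventually_positive f (Theta f g P) C s (fun _ => z)) as [c [m [Hc Hm]]]; auto.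
    + intros n. rewrite !Theta_orbit. split; auto. now apply orbit_in_iter.
    + intros n. apply HC. intros j Hj. apply Hz.
    + destruct (linear_unbounded c m (r - s * fst z) Hc) as [N [HN HN']].
      exists N. intros n Hn. specialize (HN' n Hn). specialize (Hm n ltac:(lia)). lra.
  - assert (Hb : forall n, orbit_in f g P (iter n g z)).
    { intros n. apply orbit_in_sym, orbit_in_iter; auto. now apply orbit_in_sym. }
    assert (Hc : forall n, iter n f (iter n g z) = z) by (intros; now apply iter_cancel).
    destruct (rho_eventually_positive f (Theta f g P) C s (fun n => iter n g z)) as [c [m [Hc0 Hm]]]; auto.
    + intros n. rewrite !Theta_orbit, Hc. auto.
    + intros n. apply HC. intros j Hj. apply Hb.
    + destruct (linear_unbounded c m (r + s * fst z) Hc0) as [N [HN HN']].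
      exists N. intros n Hn. specialize (HN' n Hn). specialize (Hm n ltac:(lia)).
      rewrite Hc in Hm. lra.
Qed.

Definition long_segments (f : pt -> pt) (P : pt -> Prop) : Prop :=
  exists C N0, forall N, (N0 <= N)%nat -> exists z,
    (forall j, (j <= N)%nat -> P (iter j f z)) /\ Rabs (fst (iter N f z) - fst z) <= C.

(* If the displacement over [n0] steps were bounded away from [0] on the maximal invariant
   set, it would keep a constant sign along every long orbit segment in [P] (except near its
   two ends), and the displacement of the segment would grow linearly. *)
Lemma long_segments_rho f g P M : annulus_homeo f g -> invariant P ->
  (forall z, ~ P z -> locally z (fun w => ~ P w)) -> (forall z, P z -> Rabs (snd z) <= M) ->
  long_segments f P -> rho_set f (Theta f g P) (Fin 0).
Proof.
  intros fg IP CP HM [C [N0 HS]] m Hm eps Heps. apply NNPP. intros Hn.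
  assert (gf := ah_gf f g fg). assert (fg' := ah_fg f g fg).
  assert (Cf := ah_f_continuous f g fg). assert (Tf := ah_f_Tn f g fg).
  assert (Cg := ah_g_continuous f g fg). assert (Tg := ah_g_Tn f g fg).
  destruct (displacement_bounded f P M) as [C0 [C0pos HC0]]; auto.
  (* Of the margin [3 * C0], one [C0] is lost in passing to points whose orbit stays in [P] only for
     a limited time. The remaining [2 * C0] forbids sign changes, since [d] varies by at most
     [2 * C0] between consecutive points of an orbit. *)
  destruct (linear_unbounded eps m (3 * C0) Heps) as [n0 [Hn0 Hn0']].
  specialize (Hn0' n0 (le_n _)).
  set (d := fun z => fst (iter n0 f z) - fst z).
  assert (Hd : forall z, orbit_in f g P z -> 3 * C0 < Rabs (d z)).
  { intros z Hz. apply Rlt_le_trans with (INR n0 * eps); auto. apply Rnot_lt_le. intros Hlt.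
    apply Hn. exists (rho_n f n0 z). split.
    - exists n0, z. rewrite !Theta_orbit. split; [exact Hn0|]. split; [exact Hz|].
      split; [now apply orbit_in_iter|reflexivity].
    - assert (In : 0 < INR n0) by (apply lt_0_INR; lia).
      unfold rho_n. fold (d z). rewrite Rminus_0_r. unfold Rdiv.
      rewrite Rabs_mult, Rabs_inv, (Rabs_pos_eq (INR n0)) by lra.
      apply Rlt_div_l; auto. lra. }
  assert (Cd : forall z : pt, continuous d z).
  { intros z. unfold d. assert (Ci := fun z => iter_continuous n0 f z Cf). ctn. }
  (* Otherwise points with ever longer orbit segments in [P] on both sides and small [d] accumulate
     at a point whose whole orbit is in [P], as [P] is closed; this contradicts [Hd]. *)
  assert (exists K, forall z, (forall j, (j <= K)%nat -> P (iter j f z) /\ P (iter j g z)) ->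
    2 * C0 <= Rabs (d z)) as [K HK].
  { apply NNPP. intros HN.
    assert (HX : forall k, { z : pt | (0 <= fst z <= 1 /\ - M <= snd z <= M) /\
       (forall j, (j <= k)%nat -> P (iter j f z) /\ P (iter j g z)) /\ Rabs (d z) < 2 * C0 }).
    { intros k. apply constructive_indefinite_description. apply NNPP. intros Hz. apply HN.
      exists k. intros z Hj. apply Rnot_lt_le. intros Hlt. apply Hz.
      destruct (Tn_unit z) as [i Hi]. exists (Tn i z). split; [|split].
      - split; auto. simpl. apply Rabs_le_between. apply HM. apply (Hj O); lia.
      - intros j Hjk. rewrite !iter_Tn by auto. rewrite (IP i), (IP i). auto.
      - unfold d. rewrite iter_Tn by auto. simpl.
        replace (fst (iter n0 f z) + IZR i - (fst z + IZR i)) with (d z) by (unfold d; ring). auto. }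
    destruct (rectangle_cluster (fun k => proj1_sig (HX k)) 0 1 (- M) M) as [z [_ HC]].
    { intros k. apply (proj2_sig (HX k)). }
    assert (Hz : orbit_in f g P z).
    { intros j. split; apply NNPP; intros Hnp.
      - destruct (HC (fun w => ~ P (iter j f w))) with (N := j) as [k [Hk Hpk]].
        + apply (locally_preimage (iter j f) (fun w => ~ P w)); auto. now apply iter_continuous.
        + apply Hpk. apply (proj2_sig (HX k)). auto.
      - destruct (HC (fun w => ~ P (iter j g w))) with (N := j) as [k [Hk Hpk]].
        + apply (locally_preimage (iter j g) (fun w => ~ P w)); auto. now apply iter_continuous.
        + apply Hpk. apply (proj2_sig (HX k)). auto. }
    specialize (Hd z Hz).
    destruct (HC _ (continuous_eps d z (Cd z) C0 C0pos) O) as [k [_ Hk]].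
    destruct (proj2_sig (HX k)) as [_ [_ Hk2]].
    revert Hk Hk2 Hd. unfold Rabs; repeat destruct Rcase_abs; lra. }
  destruct (linear_unbounded C0 N0 (C + (INR (2 * K + n0)) * C0) C0pos) as [q [Hq Hq']].
  specialize (Hq' q (le_n _)).
  (* [K] steps are set aside at each end, [n0] more keep the windows defining [d] inside the
     segment, and there are [q] blocks of length [n0]. The blocks gain at least [2 * q * C0] and the
     rest costs at most [(2 * K + n0) * C0]; [q] makes the balance exceed [C]. *)
  set (N := (2 * K + n0 + q * n0)%nat).
  destruct (HS N) as [z [Hz HzC]]; [unfold N; nia|].
  set (o := fun j => iter j f z).
  assert (Ho : forall j, (K <= j)%nat -> (j + K <= N)%nat -> 2 * C0 <= Rabs (d (o j))).
  { intros j H1 H2. apply HK. intros i Hi. unfold o. split.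
    - rewrite <- iter_add. apply Hz. lia.
    - rewrite iter_cancel_le by (auto; lia). apply Hz. lia. }
  assert (Dstep : forall i j, (i + j <= N)%nat -> Rabs (fst (o (i + j)%nat) - fst (o j)) <= INR i * C0).
  { intros i j Hij. unfold o. rewrite iter_add. apply HC0. intros k Hk. rewrite <- iter_add. apply Hz. lia. }
  assert (exists s, sign s /\ 2 * C0 <= s * d (o K)) as [s [Ss Hs]].
  { specialize (Ho K (le_n _)). unfold Rabs in Ho. destruct Rcase_abs.
    - exists (-1). split; [right; auto|]. specialize (Ho ltac:(unfold N; lia)). lra.
    - exists 1. split; [left; auto|]. specialize (Ho ltac:(unfold N; lia)). lra. }
  assert (Hsign : forall i, (i <= q * n0)%nat -> 2 * C0 <= s * d (o (K + i)%nat)).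
  { induction i; intros Hi; [now rewrite Nat.add_0_r|]. specialize (IHi ltac:(lia)).
    assert (A := Ho (K + S i)%nat ltac:(lia) ltac:(unfold N; lia)).
    assert (B1 := Dstep 1%nat (n0 + (K + i))%nat ltac:(unfold N; nia)).
    assert (B2 := Dstep 1%nat (K + i)%nat ltac:(unfold N; nia)).
    assert (Ed : forall j, d (o j) = fst (o (n0 + j)%nat) - fst (o j)).
    { intros j. unfold d, o. now rewrite iter_add. }
    rewrite Ed in A, IHi |- *.
    replace (n0 + (K + S i))%nat with (1 + (n0 + (K + i)))%nat in * by lia.
    replace (K + S i)%nat with (1 + (K + i))%nat in * by lia.
    simpl INR in B1, B2. apply Rabs_le_between in B1. apply Rabs_le_between in B2.
    revert A. unfold Rabs. destruct Ss as [->| ->]; destruct Rcase_abs; lra. }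
  assert (Hsum : forall i, (i <= q)%nat ->
    INR i * (2 * C0) <= s * (fst (o (K + i * n0)%nat) - fst (o K))).
  { induction i; intros Hi; [simpl; rewrite Nat.add_0_r; lra|]. specialize (IHi ltac:(lia)).
    assert (A := Hsign (i * n0)%nat ltac:(nia)). rewrite S_INR.
    unfold d, o in A. rewrite <- iter_add in A. fold (o (K + i * n0)%nat) in A.
    replace (n0 + (K + i * n0))%nat with (K + S i * n0)%nat in A by lia.
    fold (o (K + S i * n0)%nat) in A. lra. }
  specialize (Hsum q (le_n _)).
  assert (B1 := Dstep K O ltac:(unfold N; lia)).
  assert (B2 := Dstep (K + n0)%nat (K + q * n0)%nat ltac:(unfold N; lia)).
  replace (K + n0 + (K + q * n0))%nat with N in B2 by (unfold N; lia).
  rewrite Nat.add_0_r in B1. fold (o N) in HzC. change z with (o O) in HzC.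
  rewrite plus_INR, mult_INR in Hq'. rewrite plus_INR in B2. simpl (INR 2) in Hq'.
  apply Rabs_le_between in B1. apply Rabs_le_between in B2. apply Rabs_le_between in HzC.
  destruct Ss as [->| ->]; lra.
Qed.

(** * Existence of long orbit segments *)

Lemma moves_side_iter f g c sg n z : annulus_homeo f g -> essential_continuum c -> sign sg ->
  moves sg f c -> side sg c z -> side sg c (iter n f z).
Proof.
  intros fg E S Hm Hz. induction n; simpl; auto. now apply (moves_side f g c sg fg E S Hm).
Qed.

Lemma moves_iter f g c sg n : annulus_homeo f g -> essential_continuum c -> sign sg ->
  moves sg f c -> moves sg (iter (S n) f) c.
Proof.
  intros fg E S Hm z Hz. simpl. rewrite <- iter_comm.
  apply (moves_side_iter f g); auto.
Qed.

Definition between (c c' : pt -> Prop) (z : pt) : Prop := ~ side (-1) c z /\ ~ side 1 c' z.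

Section Segments.
Variables (K : R -> pt -> pt) (f g : pt -> pt) (c0 c1 c2 : pt -> Prop) (sg : R) (th0 th1 : pt).
Hypothesis HK : isotopy_lift K.
Hypothesis K1 : K 1 = f.
Hypothesis fg : annulus_homeo f g.
Hypothesis E0 : essential_continuum c0.
Hypothesis E1 : essential_continuum c1.
Hypothesis E2 : essential_continuum c2.
Hypothesis free1 : moves 1 f c1 \/ moves (-1) f c1.
Hypothesis Ssg : sign sg.
Hypothesis th0_c0 : side 1 c0 th0.
Hypothesis th0_c2 : side (-1) c2 th0.
Hypothesis th0_c1 : forall n, side (-1) c1 (iter n f th0).
Hypothesis th1_c0 : side 1 c0 th1.
Hypothesis th1_c2 : side (-1) c2 th1.
Hypothesis th1_c1 : forall n, side 1 c1 (iter n g th1).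
Hypothesis drift0 : drift sg f th0.
Hypothesis drift1 : drift (- sg) f th1.
Hypothesis drift1' : drift sg g th1.

Let S1 : sign 1. Proof. left; auto. Qed.
Let Sm : sign (-1). Proof. right; auto. Qed.

(** Being above [c0] at time 0 persists, and being above [c2] at an earlier time would persist until
    time [N]. *)
Lemma between_iter_up y N j : moves 1 f c0 -> moves 1 f c2 ->
  side 1 c0 y -> side (-1) c2 (iter N f y) -> (j <= N)%nat -> between c0 c2 (iter j f y).
Proof.
  intros M0 M2 H0 H2 Hj. split; intros H.
  - apply (ec_separating c0 E0 (iter j f y)); auto. now apply (moves_side_iter f g).
  - apply (ec_separating c2 E2 (iter N f y)); auto.
    replace N with ((N - j) + j)%nat by lia. rewrite iter_add. now apply (moves_side_iter f g).
Qed.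

Lemma long_segments_up : moves 1 f c0 -> moves 1 f c2 -> long_segments f (between c0 c2).
Proof.
  intros M0 M2.
  destruct (side_sray (-1) c1 th0 Sm (th0_c1 O)) as [r1 R1].
  destruct (side_sray 1 c0 th0 S1 th0_c0) as [r2 R2].
  destruct (side_sray 1 c1 th1 S1 (th1_c1 O)) as [r3 R3].
  destruct (side_sray (-1) c2 th1 Sm th1_c2) as [r4 R4].
  set (r := Rmax (Rmax r1 r2) (Rmax r3 r4)).
  assert (L1 := Rmax_l r1 r2). assert (L2 := Rmax_r r1 r2). assert (L3 := Rmax_l r3 r4).
  assert (L4 := Rmax_r r3 r4). assert (L5 := Rmax_l (Rmax r1 r2) (Rmax r3 r4)).
  assert (L6 := Rmax_r (Rmax r1 r2) (Rmax r3 r4)). fold r in L5, L6.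
  destruct (drift0 r) as [N0 HN0]. destruct (drift1' r) as [N1 HN1].
  (* Both ends of the segment will have abscissae in [[- r, r]]. The successor keeps [N] positive,
     as [moves_iter] requires. *)
  exists (2 * r), (Datatypes.S (Nat.max N0 N1)). intros N HN.
  destruct N as [|n]; [lia|]. set (N := Datatypes.S n) in *.
  assert (gN : forall z, iter N g (iter N f z) = z) by (intros; apply iter_cancel, fg).
  assert (fN : forall z, iter N f (iter N g z) = z) by (intros; apply iter_cancel, fg).
  assert (Hw : iter N f (iter N g th1) = th1) by apply fN.
  (* The isotopy is iterated [N] times, and [w] is [iter N g th1] so that its orbit ends at [th1].
     The two side predicates are the conditions that [between_iter_up] needs at the ends of the
     segment. *)
  destruct (link (fun t => iter N (K t)) sg (isotopy_iter K N HK) Ssg (iter N g) c1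
    (side 1 c0) (side (-1) c2) th0 (iter N g th1) r) as [y [Y1 [Y2 [Y3 Y4]]]];
    rewrite ?K1; auto.
  - destruct free1; [left|right]; now apply (moves_iter f g).
  - now apply sray_weaken with (side (-1) c1) r1; auto; lra.
  - apply sray_weaken with (side 1 c0) r2; auto; lra.
  - rewrite Hw. apply sray_weaken with (side 1 c1) r3; auto; lra.
  - rewrite Hw. apply sray_weaken with (side (-1) c2) r4; auto; lra.
  - apply HN1. lia.
  - apply HN0. lia.
  - rewrite K1 in Y2, Y4. exists y. split.
    + intros j Hj. now apply between_iter_up with N.
    + apply Rabs_le_between in Y3. apply Rabs_le_between in Y4. apply Rabs_le_between. lra.
Qed.

(** A path descending from [z] below [c2] must meet [c0], as otherwise [z] would be on both sides of
    [c0]; it is cut at the first meeting. *)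
Lemma between_connected_below z : side 1 c0 z -> side (-1) c2 z ->
  exists p : R -> pt, (forall s, continuous p s) /\ p 0 = z /\
    (forall s, 0 <= s <= 1 -> between c0 c2 (p s)) /\ c0 (p 1).
Proof.
  intros H0 H2.
  destruct (ec_bounded c0 E0) as [M [M0 HM]].
  destruct (side_sray (-1) c2 z Sm H2) as [r Hr].
  destruct (Hr (M + 1)) as [p [Cp [p0 [Hp Hp1]]]].
  assert (Low : side (-1) c0 (p 1)) by (apply side_far with M; auto; lra).
  assert (exists s0, 0 <= s0 <= 1 /\ c0 (p s0)) as [s0 [Hs0 Hc]].
  { apply NNPP. intros Hn. apply (ec_separating c0 E0 z); auto.
    apply side_reach with (p 1); auto. exists p. repeat split; auto. intros s Hs Hcs. apply Hn. eauto. }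
  destruct (first_hit c0 (fun s => p (s0 * s))) as [r0 [Hr0 [Hcr Hbef]]].
  - apply ec_closed; auto.
  - ctn.
  - rewrite Rmult_0_r, p0. now apply (side_not 1).
  - now rewrite Rmult_1_r.
  - exists (fun s => p (s0 * (r0 * s))). split; [|split; [|split]].
    + ctn.
    + now rewrite !Rmult_0_r.
    + intros s Hs. assert (Hrs : 0 <= r0 * s <= r0) by nra.
      assert (Hin : 0 <= s0 * (r0 * s) <= 1) by nra.
      split; intros H.
      * destruct (Req_dec (r0 * s) r0) as [Eq|Ne].
        { rewrite Eq in H. now apply side_not in H. }
        apply (ec_separating c0 E0 z); auto. apply side_reach with (p (s0 * (r0 * s))); auto.
        rewrite <- p0.
        replace (p 0) with ((fun s => p (s0 * s)) 0) by (simpl; now rewrite Rmult_0_r).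
        apply (reach_prefix c0 (fun s => p (s0 * s))); [ctn|lra|].
        intros s' Hs'. apply Hbef. lra.
      * apply (ec_separating c2 E2 (p (s0 * (r0 * s)))); auto. now apply Hp.
    + now rewrite Rmult_1_r.
Qed.

(** Any point of the region with zero displacement over [N] steps will do, so [C = 0]. Without one,
    the displacement keeps its sign on the connected set [c0] and along paths from [th0] and [th1]
    to [c0], although these two points drift in opposite directions. *)
Lemma long_segments_in : (forall z, c0 z -> side (-1) c2 z) ->
  moves 1 f c0 -> moves (-1) f c2 -> long_segments f (between c0 c2).
Proof.
  intros B02 M0 M2.
  destruct (drift0 (sg * fst th0)) as [N0 HN0]. destruct (drift1 (- sg * fst th1)) as [N1 HN1].
  exists 0, (Nat.max N0 N1). intros N HN.
  specialize (HN0 N ltac:(lia)). specialize (HN1 N ltac:(lia)).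
  set (d := fun z => sg * (fst (iter N f z) - fst z)).
  assert (Cd : forall z : pt, continuous d z).
  { intros z. unfold d. assert (Ci := fun z => iter_continuous N f z (ah_f_continuous f g fg)). ctn. }
  assert (Fwd : forall z j, between c0 c2 z -> between c0 c2 (iter j f z)).
  { intros z j Hz. induction j; simpl; auto. destruct IHj as [H0 H2]. split; intros H.
    - apply H0. now apply (moves_side_back f g c0 1 fg E0 S1 M0).
    - apply H2. replace 1 with (- -1) in H |- * by ring.
      now apply (moves_side_back f g c2 (-1) fg E2 Sm M2). }
  apply NNPP. intros Hn.
  assert (Hnz : forall z, between c0 c2 z -> d z <> 0).
  { intros z Hz E. apply Hn. exists z. split; [auto|].
    assert (fst (iter N f z) - fst z = 0) by (unfold d in E; destruct Ssg as [->| ->]; lra).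
    rewrite H, Rabs_R0. lra. }
  assert (Hc0 : forall z, c0 z -> between c0 c2 z).
  { intros z Hz. split; intros H; [now apply (side_not _ _ _ H)|].
    apply (ec_separating c2 E2 z); auto. }
  assert (Hconst : (forall z, c0 z -> 0 < d z) \/ (forall z, c0 z -> ~ 0 < d z)).
  { apply (ec_connected c0 E0).
    - intros k z. unfold d. rewrite iter_Tn by apply fg. simpl.
      replace (fst (iter N f z) + IZR k - (fst z + IZR k)) with (fst (iter N f z) - fst z) by ring. tauto.
    - intros z Hz H. now apply (continuous_gt d).
    - intros z Hz H. assert (Hlt : 0 < 0 - d z) by (assert (A := Hnz z (Hc0 z Hz)); lra).
      generalize (continuous_gt (fun z => 0 - d z) z 0 ltac:(ctn) Hlt).
      apply filter_imp. intros w Hw. lra. }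
  assert (Hpath : forall z, side 1 c0 z -> side (-1) c2 z -> exists w, c0 w /\ (0 < d z <-> 0 < d w)).
  { intros z H0 H2. destruct (between_connected_below z H0 H2) as [p [Cp [p0 [Hp Hp1]]]].
    exists (p 1). split; auto. rewrite <- p0.
    assert (Hz : forall s, 0 <= s <= 1 -> d (p s) <> 0) by (intros; apply Hnz; auto).
    assert (Z0 := Hz 0 ltac:(lra)). assert (Z1 := Hz 1 ltac:(lra)).
    split; intros H; apply Rnot_le_lt; intros Hle;
    destruct (IVT_unit_any (fun s => d (p s)) 0) as [s [Hs Es]]; try (ctn; fail); try lra;
    now apply (Hz s). }
  destruct (Hpath th0) as [w0 [W0 D0]]; auto. destruct (Hpath th1) as [w1 [W1 D1]]; auto.
  assert (P0 : 0 < d th0) by (unfold d; lra).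
  assert (P1 : ~ 0 < d th1) by (unfold d; lra).
  destruct Hconst as [A|A].
  - apply P1, D1, A; auto.
  - apply (A w0); auto. now apply D0.
Qed.

Lemma long_segments_moves_up : (forall z, c0 z -> side (-1) c2 z) ->
  moves 1 f c0 -> (moves 1 f c2 \/ moves (-1) f c2) -> long_segments f (between c0 c2).
Proof. intros B M [H|H]; [now apply long_segments_up|now apply long_segments_in]. Qed.
End Segments.

Lemma long_segments_reverse f g P : (forall z, f (g z) = z) ->
  long_segments g P -> long_segments f P.
Proof.
  intros fg [C [N0 H]]. exists C, N0. intros N HN. destruct (H N HN) as [z [Hz HC]].
  exists (iter N g z). split.
  - intros j Hj. rewrite (iter_cancel_le g f) by auto. apply Hz. lia.
  - rewrite (iter_cancel g f) by auto. now rewrite Rabs_minus_sym.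
Qed.

Lemma between_invariant c c' : essential_continuum c -> essential_continuum c' -> invariant (between c c').
Proof.
  intros E E' k z. unfold between.
  rewrite (side_invariant (-1) c (ec_invariant c E) k z), (side_invariant 1 c' (ec_invariant c' E') k z).
  tauto.
Qed.

Lemma between_closed c c' z : essential_continuum c -> essential_continuum c' ->
  ~ between c c' z -> locally z (fun w => ~ between c c' w).
Proof.
  intros E E' H.
  assert (D : side (-1) c z \/ side 1 c' z) by (apply NNPP; intros Hn; apply H; split; tauto).
  destruct D as [D|D].
  - generalize (side_open (-1) c z (ec_closed c E) D). apply filter_imp. unfold between. tauto.
  - generalize (side_open 1 c' z (ec_closed c' E') D). apply filter_imp. unfold between. tauto.
Qed.

Lemma between_bounded c c' : essential_continuum c -> essential_continuum c' ->
  exists M, forall z, between c c' z -> Rabs (snd z) <= M.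
Proof.
  intros E E'. destruct (ec_far c c' E E') as [M [M0 [HM HM']]]. exists M.
  intros z [H1 H2]. apply Rnot_lt_le. intros Hlt. revert Hlt. unfold Rabs. destruct Rcase_abs; intros Hlt.
  - apply H1, side_far with M; auto; [right; auto|lra].
  - apply H2, side_far with M; auto; [left; auto|lra].
Qed.

Lemma orbit_between_sides f g c c' z : annulus_homeo f g ->
  essential_continuum c -> essential_continuum c' ->
  (forall z, c z -> ~ c (f z)) -> (forall z, c' z -> ~ c' (f z)) ->
  orbit_in f g (between c c') z -> side 1 c z /\ side (-1) c' z.
Proof.
  intros fg E E' F F' H. destruct (H 1%nat) as [[A1 A2] [B1 B2]]. simpl in *.
  split; apply (free_invariant_side f g); auto; try (left; reflexivity); try (right; reflexivity).
  - now replace (- -1) with 1 by ring.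
  - now replace (- -1) with 1 by ring.
Qed.

Section Ordered.
Variables (F : R -> pt -> pt) (G : pt -> pt) (c0 c1 c2 : pt -> Prop) (sg : R).
Hypothesis HF : isotopy_lift F.
Hypothesis GF : forall z, G (F 1 z) = z.
Hypothesis FG : forall z, F 1 (G z) = z.
Hypothesis E0 : essential_continuum c0.
Hypothesis E1 : essential_continuum c1.
Hypothesis E2 : essential_continuum c2.
Hypothesis B01 : forall z, c1 z -> side 1 c0 z.
Hypothesis B12 : forall z, c2 z -> side 1 c1 z.
Hypothesis F0 : forall z, c0 z -> ~ c0 (F 1 z).
Hypothesis F1 : forall z, c1 z -> ~ c1 (F 1 z).
Hypothesis F2 : forall z, c2 z -> ~ c2 (F 1 z).
Hypothesis Ssg : sign sg.
Hypothesis ne0 : exists z, Theta (F 1) G (between c0 c1) z.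
Hypothesis ne1 : exists z, Theta (F 1) G (between c1 c2) z.
Hypothesis rho0 : forall x, rho_set (F 1) (Theta (F 1) G (between c0 c1)) x ->
  exists r, x = Fin r /\ 0 < sg * r.
Hypothesis rho1 : forall x, rho_set (F 1) (Theta (F 1) G (between c1 c2)) x ->
  exists r, x = Fin r /\ 0 < - sg * r.

Let S1 : sign 1. Proof. left; auto. Qed.
Let Sm : sign (-1). Proof. right; auto. Qed.

Lemma ordered_rho : rho_set (F 1) (Theta (F 1) G (between c0 c2)) (Fin 0).
Proof.
  assert (fg := isotopy_annulus_homeo F G HF GF FG).
  destruct (between_bounded c0 c2 E0 E2) as [M HM].
  apply (long_segments_rho (F 1) G _ M); auto using between_invariant, between_closed.
  destruct (between_bounded c0 c1 E0 E1) as [M0 HM0]. destruct (between_bounded c1 c2 E1 E2) as [M1 HM1].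
  destruct ne0 as [th0 T0]. destruct ne1 as [th1 T1].
  destruct (theta_drift (F 1) G _ M0 sg th0 fg Ssg HM0 rho0 T0) as [D0 D0'].
  destruct (theta_drift (F 1) G _ M1 (- sg) th1 fg (sign_opp _ Ssg) HM1 rho1 T1) as [D1 D1'].
  rewrite Ropp_involutive in D1'.
  apply Theta_orbit in T0. apply Theta_orbit in T1.
  assert (O0 : forall z, orbit_in (F 1) G (between c0 c1) z -> side 1 c0 z /\ side (-1) c1 z)
    by (intros; now apply (orbit_between_sides (F 1) G)).
  assert (O1 : forall z, orbit_in (F 1) G (between c1 c2) z -> side 1 c1 z /\ side (-1) c2 z)
    by (intros; now apply (orbit_between_sides (F 1) G)).
  assert (T0f : forall n, orbit_in (F 1) G (between c0 c1) (iter n (F 1) th0))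
    by (intros; now apply orbit_in_iter).
  assert (T0g : forall n, orbit_in (F 1) G (between c0 c1) (iter n G th0))
    by (intros; apply orbit_in_sym, orbit_in_iter; auto using orbit_in_sym).
  assert (T1f : forall n, orbit_in (F 1) G (between c1 c2) (iter n (F 1) th1))
    by (intros; now apply orbit_in_iter).
  assert (T1g : forall n, orbit_in (F 1) G (between c1 c2) (iter n G th1))
    by (intros; apply orbit_in_sym, orbit_in_iter; auto using orbit_in_sym).
  assert (th0_c2 : side (-1) c2 th0).
  { apply (side_opp_beyond c1 c2 1); auto. now apply O0. }
  assert (th1_c0 : side 1 c0 th1).
  { apply (side_beyond c0 c1 1); auto. now apply O1. }
  assert (B02 : forall z, c0 z -> side (-1) c2 z).
  { intros z Hz. apply (side_opp_beyond c1 c2 1); auto. now apply (beyond_opp c0 c1 1). }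
  assert (m1 := free_moves (F 1) G c1 fg E1 F1). assert (m2 := free_moves (F 1) G c2 fg E2 F2).
  destruct (free_moves (F 1) G c0 fg E0 F0) as [m0|m0].
  - apply (long_segments_moves_up F (F 1) G c0 c1 c2 sg th0 th1); auto;
      first [now apply O0 | now apply O1 | intros n; now apply O0 | intros n; now apply O1].
  (* The inverse moves [c0] up. It is treated with [- sg], because time reversal changes the
     direction of every drift. *)
  - apply (long_segments_reverse (F 1) G); auto.
    assert (inv : forall c, essential_continuum c -> moves 1 (F 1) c \/ moves (-1) (F 1) c ->
      moves 1 G c \/ moves (-1) G c).
    { intros c E [m|m].
      - right. exact (moves_inverse (F 1) G c 1 fg E S1 m).
      - left. assert (m' := moves_inverse (F 1) G c (-1) fg E Sm m).
        now replace (- -1) with 1 in m' by ring. }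
    assert (HR := isotopy_reverse F G HF GF FG).
    apply (long_segments_moves_up (fun t z => F (1 - t) (G z)) G (F 1) c0 c1 c2 (- sg) th0 th1);
      auto using annulus_homeo_sym, sign_opp;
      try first [now apply O0 | now apply O1 | intros n; now apply O0 | intros n; now apply O1].
    + apply functional_extensionality. intros z. replace (1 - 1) with 0 by ring. now apply isotopy_0.
    + now rewrite Ropp_involutive.
    + assert (m' := moves_inverse (F 1) G c0 (-1) fg E0 Sm m0).
      now replace (- -1) with 1 in m' by ring.
Qed.
End Ordered.

(** * Reduction to vertically ordered curves *)

Lemma Theta_ext f g (P P' : pt -> Prop) z : (forall z, P z <-> P' z) -> Theta f g P z -> Theta f g P' z.
Proof. intros E [H0 H]. split; [now apply E|]. intros n. now apply E. Qed.

Lemma rho_set_ext f (P P' : pt -> Prop) x : (forall z, P z <-> P' z) -> rho_set f P x -> rho_set f P' x.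
Proof.
  intros E H m Hm. specialize (H m Hm).
  assert (R : forall y, rho_vals f P m y -> rho_vals f P' m y).
  { intros y [n [z [H1 [H2 [H3 H4]]]]]. exists n, z. rewrite <- !E. auto. }
  destruct x; simpl in *.
  - intros e He. destruct (H e He) as [s [Hs Hd]]. eauto.
  - intros M. destruct (H M) as [s [Hs Hd]]. eauto.
  - intros M. destruct (H M) as [s [Hs Hd]]. eauto.
Qed.

Theorem theoremC
  (F : R -> pt -> pt) (G : pt -> pt) (g0 g1 g2 : pt -> Prop)
  (HI : isotopy_lift F)
  (HG : forall z, G (F 1 z) = z /\ F 1 (G z) = z)
  (Hj0 : jordanA g0) (Hj1 : jordanA g1) (Hj2 : jordanA g2)
  (He0 : essentialA g0) (He1 : essentialA g1) (He2 : essentialA g2)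
  (Hd01 : disjointA g0 g1) (Hd12 : disjointA g1 g2) (Hd02 : disjointA g0 g2)
  (Hf0 : forall z, g0 z -> ~ g0 (F 1 z))
  (Hf1 : forall z, g1 z -> ~ g1 (F 1 z))
  (Hf2 : forall z, g2 z -> ~ g2 (F 1 z))
  (Hsep : separatesA g1 g0 g2)
  (Hne0 : exists z, Theta (F 1) G (closed_annulus g0 g1) z)
  (Hne1 : exists z, Theta (F 1) G (closed_annulus g1 g2) z)
  (Hrho :
     ((forall x, rho_set (F 1) (Theta (F 1) G (closed_annulus g0 g1)) x -> in_pos x) /\
      (forall x, rho_set (F 1) (Theta (F 1) G (closed_annulus g1 g2)) x -> in_neg x)) \/
     ((forall x, rho_set (F 1) (Theta (F 1) G (closed_annulus g0 g1)) x -> in_neg x) /\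
      (forall x, rho_set (F 1) (Theta (F 1) G (closed_annulus g1 g2)) x -> in_pos x))) :
  rho_set (F 1)
    (Theta (F 1) G (unionA (closed_annulus g0 g1) (closed_annulus g1 g2)))
    (Fin 0).
Proof.
  assert (E0 := essential_jordan_continuum g0 Hj0 He0).
  assert (E1 := essential_jordan_continuum g1 Hj1 He1).
  assert (E2 := essential_jordan_continuum g2 Hj2 He2).
  assert (GF : forall z, G (F 1 z) = z) by apply HG.
  assert (FG : forall z, F 1 (G z) = z) by apply HG.
  assert (S1 : sign 1) by (left; auto). assert (Sm : sign (-1)) by (right; auto).
  assert (Hrho' : exists sg, sign sg /\
    (forall x, rho_set (F 1) (Theta (F 1) G (closed_annulus g0 g1)) x -> exists r, x = Fin r /\ 0 < sg * r) /\
    (forall x, rho_set (F 1) (Theta (F 1) G (closed_annulus g1 g2)) x -> exists r, x = Fin r /\ 0 < - sg * r)).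
  { destruct Hrho as [[A B]|[A B]]; [exists 1|exists (-1)]; (split; [auto|]);
    split; intros x Hx; [destruct (A x Hx) as [r [-> Hr]]|destruct (B x Hx) as [r [-> Hr]]
      |destruct (A x Hx) as [r [-> Hr]]|destruct (B x Hx) as [r [-> Hr]]]; exists r; split; auto; lra. }
  destruct Hrho' as [sg [Ssg [R0 R1]]].
  (* Points on the same side of [g1] lie in one component of its complement, which [separatesA]
     forbids for [g0] and [g2]. *)
  assert (Hsame : forall s, sign s -> (forall z, g0 z -> side s g1 z) -> (forall z, g2 z -> side s g1 z) -> False).
  { intros s Ss H0 H2. destruct (ec_nonempty g0 E0) as [z0 Hz0]. destruct (ec_nonempty g2 E2) as [z2 Hz2].
    destruct (ec_bounded g1 E1) as [M [_ HM]].
    assert (XZ : forall w, complA g1 w <-> ~ g1 w) by (unfold complA; tauto).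
    assert (N0 : ~ g1 z0) by (apply (side_not s); auto).
    apply (Hsep _ (component_exists g1 (complA g1) (ec_invariant g1 E1) (ec_closed g1 E1) XZ z0 N0)).
    split.
    - exists z0. split; auto. exists 0%Z. rewrite Tn_0. now apply reach_refl.
    - exists z2. split; auto. exists 0%Z. rewrite Tn_0. apply (side_connected g1 s z0 z2 M); auto. }
  (* [s = 1] if [g0] is the lowest curve, [s = -1] if it is the highest one. *)
  assert (exists s, sign s /\ (forall z, g1 z -> side s g0 z) /\ (forall z, g2 z -> side s g1 z)) as [s [Ss [B01 B12]]].
  { destruct (ec_dichotomy g1 g2 E1 E2 Hd12) as [A|A];
    (destruct (ec_dichotomy g1 g0 E1 E0) as [B|B]; [intros z H1 H0; now apply (Hd01 z)| |]).
    - exfalso. now apply (Hsame 1).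
    - exists 1. split; auto. split; auto. intros z Hz. replace 1 with (- -1) by ring.
      now apply (beyond_opp g1 g0 (-1)).
    - exists (-1). split; auto. split; auto. intros z Hz. now apply (beyond_opp g1 g0 1).
    - exfalso. now apply (Hsame (-1)). }
  assert (A0 := fun z => closed_annulus_sides g0 g1 s z Ss E0 E1 B01).
  assert (A1 := fun z => closed_annulus_sides g1 g2 s z Ss E1 E2 B12).
  (* A point on neither outer side is in one annulus or the other according to whether it belongs to
     [side s g1]. *)
  assert (AU : forall z, unionA (closed_annulus g0 g1) (closed_annulus g1 g2) z <->
    ~ side (- s) g0 z /\ ~ side s g2 z).
  { intros z. unfold unionA. rewrite A0, A1. split.
    - intros [[H1 H2]|[H1 H2]]; split; auto.
      + intros H. apply H2. now apply (side_beyond g1 g2 s).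
      + intros H. apply H1. now apply (side_opp_beyond g0 g1 s).
    - intros [H1 H2]. destruct (classic (side s g1 z)) as [H|H]; [right|left]; split; auto.
      intros H'. now apply (ec_sides g1 s z). }
  destruct Ss as [->| ->].
  - assert (Q0 : forall z, closed_annulus g0 g1 z <-> between g0 g1 z) by exact A0.
    assert (Q1 : forall z, closed_annulus g1 g2 z <-> between g1 g2 z) by exact A1.
    apply rho_set_ext with (Theta (F 1) G (between g0 g2)).
    { intros z. split; apply Theta_ext; intros w; [symmetry|]; apply AU. }
    apply (ordered_rho F G g0 g1 g2 sg); auto.
    + destruct Hne0 as [z Hz]. exists z. revert Hz. now apply Theta_ext.
    + destruct Hne1 as [z Hz]. exists z. revert Hz. now apply Theta_ext.
    + intros x Hx. apply R0. revert Hx. apply rho_set_ext. intros z.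
      split; apply Theta_ext; intros w; [symmetry|]; apply Q0.
    + intros x Hx. apply R1. revert Hx. apply rho_set_ext. intros z.
      split; apply Theta_ext; intros w; [symmetry|]; apply Q1.
  - assert (mm : - -1 = 1) by ring. rewrite mm in *.
    assert (Q0 : forall z, closed_annulus g0 g1 z <-> between g1 g0 z).
    { intros z. rewrite A0. unfold between. tauto. }
    assert (Q1 : forall z, closed_annulus g1 g2 z <-> between g2 g1 z).
    { intros z. rewrite A1. unfold between. tauto. }
    assert (QU : forall z, unionA (closed_annulus g0 g1) (closed_annulus g1 g2) z <-> between g2 g0 z).
    { intros z. rewrite AU. unfold between. tauto. }
    apply rho_set_ext with (Theta (F 1) G (between g2 g0)).
    { intros z. split; apply Theta_ext; intros w; [symmetry|]; apply QU. }
    (* The lower annulus is now the one between [g2] and [g1], whose drift has the sign [- sg]. *)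
    apply (ordered_rho F G g2 g1 g0 (- sg)); auto using sign_opp.
    + intros z Hz. rewrite <- mm. now apply (beyond_opp g1 g2 (-1)).
    + intros z Hz. rewrite <- mm. now apply (beyond_opp g0 g1 (-1)).
    + destruct Hne1 as [z Hz]. exists z. revert Hz. now apply Theta_ext.
    + destruct Hne0 as [z Hz]. exists z. revert Hz. now apply Theta_ext.
    + intros x Hx. apply R1. revert Hx. apply rho_set_ext. intros z.
      split; apply Theta_ext; intros w; [symmetry|]; apply Q1.
    + intros x Hx. rewrite Ropp_involutive. apply R0. revert Hx. apply rho_set_ext. intros z.
      split; apply Theta_ext; intros w; [symmetry|]; apply Q0.
Qed.
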